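(* Let $a\in\mathbb Z_+=\{0,1,2,\dots\}$ and $b\ge0$ be such that either (i) $a=b=0$ or (ii) $\gamma a+b>0$ holds. Assume $$0<\delta<\min\{\tfrac12,\gamma a+b\}\ \text{ if }\gamma a+b>0,\qquad 0<\delta<\min\{\tfrac12,\gamma\}\ \text{ if }a=b=0 .$$ Then there exists a constant $N=N(d,a,b,\gamma,\nu,\delta)$ such that $$\sup_{s<t}\int_{\mathbb R^d}\Big||x|^{\frac d2+\delta}q_{a,b}(s,t,x)\Big|^2dx\le N .$$
   Context: Standing assumptions: $d\in\mathbb N$, $\gamma\in(0,\infty)$, $\nu>0$, and $\psi:\mathbb R\times\mathbb R^d\to\mathbb C$ is measurable with $\Re[\psi(t,\xi)]\le-\nu|\xi|^\gamma$ for all $(t,\xi)$ and $|D_\xi^\alpha\psi(t,\xi)|\le\nu^{-1}|\xi|^{\gamma-|\alpha|}$ for all $t\in\mathbb R$, $\xi\neq0$, $|\alpha|\le\lfloor d/2\rfloor+1$. For $s<t$, $$q_{a,b}(s,t,x)=\mathcal F^{-1}\Big[\big((t-s)\psi(t,(t-s)^{-1/\gamma}\xi)\big)^a|\xi|^b\exp\Big(\int_s^t\psi(r,(t-s)^{-1/\gamma}\xi)\,dr\Big)\Big](x),$$ where $\mathcal F^{-1}[g](x)=(2\pi)^{-d}\int_{\mathbb R^d}e^{i\xi\cdot x}g(\xi)\,d\xi$. (A zeroth power is $1$.) *)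

(* Defs.v *)
From HB Require Import structures.
From mathcomp Require Import all_boot all_order all_algebra.
From mathcomp Require Import all_classical all_reals all_analysis complex.

Set Implicit Arguments.
Unset Strict Implicit.
Unset Printing Implicit Defensive.

Import Order.TTheory GRing.Theory Num.Theory.
Import numFieldNormedType.Exports.

Local Open Scope classical_set_scope.
Local Open Scope ring_scope.
Local Open Scope complex_scope.

Local Notation Re := complex.Re.
Local Notation Im := complex.Im.

(* R^d is d.-tuple R with the library's product sigma-algebra.  The library has
   no Lebesgue measure on it; lebesgue_tuple d is obtained by recursion on d,
   as the image of lebesgue_measure \x lebesgue_tuple d.-1 by (h, x) |-> h :: x.
   lebesgue_tuple_box is its usual characterization on boxes. *)
Section lebesgue_tuple.
Variable R : realType.

Definition cons_pair n (p : R * n.-tuple R) : n.+1.-tuple R :=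
  [tuple of p.1 :: p.2].

Lemma measurable_cons_pair n : measurable_fun [set: R * n.-tuple R] (@cons_pair n).
Proof. exact: measurable_cons. Qed.

Section step.
Variables (n : nat) (mu : {sigma_finite_measure set (n.-tuple R) -> \bar R}).

Definition lebesgue_cons : set (n.+1.-tuple R) -> \bar R :=
  pushforward ((@lebesgue_measure R) \x mu)%E (@cons_pair n).

Let mcons := @measurable_cons_pair n.

Let lebesgue_cons0 : lebesgue_cons set0 = 0%E.
Proof. exact: measure0. Qed.

Let lebesgue_cons_ge0 A : (0 <= lebesgue_cons A)%E.
Proof. exact: measure_ge0. Qed.

Let lebesgue_cons_sigma_additive : semi_sigma_additive lebesgue_cons.
Proof. exact: measure_semi_sigma_additive. Qed.

HB.instance Definition _ := isMeasure.Build _ _ _ lebesgue_cons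
  lebesgue_cons0 lebesgue_cons_ge0 lebesgue_cons_sigma_additive.

Lemma lebesgue_cons_sigma_finite : sigma_finite setT lebesgue_cons.
Proof.
pose uncons (x : n.+1.-tuple R) : R * n.-tuple R := (thead x, [tuple of behead x]).
have muncons : measurable_fun [set: n.+1.-tuple R] uncons.
  apply: measurable_fun_pair; first exact: measurable_tnth.
  exact: measurable_behead.
have consK p : uncons (cons_pair p) = p.
  by case: p => h x; congr pair; apply: val_inj.
have /sigma_finiteP[F [FT ndF Foo]] := sigma_finiteT (@lebesgue_measure R).
have /sigma_finiteP[G [GT ndG Goo]] := sigma_finiteT mu.
exists (fun k => uncons @^-1` (F k `*` G k)).
  rewrite -preimage_bigcup -(preimage_setT uncons); congr (_ @^-1` _).
  rewrite -setXTT FT GT; apply/seteqP; split => -[x y] /=.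
    move=> [[k _ Fk] [l _ Gl]]; exists (maxn k l) => //; split.
    - by move: x Fk; exact/subsetPset/ndF/leq_maxl.
    - by move: y Gl; exact/subsetPset/ndG/leq_maxr.
  by move=> [k _ []/= ? ?]; split; exists k.
move=> k; have [mF Fk] := Foo k; have [mG Gk] := Goo k; split.
  by rewrite -[X in measurable X]setTI; apply: muncons => //; exact: measurableX.
rewrite /lebesgue_cons /pushforward.
rewrite (_ : _ @^-1` _ = F k `*` G k); last first.
  by apply/seteqP; split => p; rewrite /preimage /mkset consK.
by rewrite product_measure1E// lte_mul_pinfty// ge0_fin_numE.
Qed.

HB.instance Definition _ := @Measure_isSigmaFinite.Build _ _ _
  lebesgue_cons lebesgue_cons_sigma_finite.

End step.

Fixpoint lebesgue_tuple n :
    {sigma_finite_measure set (n.-tuple R) -> \bar R} :=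
  if n is m.+1 then lebesgue_cons (lebesgue_tuple m)
  else \d_ ([tuple] : 0.-tuple R).

Lemma lebesgue_tuple_box n (A : 'I_n -> set R) : (forall i, measurable (A i)) ->
  lebesgue_tuple n [set x | forall i, A i (tnth x i)] =
  (\prod_(i < n) lebesgue_measure (A i))%E.
Proof.
elim: n A => [|n IH] A mA.
  rewrite big_ord0 /= diracE mem_set//.
  by move=> [].
have mbox m (B : 'I_m -> set R) : (forall i, measurable (B i)) ->
    measurable [set x : m.-tuple R | forall i, B i (tnth x i)].
  move=> mB.
  rewrite (_ : [set x | _] = \bigcap_(i in [set: 'I_m]) (@tnth m R ^~ i @^-1` B i)).
    apply: fin_bigcap_measurable => // i _.
    by rewrite -[X in measurable X]setTI; exact: measurable_tnth.
  by apply/seteqP; split => [x Bx i _|x Bx i]; exact: Bx.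
rewrite big_ord_recl /= /lebesgue_cons /pushforward.
rewrite -(IH (fun i => A (lift ord0 i)))//.
have mB := mbox n (fun i => A (lift ord0 i)) (fun i => mA _).
apply: etrans (product_measure1E (@lebesgue_measure R) (lebesgue_tuple n)
  (mA ord0) mB).
congr product_measure1; apply/seteqP; split => [[h x] /= H|[h x] [/= Hh H] i].
  split => [|i]; first exact: (H ord0).
  by have := H (lift ord0 i); rewrite tnthS.
have [->//|i0] := eqVneq i ord0.
by case: (unliftP ord0 i) i0 => [j ->|->]; rewrite ?eqxx// tnthS.
Qed.
End lebesgue_tuple.

Section euclidean.
Variables (R : realType) (d : nat).
Implicit Types x y : d.-tuple R.

Definition dotp x y : R := \sum_(i < d) tnth x i * tnth y i.

Definition enorm x : R := Num.sqrt (dotp x x).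

Definition tscale (c : R) x : d.-tuple R := [tuple c * tnth x i | i < d].

Definition tzero : d.-tuple R := [tuple 0 | i < d].

Definition set_coord x (i : 'I_d) (h : R) : d.-tuple R :=
  [tuple if j == i then h else tnth x j | j < d].

End euclidean.

Section complex_valued.
Variable R : realType.

Definition cexp (z : R[i]) : R[i] :=
  (expR (Re z))%:C * (cos (Im z) +i* sin (Im z)).

Definition cintegral (disp : measure_display) (T : measurableType disp)
    (mu : {measure set T -> \bar R}) (D : set T) (f : T -> R[i]) : R[i] :=
  (\int[mu]_(x in D) Re (f x))%R +i* (\int[mu]_(x in D) Im (f x))%R.

Definition cmeasurable (disp : measure_display) (T : measurableType disp)
    (f : T -> R[i]) : Prop :=
  measurable_fun [set: T] (fun x => Re (f x) : R) /\
  measurable_fun [set: T] (fun x => Im (f x) : R).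

Variable d : nat.

Definition inverse_fourier (g : d.-tuple R -> R[i]) (x : d.-tuple R) : R[i] :=
  ((2 * pi) ^- d)%:C *
  cintegral (lebesgue_tuple R d) setT (fun xi => cexp (dotp xi x)*i * g xi).

Definition ex_partial (i : 'I_d) (f : d.-tuple R -> R[i]) (x : d.-tuple R) :
    Prop :=
  derivable (fun h : R => Re (f (set_coord x i h)) : R) (tnth x i) 1 /\
  derivable (fun h : R => Im (f (set_coord x i h)) : R) (tnth x i) 1.

Definition partial (i : 'I_d) (f : d.-tuple R -> R[i]) (x : d.-tuple R) :
    R[i] :=
  derive1 (fun h : R => Re (f (set_coord x i h)) : R) (tnth x i) +i*
  derive1 (fun h : R => Im (f (set_coord x i h)) : R) (tnth x i).

(* A multi-index alpha is a d-tuple of naturals, and D^alpha is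
   d_1^alpha_1 ... d_d^alpha_d, encoded by the word 1..1 2..2 ... d..d whose
   last letter is differentiated first. *)
Definition msize (alpha : d.-tuple nat) : nat := (\sum_(i < d) tnth alpha i)%N.

Definition mword (alpha : d.-tuple nat) : seq 'I_d :=
  flatten [seq nseq (tnth alpha i) i | i <- enum 'I_d].

Definition partials (w : seq 'I_d) (f : d.-tuple R -> R[i]) :
    d.-tuple R -> R[i] := foldr partial f w.

Definition mderiv (alpha : d.-tuple nat) (f : d.-tuple R -> R[i]) :
    d.-tuple R -> R[i] := partials (mword alpha) f.

Definition ex_mderiv (alpha : d.-tuple nat) (f : d.-tuple R -> R[i])
    (x : d.-tuple R) : Prop :=
  forall (w1 w2 : seq 'I_d) (i : 'I_d), mword alpha = w1 ++ i :: w2 ->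
    ex_partial i (partials w2 f) x.

(* Since derive1 is total, the derivatives in the bound are also required to
   exist in the classical sense away from the origin. *)
Definition symbol_assumptions (gamma nu : R) (psi : R -> d.-tuple R -> R[i]) :
    Prop :=
  [/\ cmeasurable (fun p : R * d.-tuple R => psi p.1 p.2),
      forall t xi, Re (psi t xi) <= - nu * enorm xi `^ gamma,
      forall (alpha : d.-tuple nat) t xi, (msize alpha <= d./2 + 1)%N ->
        xi != tzero R d -> ex_mderiv alpha (psi t) xi &
      forall (alpha : d.-tuple nat) t xi, (msize alpha <= d./2 + 1)%N ->
        xi != tzero R d ->
        Normc.normc (mderiv alpha (psi t) xi) <=
          nu^-1 * enorm xi `^ (gamma - (msize alpha)%:R)].

Definition q_kernel (gamma : R) (psi : R -> d.-tuple R -> R[i]) (a : nat)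
    (b s t : R) : d.-tuple R -> R[i] :=
  inverse_fourier (fun xi =>
    let eta := tscale ((t - s) `^ (- (1 / gamma))) xi in
    ((t - s)%:C * psi t eta) ^+ a * (enorm xi `^ b)%:C *
    cexp (cintegral (@lebesgue_measure R) `[s, t] (psi ^~ eta))).

End complex_valued.

(* Main.v *)
Require Import Defs.
From mathcomp Require Import all_boot all_order all_algebra.
From mathcomp Require Import all_classical all_reals all_analysis complex.
From mathcomp Require Import measurable_realfun ring lra.

(* Let q be the inverse Fourier transform of the symbol g, let k = d/2 + 1
   (integer division), and let D be the difference operator with step y in the
   direction e_i.  Then D^k g has inverse Fourier transform
   (exp(- i y x_i) - 1)^k q, whose modulus is comparable to |q| where |x_i| is
   between 1/y and 2/y, so the Bessel inequality bounds the L^2 norm of q there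
   by that of D^k g.  Fix beta with delta < beta < 1/2, beta <= gamma a + b
   (beta <= gamma if a = b = 0).  The symbol satisfies |g - g(0)| <= C |xi|^beta
   and |d_i^k g| <= C |xi|^(beta - k) uniformly in s < t and psi; using the first
   bound on |xi| < 2ky and the mean value theorem with the second one elsewhere,
   ||D^k g||^2 <= C y^(d + 2 beta).  Summing over y = 2^-j with the weight
   |x_i|^(d + 2 delta) gives a geometric series.  Only the pure derivatives
   d_i^j psi enter, along lines parallel to the axes.

   The Bessel inequality is proved with the weight prod_i exp(- e |x_i|), whose
   Fourier transform is a product of Poisson kernels of fixed L^1 norm; Schur's
   test gives a bound independent of e, and e goes to 0. *)

Set Implicit Arguments.
Unset Strict Implicit.
Unset Printing Implicit Defensive.

Import Order.TTheory GRing.Theory Num.Theory.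
Import numFieldNormedType.Exports.

Local Open Scope classical_set_scope.
Local Open Scope ring_scope.

(** * Lebesgue measure on tuples *)

(** Derivatives of order k cannot replace differences: since 2 (k - beta) > d, the bound |xi|^(beta
    - k) is not square integrable at the origin, and the weight has the non-integer order d/2 +
    delta. A difference of step y blurs the origin at scale y, and the sum over dyadic y recovers
    the fractional order. The same condition 2 (k - beta) > d makes the tail of |xi|^(2 (beta - k))
    integrable; as 2k >= d + 1, with equality for odd d, beta < 1/2 suffices, and this is where
    delta < 1/2 enters.

    Uniformity in s < t comes from scaling: with lam = (t - s)^(-1/gamma) one has lam^gamma (t - s)
    = 1, so every bound on the rescaled symbol is free of s and t.

    On a line parallel to an axis the symbol is a function of one real variable; membership in a
    class [sym], with a weight depending on |xi|, passes through products, exponentials and time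
    integrals. No size bound on psi is available at the origin, so the symbol is altered there, on a
    null set. *)

Section lebesgue_affine.
Variable R : realType.
Local Notation mu := (@lebesgue_measure R).

Lemma lebesgue_measure_translation (c : R) (A : set R) : measurable A ->
  pushforward mu ((fun x => x + c) : _ -> measurableTypeR R) A = mu A.
Proof.
move=> mA; have mc : measurable_fun [set: R] ((fun x => x + c) : _ -> measurableTypeR R).
  exact: measurable_funD.
apply/esym/lebesgue_measure_unique => //= _ [[a b] _ <-] /=.
rewrite /pushforward.
rewrite (_ : _ @^-1` _ = `]a - c, b - c]%classic); last first.
  apply/seteqP; split => x /=; rewrite !in_itv/= => /andP[h1 h2]; apply/andP; split; lra.
rewrite !lebesgue_measure_itv/= !lte_fin ltrD2r.
by case: ifP => // ab; rewrite -!EFinD; congr EFin; lra.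
Qed.

Local Open Scope ereal_scope.

Lemma ge0_integral_translation (c : R) (f : R -> \bar R) :
  measurable_fun setT f -> (forall x, 0 <= f x) ->
  \int[mu]_x f (x + c)%R = \int[mu]_x f x.
Proof.
move=> mf f0.
have mc : measurable_fun [set: R] ((fun x => x + c)%R : _ -> measurableTypeR R).
  exact: measurable_funD.
have := @ge0_integral_pushforward _ _ (measurableTypeR R) (measurableTypeR R) R
  (fun x => x + c)%R mc mu setT f measurableT mf (fun x _ => f0 x).
rewrite preimage_setT => /esym ->.
by apply: eq_measure_integral => //= A mA _; exact: lebesgue_measure_translation.
Qed.

Lemma ge0_integral_reflection (f : R -> \bar R) : measurable_fun setT f ->
  (forall x, 0 <= f x) -> \int[mu]_x f (- x)%R = \int[mu]_x f x.
Proof.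
move=> mf f0.
have mN : measurable_fun [set: R] (-%R : _ -> measurableTypeR R) by [].
have := @ge0_integral_pushforward _ _ (measurableTypeR R) (measurableTypeR R) R
  -%R mN mu setT f measurableT mf (fun x _ => f0 x).
rewrite preimage_setT => /esym ->.
by apply: eq_measure_integral => //= A mA _; exact: lebesgue_measureN.
Qed.

Lemma integral_reflection (f : R -> \bar R) : measurable_fun setT f ->
  \int[mu]_x f (- x)%R = \int[mu]_x f x.
Proof.
move=> mf; rewrite integralE [RHS]integralE; congr (_ - _).
- rewrite -[RHS]ge0_integral_reflection//; first by apply: eq_integral => x _; rewrite ?funeposE ?funenegE.
  exact: measurable_funepos.
- rewrite -[RHS]ge0_integral_reflection//; first by apply: eq_integral => x _; rewrite ?funeposE ?funenegE.
  exact: measurable_funeneg.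
Qed.

End lebesgue_affine.

Section tuple_measure.
Variable R : realType.

Lemma measurable_tuple_fun (dT : measure_display) (T : measurableType dT) n
    (F : 'I_n -> T -> R) :
  (forall i, measurable_fun setT (F i)) ->
  measurable_fun setT (fun t => [tuple F i t | i < n]).
Proof.
move=> mF; apply/measurable_fun_tnthP => i.
by apply: eq_measurable_fun (mF i) => x _ /=; rewrite tnth_mktuple.
Qed.

Lemma measurable_dotp n (dT : measure_display) (T : measurableType dT)
    (f g : T -> n.-tuple R) :
  measurable_fun setT f -> measurable_fun setT g ->
  measurable_fun setT (fun x => dotp (f x) (g x)).
Proof.
move=> mf mg; apply: measurable_sum => i; apply: measurable_funM.
- by move/measurable_fun_tnthP : mf => /(_ i).
- by move/measurable_fun_tnthP : mg => /(_ i).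
Qed.

Lemma measurable_enorm n : measurable_fun setT (@enorm R n).
Proof.
apply: measurableT_comp; first by apply: continuous_measurable_fun; exact: sqrt_continuous.
exact: measurable_dotp.
Qed.

Definition tadd n (x y : n.-tuple R) : n.-tuple R :=
  [tuple tnth x i + tnth y i | i < n].

Lemma measurable_tadd n (y : n.-tuple R) :
  measurable_fun setT (fun x : n.-tuple R => tadd x y).
Proof.
apply: measurable_tuple_fun => i; apply: measurable_funD => //.
exact: measurable_tnth.
Qed.

Lemma measurable_tscale n c : measurable_fun setT (@tscale R n c).
Proof.
apply: measurable_tuple_fun => i; apply: measurable_funM => //.
exact: measurable_tnth.
Qed.

Lemma cons_pair_tadd n (h : R) (x : n.-tuple R) (y : n.+1.-tuple R) :
  tadd (cons_pair (h, x)) y =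
  cons_pair (h + thead y, tadd x [tuple of behead y]).
Proof.
apply: eq_from_tnth => i; rewrite tnth_mktuple.
case: (unliftP ord0 i) => [j ->|->]; last by rewrite !tnth0.
rewrite /cons_pair !tnthS tnth_mktuple; congr (_ + _).
by rewrite tnth_behead; congr tnth; apply: val_inj; rewrite /= inordK// ltnS.
Qed.

Local Open Scope ereal_scope.

Lemma ge0_integral_tupleS n (f : n.+1.-tuple R -> \bar R) :
  measurable_fun setT f -> (forall x, 0 <= f x) ->
  \int[lebesgue_tuple R n.+1]_x f x =
  \int[@lebesgue_measure R]_h \int[lebesgue_tuple R n]_x f (cons_pair (h, x)).
Proof.
move=> mf f0; have mc := @measurable_cons_pair R n.
have := @ge0_integral_pushforward _ _ (measurableTypeR R * n.-tuple R)%type _ R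
  _ mc ((@lebesgue_measure R) \x (lebesgue_tuple R n)) setT f measurableT mf
  (fun x _ => f0 x).
rewrite preimage_setT => E; rewrite [LHS]E.
by rewrite fubini_tonelli1//; [exact: measurableT_comp|move=> x; exact: f0].
Qed.

Lemma measurable_ge0_integral_cons n (f : n.+1.-tuple R -> \bar R) :
  measurable_fun setT f -> (forall x, 0 <= f x) ->
  measurable_fun setT
    (fun h : R => \int[lebesgue_tuple R n]_x f (cons_pair (h, x))).
Proof.
move=> mf f0; have mc := @measurable_cons_pair R n.
apply: (measurable_fun_fubini_tonelli_F (f \o (@cons_pair R n))).
  exact: measurableT_comp.
by move=> x; exact: f0.
Qed.

Lemma ge0_integral_tadd n (y : n.-tuple R) (f : n.-tuple R -> \bar R) :
  measurable_fun setT f -> (forall x, 0 <= f x) ->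
  \int[lebesgue_tuple R n]_x f (tadd x y) = \int[lebesgue_tuple R n]_x f x.
Proof.
elim: n y f => [|n IH] y f mf f0.
  by apply: eq_integral => x _; rewrite (tuple0 (tadd x y)) (tuple0 x).
have mty := measurable_tadd y.
rewrite ge0_integral_tupleS//; last exact: (measurableT_comp mf).
rewrite [RHS]ge0_integral_tupleS//.
have mx h : measurable_fun setT (fun x : n.-tuple R => f (cons_pair (h, x))).
  apply: (@measurable_fun_pair2 _ _ _ R _ _ (f \o @cons_pair R n)).
  exact: (measurableT_comp mf (@measurable_cons_pair R n)).
rewrite -[RHS](ge0_integral_translation (thead y)); last 2 first.
- exact: measurable_ge0_integral_cons.
- by move=> h; exact: integral_ge0.
apply: eq_integral => h _.
rewrite -[RHS](IH [tuple of behead y])//.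
by apply: eq_integral => x _; rewrite cons_pair_tadd.
Qed.

Lemma integral_tadd n (y : n.-tuple R) (f : n.-tuple R -> \bar R) :
  measurable_fun setT f ->
  \int[lebesgue_tuple R n]_x f (tadd x y) = \int[lebesgue_tuple R n]_x f x.
Proof.
move=> mf; rewrite integralE [RHS]integralE; congr (_ - _).
- rewrite -[RHS](ge0_integral_tadd y)//; first by apply: eq_integral => x _; rewrite ?funeposE ?funenegE.
  exact: measurable_funepos.
- rewrite -[RHS](ge0_integral_tadd y)//; first by apply: eq_integral => x _; rewrite ?funeposE ?funenegE.
  exact: measurable_funeneg.
Qed.

Lemma measurable_box n (A : 'I_n -> set R) : (forall i, measurable (A i)) ->
  measurable [set x : n.-tuple R | forall i, A i (tnth x i)].
Proof.
move=> mA.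
rewrite (_ : [set x | _] = \bigcap_(i in [set: 'I_n]) (@tnth n R ^~ i @^-1` A i)).
  apply: fin_bigcap_measurable => // i _.
  by rewrite -[X in measurable X]setTI; exact: measurable_tnth.
by apply/seteqP; split => [x Bx i _|x Bx i]; exact: Bx.
Qed.

End tuple_measure.

(** * The Euclidean norm and the volume of balls *)

Section enorm_theory.
Variables (R : realType) (d : nat).
Implicit Types x y : d.-tuple R.

Lemma dotpp_ge0 x : 0 <= dotp x x.
Proof. by apply: sumr_ge0 => i _; rewrite -expr2 sqr_ge0. Qed.

Lemma enorm_ge0 x : 0 <= enorm x.
Proof. exact: sqrtr_ge0. Qed.

Lemma sqr_enorm x : enorm x ^+ 2 = dotp x x.
Proof. by rewrite sqr_sqrtr// dotpp_ge0. Qed.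

Lemma le_tnth_enorm x i : `|tnth x i| <= enorm x.
Proof.
rewrite -(@ler_pXn2r _ 2) ?nnegrE ?enorm_ge0// sqr_enorm real_normK ?num_real//.
rewrite /dotp (bigD1 i)//= expr2 lerDl; apply: sumr_ge0 => j _.
by rewrite -expr2 sqr_ge0.
Qed.

Lemma enorm_tzero : enorm (tzero R d) = 0.
Proof.
rewrite /enorm /dotp big1 ?sqrtr0// => i _.
by rewrite tnth_mktuple mul0r.
Qed.

Lemma enorm_eq0 x : (enorm x == 0) = (x == tzero R d).
Proof.
apply/eqP/eqP => [x0|->]; last exact: enorm_tzero.
apply: eq_from_tnth => i; rewrite tnth_mktuple; apply/eqP.
by rewrite -normr_le0 -x0 le_tnth_enorm.
Qed.

Lemma enorm_gt0 x : (0 < enorm x) = (x != tzero R d).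
Proof. by rewrite lt_def enorm_ge0 andbT enorm_eq0. Qed.

Lemma enorm_tscale c x : enorm (tscale c x) = `|c| * enorm x.
Proof.
rewrite /enorm -sqrtr_sqr -sqrtrM ?sqr_ge0//; congr Num.sqrt.
rewrite /dotp mulr_sumr; apply: eq_bigr => i _; rewrite !tnth_mktuple.
ring.
Qed.

(** The ball lies in a cube of side 2r. Only the order r^d matters later, so the exact volume is not
    computed. *)
Lemma lebesgue_tuple_ball (r : R) : 0 < r ->
  (lebesgue_tuple R d [set x | enorm x <= r]%R <= ((2 * r) ^+ d)%R%:E)%E.
Proof.
move=> r0.
have m1 : measurable [set x : d.-tuple R | enorm x <= r].
  rewrite -[X in measurable X]setTI.
  by apply: measurable_fun_le => //; exact: measurable_enorm.
have mI (i : 'I_d) : measurable (`[- r, r] : set R) by [].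
apply: (@le_trans _ _ (lebesgue_tuple R d [set x | forall i, `[- r, r]%classic (tnth x i)])).
  apply: le_measure; rewrite ?inE//; first exact: (measurable_box mI).
  move=> x /= xr i; rewrite in_itv/= -ler_norml.
  exact: le_trans (le_tnth_enorm _ _) xr.
rewrite (lebesgue_tuple_box mI).
under eq_bigr do rewrite lebesgue_measure_itv/= lte_fin gtrN// -EFinD.
rewrite prodEFin prodr_const card_ord lee_fin.
by rewrite (_ : r - - r = 2 * r)//; lra.
Qed.

(** The origin is a box with a null side. In dimension 0 it would have mass 1. *)
Lemma lebesgue_tuple_tzero : (0 < d)%N ->
  lebesgue_tuple R d [set tzero R d] = 0%E.
Proof.
move=> d0.
rewrite (_ : [set tzero R d] = [set x | forall i, [set 0]%classic (tnth x i)]); last first.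
  apply/seteqP; split=> x /=; first by move=> -> i; rewrite tnth_mktuple.
  by move=> h; apply: eq_from_tnth => i; rewrite tnth_mktuple h.
rewrite (lebesgue_tuple_box (fun _ => measurable_set1 _)).
by case: d d0 => // n _; rewrite big_ord_recl lebesgue_measure_set1 mul0e.
Qed.

End enorm_theory.

(** * Dyadic decompositions *)

Section dyadic.
Variable R : realType.

Lemma geometric_nneseries_le (A q : R) : 0 <= A -> 0 <= q < 1 ->
  (\sum_(0 <= j <oo) (A * q ^+ j)%R%:E <= (A / (1 - q))%R%:E)%E.
Proof.
move=> A0 /andP[q0 q1].
apply: lime_le.
  by apply: is_cvg_nneseries => n _ _; rewrite lee_fin mulr_ge0// exprn_ge0.
apply: nearW => n; rewrite sumEFin lee_fin.
have q10 : 0 < 1 - q by lra.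
rewrite ler_pdivlMr// -mulr_sumr -mulrA ler_piMr//.
have := subrX1 q n; have := exprn_ge0 n q0; rewrite big_mkord => h1 h2.
by rewrite mulrC -opprB mulNr -h2; lra.
Qed.

Lemma dyadic_bracket (z : R) : 1 <= z ->
  exists j : nat, 2 ^+ j <= z <= 2 ^+ j.+1.
Proof.
move=> z1.
have [n zn] : exists n : nat, z <= 2 ^+ n.
  exists (Num.bound z); apply: le_trans (ltW (archi_boundP _)) _; first by lra.
  by rewrite -natrX ler_nat ltnW// ltn_expl.
elim: n zn => [|n IH] zn.
  by exists 0%N; rewrite expr0 z1/= expr1; rewrite expr0 in zn; lra.
by have [/IH//|/ltW nz] := leP z (2 ^+ n); exists n; rewrite nz.
Qed.

(** A dyadic argument without a partition of [D]: it is enough that at each point one of the [g j]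
    dominates [f], because then their sum does. It serves both for shells in |x| and for shells in a
    single coordinate. *)
Lemma dyadic_integral_le (dT : measure_display) (T : measurableType dT)
    (mu : {measure set T -> \bar R}) (D : set T) (f : T -> \bar R)
    (g : nat -> T -> \bar R) (A q : R) :
  measurable D -> 0 <= A -> 0 <= q < 1 ->
  measurable_fun D f -> (forall j, measurable_fun D (g j)) ->
  (forall x, D x -> 0 <= f x)%E -> (forall j x, D x -> 0 <= g j x)%E ->
  (forall x, D x -> exists j, f x <= g j x)%E ->
  (forall j, \int[mu]_(x in D) g j x <= (A * q ^+ j)%R%:E)%E ->
  (\int[mu]_(x in D) f x <= (A / (1 - q))%R%:E)%E.
Proof.
move=> mD A0 q01 mf mg f0 g0 fg gA.
apply: (@le_trans _ _ (\int[mu]_(x in D) \sum_(0 <= j <oo) g j x)%E).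
  apply: ge0_le_integral => //.
    apply: (@ge0_emeasurable_sum _ _ _ D g xpredT) => // k x Dx _; exact: g0.
  move=> x Dx; have [j fj] := fg x Dx; apply: (le_trans fj).
  apply: le_trans (nneseries_lim_ge j.+1 _); last by move=> k _ _; exact: g0.
  rewrite big_nat_recr//= leeDr//; apply: sume_ge0 => k _; exact: g0.
rewrite integral_nneseries//.
apply: le_trans (geometric_nneseries_le A0 q01).
by apply: lee_nneseries => [j _ _|j _//]; apply: integral_ge0 => x; exact: g0.
Qed.

End dyadic.

Lemma powR2n (R : realType) (s : R) (j : nat) : (2 ^+ j) `^ s = (2 `^ s) ^+ j.
Proof.
rewrite -powR_mulrn// -powRrM mulrC powRrM powR_mulrn ?powR_ge0//.
Qed.

Lemma powR2_lt1 (R : realType) (s : R) : s < 0 -> 2 `^ s < 1.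
Proof.
move=> s0; rewrite -[s]opprK powRN invf_lt1 ?powR_gt0//.
have : (1 : R) `^ (- s) < 2 `^ (- s) by apply: gt0_ltr_powR; rewrite ?nnegrE; lra.
by rewrite powR1.
Qed.

(** On the shell 2^j r <= |x| <= 2^(j+1) r the integrand is at most (2^j r)^(-p), and the shell lies
    in a ball of volume at most (4 2^j r)^d. The contributions are geometric of ratio 2^(d - p) <
    1. *)
Lemma integral_enorm_tail (R : realType) (d : nat) (p : R) : d%:R < p ->
  exists2 C : R, 0 <= C & forall r, 0 < r ->
  (\int[lebesgue_tuple R d]_(x in [set x | r <= enorm x]%R)
     (enorm x `^ (- p))%:E <= (C * r `^ (d%:R - p))%:E)%E.
Proof.
move=> dp.
have p0 : 0 <= p by apply: le_trans (ltW dp); exact: ler0n.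
pose q : R := 2 `^ (d%:R - p).
have q1 : q < 1 by apply: powR2_lt1; lra.
have q0 : 0 <= q by exact: powR_ge0.
exists (4 ^+ d / (1 - q)); first by rewrite divr_ge0//; lra.
move=> r r0.
have mball s : measurable [set x : d.-tuple R | enorm x <= s].
  rewrite -[X in measurable X]setTI.
  by apply: measurable_fun_le => //; exact: measurable_enorm.
have mD : measurable [set x : d.-tuple R | r <= enorm x].
  rewrite -[X in measurable X]setTI.
  by apply: measurable_fun_le => //; exact: measurable_enorm.
have -> : 4 ^+ d / (1 - q) * r `^ (d%:R - p) =
          (4 ^+ d * r `^ (d%:R - p)) / (1 - q) by ring.
pose g j (x : d.-tuple R) : \bar R :=
  (((2 ^+ j * r) `^ (- p))%:E * (\1_[set x | enorm x <= 2 ^+ j.+1 * r] x)%:E)%E.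
have mg j (D : set (d.-tuple R)) : measurable_fun D (g j).
  apply: measurable_funTS; apply: measurable_funeM.
  exact/measurable_EFinP/measurable_indic.
have g0 j x : (0 <= g j x)%E by rewrite /g mule_ge0// lee_fin ?powR_ge0.
apply: (@dyadic_integral_le _ _ _ _ _ _ g).
- exact: mD.
- by rewrite mulr_ge0 ?powR_ge0.
- by rewrite q0 q1.
- apply: measurable_funTS; apply/measurable_EFinP.
  by apply: (measurableT_comp (measurable_powR _)); exact: measurable_enorm.
- by move=> j; exact: mg.
- by move=> x _; rewrite lee_fin powR_ge0.
- by move=> j x _; exact: g0.
- move=> x /= rx.
  have : 1 <= enorm x / r by rewrite ler_pdivlMr// mul1r.
  move=> /dyadic_bracket[j /andP[]].
  rewrite ler_pdivlMr// ler_pdivrMr// => h1 h2.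
  exists j; rewrite /g indicE mem_set//= mule1 lee_fin !powRN.
  rewrite lef_pV2 ?posrE ?powR_gt0//; last 2 first.
  + exact: lt_le_trans rx.
  + by rewrite mulr_gt0.
  apply: ge0_ler_powR => //; rewrite nnegrE ?enorm_ge0//.
  by rewrite mulr_ge0// ltW.
- move=> j.
  apply: (@le_trans _ _ (\int[lebesgue_tuple R d]_x g j x)%E).
    by apply: ge0_subset_integral => //; exact: mg.
  rewrite /g ge0_integralZl//; last 2 first.
  + exact/measurable_EFinP/measurable_indic.
  + by rewrite lee_fin powR_ge0.
  rewrite integral_indic// setIT.
  apply: (@le_trans _ _ (((2 ^+ j * r) `^ (- p))%:E * ((2 * (2 ^+ j.+1 * r)) ^+ d)%:E)%E).
    apply: lee_wpmul2l; first by rewrite lee_fin powR_ge0.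
    by apply: lebesgue_tuple_ball; rewrite mulr_gt0.
  rewrite -EFinM lee_fin.
  have -> : 2 * (2 ^+ j.+1 * r) = 4 * (2 ^+ j * r) by rewrite exprS; ring.
  have jr0 : 0 < 2 ^+ j * r by rewrite mulr_gt0.
  rewrite exprMn -(powR_mulrn d (ltW jr0)) mulrCA -powRD; last first.
    by apply/implyP => _; rewrite gt_eqF.
  rewrite addrC (powRM _ _ (ltW r0))// powR2n -/q mulrA.
  by rewrite (mulrAC (4 ^+ d)).
Qed.

(** * Schur test and Bessel inequality *)

Section integral_tools.
Variable R : realType.

Lemma dominated_integrable (dT : measure_display) (T : measurableType dT)
    (mu : {measure set T -> \bar R}) (D : set T) (f g : T -> R) :
  measurable D -> measurable_fun D f -> (forall x, D x -> `|f x| <= g x) ->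
  mu.-integrable D (EFin \o g) -> mu.-integrable D (EFin \o f).
Proof.
move=> mD mf fg; apply: le_integrable => //; first exact/measurable_EFinP.
by move=> x Dx; rewrite /= lee_fin (le_trans (fg x Dx))// ler_norm.
Qed.

Lemma EFin_Rintegral (dT : measure_display) (T : measurableType dT)
    (mu : {measure set T -> \bar R}) (D : set T) (f : T -> R) :
  measurable D -> mu.-integrable D (EFin \o f) ->
  ((\int[mu]_(x in D) f x)%R%:E = \int[mu]_(x in D) (f x)%:E)%E.
Proof. by move=> mD If; rewrite /Rintegral fineK//; exact: integrable_fin_num. Qed.

Lemma ge0_integrable (dT : measure_display) (T : measurableType dT)
    (mu : {measure set T -> \bar R}) (D : set T) (f : T -> R) (M : R) :
  measurable D -> measurable_fun D f -> (forall x, D x -> 0 <= f x) ->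
  (\int[mu]_(x in D) (f x)%:E <= M%:E)%E -> mu.-integrable D (EFin \o f).
Proof.
move=> mD mf f0 fM; apply/integrableP; split; first exact/measurable_EFinP.
apply: (le_lt_trans _ (ltry M)); apply: le_trans fM; rewrite le_eqVlt.
by apply/orP; left; apply/eqP; apply: eq_integral => x /set_mem Dx/=; rewrite ger0_norm// f0.
Qed.

(** After cutting off by the indicator of [D], the integral is [fine] of the difference of the
    Tonelli integrals of the positive and negative parts; in this form it is measurable even across
    parameters where it diverges. *)
Lemma measurable_Rintegral_param (d1 d2 : measure_display)
    (T1 : measurableType d1) (T2 : measurableType d2)
    (m2 : {sigma_finite_measure set T2 -> \bar R}) (D : set T2)
    (f : T1 * T2 -> R) :
  measurable D -> measurable_fun setT f ->
  measurable_fun setT (fun x => (\int[m2]_(y in D) f (x, y))%R).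
Proof.
move=> mD mf.
pose g (p : T1 * T2) : \bar R := (f p * \1_D p.2)%:E.
have mg : measurable_fun setT g.
  apply/measurable_EFinP; apply: measurable_funM => //.
  have mI : measurable_fun setT (\1_D : T2 -> R) by exact: measurable_indic.
  exact: (measurableT_comp mI).
rewrite (_ : (fun x => _) = (fun x => fine (\int[m2]_y g (x, y))%E)); last first.
  apply/funext => x; rewrite Rintegral_mkcond /Rintegral; congr fine.
  apply: eq_integral => y _; rewrite /g patchE indicE/=.
  by case: ifP => yD; rewrite ?mulr1 ?mulr0.
apply: measurableT_comp; first exact: fine_measurable.
rewrite (_ : (fun x => _) =
   (fun x => \int[m2]_y g^\+ (x, y) - \int[m2]_y g^\- (x, y))%E); last first.
  apply/funext => x; rewrite integralE; congr (_ - _)%E.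
    by apply: eq_integral => y _; rewrite !funeposE.
  by apply: eq_integral => y _; rewrite !funenegE.
apply: emeasurable_funB.
  apply: (measurable_fun_fubini_tonelli_F (g^\+)%E) => //.
  exact: measurable_funepos.
apply: (measurable_fun_fubini_tonelli_F (g^\-)%E) => //.
exact: measurable_funeneg.
Qed.

Lemma integrable_tensor (d1 d2 : measure_display)
    (T1 : measurableType d1) (T2 : measurableType d2)
    (m1 : {sigma_finite_measure set T1 -> \bar R})
    (m2 : {sigma_finite_measure set T2 -> \bar R})
    (u : T1 -> R) (v : T2 -> R) (f : T1 * T2 -> R) :
  m1.-integrable setT (EFin \o u) -> m2.-integrable setT (EFin \o v) ->
  measurable_fun setT f ->
  (forall p, `|f p| <= `|u p.1| * `|v p.2|) ->
  (m1 \x m2)%E.-integrable setT (EFin \o f).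
Proof.
move=> Iu Iv mf fuv.
have mu : measurable_fun setT u.
  by apply/measurable_EFinP; exact: measurable_int Iu.
have mv : measurable_fun setT v.
  by apply/measurable_EFinP; exact: measurable_int Iv.
have muv : measurable_fun setT (fun p : T1 * T2 => `|u p.1| * `|v p.2|).
  apply: measurable_funM.
    by apply: measurableT_comp => //; exact: measurableT_comp.
  by apply: measurableT_comp => //; exact: measurableT_comp.
apply: (dominated_integrable _ mf (g := fun p => `|u p.1| * `|v p.2|)) => //.
apply/integrableP; split; first exact/measurable_EFinP.
rewrite (eq_integral (fun p => (`|u p.1| * `|v p.2|)%:E)); last first.
  by move=> p _ /=; rewrite ger0_norm// mulr_ge0.
have mE : measurable_fun setT (fun p : T1 * T2 => (`|u p.1| * `|v p.2|)%:E).
  exact/measurable_EFinP.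
have E0 (p : T1 * T2) : (0 <= (`|u p.1| * `|v p.2|)%:E)%E.
  by rewrite lee_fin mulr_ge0.
rewrite (fubini_tonelli1 _ mE E0) /fubini_F/=.
have Iau := integrable_norm Iu; have Iav := integrable_norm Iv.
under eq_integral => x _.
  under eq_integral do rewrite EFinM.
  rewrite ge0_integralZl//; last by apply/measurable_EFinP; exact: measurableT_comp.
  rewrite -(EFin_Rintegral _ Iav)// -EFinM mulrC EFinM.
  over.
rewrite /= ge0_integralZl//; last 2 first.
- by apply/measurable_EFinP; exact: measurableT_comp.
- by rewrite lee_fin Rintegral_ge0.
by rewrite -(EFin_Rintegral _ Iau)// -EFinM ltry.
Qed.

End integral_tools.

Section schur.
Context (R : realType) (d1 d2 : measure_display).
Context (X : measurableType d1) (Y : measurableType d2).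
Variables (mu : {sigma_finite_measure set X -> \bar R})
          (nu : {sigma_finite_measure set Y -> \bar R}).
Variables (w : X -> R) (c : Y * X -> R) (h : Y -> R) (M : R).
Hypothesis w0 : forall x, 0 <= w x.
Hypothesis Iw : mu.-integrable setT (EFin \o w).
Hypothesis Ih : nu.-integrable setT (EFin \o h).
Hypothesis mc : measurable_fun setT c.
Hypothesis c1 : forall p, `|c p| <= 1.
(** Gram kernel of the functions [c (y, _)] in the L^2 space of weight [w]. It is symmetric, so a
    bound on its row integrals is all that the Schur test requires. *)
Let K (p : Y * Y) : R := (\int[mu]_x (w x * (c (p.1, x) * c (p.2, x))))%R.
Hypothesis KM : forall xi, (\int[nu]_eta `|K (xi, eta)|%:E <= M%:E)%E.

Let mw : measurable_fun setT w.
Proof. by apply/measurable_EFinP; exact: measurable_int Iw. Qed.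

Let mh : measurable_fun setT h.
Proof. by apply/measurable_EFinP; exact: measurable_int Ih. Qed.

Let mcx x : measurable_fun setT (fun y => c (y, x)).
Proof. exact: measurable_fun_pair1. Qed.

Let mcy y : measurable_fun setT (fun x => c (y, x)).
Proof. exact: measurable_fun_pair2. Qed.

Let mcswap : measurable_fun setT (fun p : X * Y => c (p.2, p.1)).
Proof. by apply: (measurableT_comp mc); exact: measurable_fun_pair. Qed.

Let C x : R := (\int[nu]_y (c (y, x) * h y))%R.

Let mC : measurable_fun setT C.
Proof.
apply: (@measurable_Rintegral_param _ _ _ _ _ _ setT
  (fun p : X * Y => c (p.2, p.1) * h p.2)) => //.
by apply: measurable_funM => //; exact: measurableT_comp.
Qed.

Let Ich x : nu.-integrable setT (EFin \o (fun y => c (y, x) * h y)).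
Proof.
apply: (dominated_integrable _ _ _ (integrable_norm Ih)) => //.
  exact: measurable_funM.
by move=> y _; rewrite normrM ler_piMl.
Qed.

(** The L^1 norm of [h] bounds [C] everywhere; together with the integrability of [w] it dominates
    the integrands in which [C] occurs. *)
Let H : R := (\int[nu]_y `|h y|)%R.

Let CH x : `|C x| <= H.
Proof.
apply: le_trans (le_normr_Rintegral _ (Ich x)) _ => //.
apply: le_Rintegral => //; first exact: (integrable_norm (Ich x)).
  exact: integrable_norm.
by move=> y _; rewrite normrM ler_piMl.
Qed.

Let J y : R := (\int[mu]_x (w x * (c (y, x) * C x)))%R.

Let IwcC y : mu.-integrable setT (EFin \o (fun x => w x * (c (y, x) * C x))).
Proof.
apply: (dominated_integrable (g := fun x => H * w x)) => //.
- by do 2 apply: measurable_funM => //.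
- move=> x _; rewrite normrM ger0_norm// [leRHS]mulrC ler_wpM2l// normrM.
  by rewrite -[leRHS]mul1r ler_pM.
- exact: (integrableZl _ H Iw).
Qed.

Let IwC2 : mu.-integrable setT (EFin \o (fun x => w x * C x ^+ 2)).
Proof.
apply: (dominated_integrable (g := fun x => H ^+ 2 * w x)) => //.
- by apply: measurable_funM => //; exact: measurable_funX.
- move=> x _; rewrite normrM ger0_norm// [leRHS]mulrC ler_wpM2l// normrX.
  by rewrite lerXn2r// nnegrE// (le_trans _ (CH x)).
- exact: (integrableZl _ (H ^+ 2) Iw).
Qed.

Let mK : measurable_fun setT K.
Proof.
apply: (@measurable_Rintegral_param _ _ _ _ _ _ setT
  (fun q : (Y * Y) * X => w q.2 * (c (q.1.1, q.2) * c (q.1.2, q.2)))) => //.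
apply: measurable_funM; first exact: measurableT_comp.
apply: measurable_funM.
  apply: (measurableT_comp mc); apply: measurable_fun_pair => //.
  exact: measurableT_comp.
apply: (measurableT_comp mc); apply: measurable_fun_pair => //.
exact: measurableT_comp.
Qed.

Let Ksym y y' : K (y, y') = K (y', y).
Proof. by apply: eq_Rintegral => x _ /=; rewrite (mulrC (c _)). Qed.

Let Iwc y : mu.-integrable setT (EFin \o (fun x => w x * c (y, x))).
Proof.
apply: (dominated_integrable (g := w)) => //; first exact: measurable_funM.
by move=> x _; rewrite normrM ger0_norm// ler_piMr.
Qed.

(** Unfolding [C] and exchanging the integrals exhibits [J] as the operator of kernel [K] applied to
    [h]. Fubini applies since |c| <= 1 leaves the product of [w] and |h| as a dominating
    function. *)
Let JE y : (J y)%:E = (\int[nu]_y' (h y' * K (y, y'))%:E)%E.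
Proof.
rewrite /J (EFin_Rintegral _ (IwcC y))//.
transitivity (\int[mu]_x \int[nu]_y' (w x * (c (y, x) * (c (y', x) * h y')))%:E)%E.
  apply: eq_integral => x _.
  rewrite -[RHS]EFin_Rintegral//; last first.
    rewrite (_ : _ \o _ = (EFin \o (fun y' => (w x * c (y, x)) * (c (y', x) * h y')))).
      exact: (integrableZl _ _ (Ich x)).
    by apply/funext => y'/=; rewrite mulrA.
  congr EFin; rewrite -[RHS]/(\int[nu]_y' (w x * (c (y, x) * (c (y', x) * h y'))))%R.
  under eq_Rintegral do rewrite mulrA.
  by rewrite RintegralZl//= mulrA.
rewrite (@Fubini _ _ _ _ _ mu nu
  (fun p => (w p.1 * (c (y, p.1) * (c (p.2, p.1) * h p.2)))%:E)) /=; last first.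
  apply: (integrable_tensor Iw Ih).
    apply: measurable_funM; first exact: measurableT_comp.
    apply: measurable_funM; first exact: (measurableT_comp (mcy y)).
    by apply: measurable_funM => //; exact: measurableT_comp.
  move=> p; rewrite normrM ler_wpM2l// !normrM.
  by rewrite mulrA ler_piMl// -[leRHS]mul1r ler_pM.
apply: eq_integral => y' _.
rewrite /K mulrC -RintegralZr//=; last first.
  apply: (dominated_integrable (g := w)) => //.
    by apply: measurable_funM => //; exact: measurable_funM.
  move=> x _; rewrite normrM ger0_norm// ler_piMr// normrM.
  by rewrite -[leRHS]mul1r ler_pM.
rewrite EFin_Rintegral//; last first.
  apply: (dominated_integrable (g := fun x => `|h y'| * w x)) => //.
  - apply: measurable_funM => //; apply: measurable_funM => //.
    exact: measurable_funM.
  - move=> x _; rewrite mulrC normrM ler_wpM2l// normrM ger0_norm//.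
    by rewrite ler_piMr// normrM -[leRHS]mul1r ler_pM.
  - exact: (integrableZl _ `|h y'| Iw).
by apply: eq_integral => x _; congr EFin; ring.
Qed.

Let mJ : measurable_fun setT J.
Proof.
apply: (@measurable_Rintegral_param _ _ _ _ _ _ setT
  (fun p : Y * X => w p.2 * (c (p.1, p.2) * C p.2))) => //.
apply: measurable_funM; first exact: measurableT_comp.
apply: measurable_funM; last exact: measurableT_comp.
by apply: (measurableT_comp mc); exact: measurable_fun_pair.
Qed.

(** The left side is the quadratic form of [K] at [h], by Fubini. From |h(y) h(y')| <= (h(y)^2 +
    h(y')^2) / 2 it splits into the halves [Q1] and [Q2], whose integrals agree by the symmetry of
    [K], and each is controlled by the row bound. *)
Lemma schur_bessel :
  (\int[mu]_x (w x * (\int[nu]_y (c (y, x) * h y))%R ^+ 2)%:E <=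
   M%:E * \int[nu]_y (h y ^+ 2)%:E)%E.
Proof.
rewrite -/(C _).
have -> : (\int[mu]_x (w x * C x ^+ 2)%:E = \int[nu]_y (h y * J y)%:E)%E.
  transitivity (\int[mu]_x \int[nu]_y (w x * (C x * (c (y, x) * h y)))%:E)%E.
    apply: eq_integral => x _.
    rewrite -[RHS]EFin_Rintegral//; last first.
      rewrite (_ : _ \o _ = (EFin \o (fun y => (w x * C x) * (c (y, x) * h y)))).
        exact: (integrableZl _ _ (Ich x)).
      by apply/funext => y'/=; rewrite mulrA.
    congr EFin; under eq_Rintegral do rewrite mulrA.
    by rewrite RintegralZl//= -mulrA -expr2.
  rewrite (@Fubini _ _ _ _ _ mu nu
    (fun p => (w p.1 * (C p.1 * (c (p.2, p.1) * h p.2)))%:E)) /=; last first.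
    apply: (integrable_tensor (u := fun x => H * w x) _ Ih).
    - exact: (integrableZl _ H Iw).
    - apply: measurable_funM; first exact: measurableT_comp.
      apply: measurable_funM; first exact: (measurableT_comp mC).
      by apply: measurable_funM => //; exact: measurableT_comp.
    - move=> p; rewrite normrM (normrM H) (mulrC `|H|) -mulrA ler_wpM2l// !normrM.
      apply: ler_pM => //; first exact: le_trans (CH _) (ler_norm _).
      by rewrite ler_piMl.
  apply: eq_integral => y _.
  rewrite mulrC -[in RHS]RintegralZr//= EFin_Rintegral//; last first.
    rewrite (_ : _ \o _ = (EFin \o (fun x => h y * (w x * (c (y, x) * C x))))).
      exact: (integrableZl _ _ (IwcC y)).
    by apply/funext => x /=; rewrite mulrC.
  by apply: eq_integral => x _; congr EFin; ring.
pose Q1 (p : Y * Y) : \bar R := ((h p.1 ^+ 2 / 2) * `|K p|)%:E.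
pose Q2 (p : Y * Y) : \bar R := ((h p.2 ^+ 2 / 2) * `|K p|)%:E.
have mh2 : measurable_fun setT (fun y => h y ^+ 2 / 2).
  by apply: measurable_funM => //; exact: measurable_funX.
have mQ1 : measurable_fun setT Q1.
  apply/measurable_EFinP; apply: measurable_funM; last exact: measurableT_comp.
  exact: (measurableT_comp mh2).
have mQ2 : measurable_fun setT Q2.
  apply/measurable_EFinP; apply: measurable_funM; last exact: measurableT_comp.
  exact: (measurableT_comp mh2).
have h20 y : 0 <= h y ^+ 2 / 2 by rewrite divr_ge0// sqr_ge0.
have Q10 p : (0 <= Q1 p)%E by rewrite lee_fin mulr_ge0.
have Q20 p : (0 <= Q2 p)%E by rewrite lee_fin mulr_ge0.
have mKy y : measurable_fun setT (fun y' => K (y, y')).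
  exact: measurable_fun_pair2.
have intQ y : (\int[nu]_y' Q1 (y, y') <= M%:E * (h y ^+ 2 / 2)%:E)%E.
  rewrite /Q1/=; under eq_integral do rewrite EFinM.
  rewrite ge0_integralZl ?lee_fin//; last first.
    by apply/measurable_EFinP; exact: measurableT_comp.
  by rewrite muleC lee_wpmul2r// lee_fin.
have M0 : 0 <= M.
  by rewrite -lee_fin; apply: le_trans (KM point); exact: integral_ge0.
have half : (\int[nu]_y \int[nu]_y' Q1 (y, y') <=
    M%:E * \int[nu]_y (h y ^+ 2 / 2)%:E)%E.
  rewrite -ge0_integralZl ?lee_fin//; last 2 first.
  - exact/measurable_EFinP.
  - by move=> y _; rewrite lee_fin.
  apply: ge0_le_integral => //.
  - by move=> y _; exact: integral_ge0.
  - exact: (measurable_fun_fubini_tonelli_F Q1).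
  - by apply: measurable_funeM; exact/measurable_EFinP.
apply: (@le_trans _ _ (\int[nu]_y \int[nu]_y' (Q1 (y, y') + Q2 (y, y')))%E).
  apply: le_trans (lee_abs _) _; apply: le_trans (le_abse_integral _ _ _) _ => //.
    by apply/measurable_EFinP; exact: measurable_funM.
  apply: ge0_le_integral => //.
  - apply: measurableT_comp => //; apply/measurable_EFinP; exact: measurable_funM.
  - apply: (measurable_fun_fubini_tonelli_F (Q1 \+ Q2)%E).
      exact: emeasurable_funD.
    by move=> p; exact: adde_ge0.
  move=> y _; rewrite EFinM JE abseM.
  apply: (@le_trans _ _ (`|(h y)%:E| * \int[nu]_y' (`|h y'| * `|K (y, y')|)%:E)%E).
    apply: lee_wpmul2l => //; apply: le_trans (le_abse_integral _ _ _) _ => //.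
      by apply/measurable_EFinP; exact: measurable_funM.
    by rewrite le_eqVlt; apply/orP; left; apply/eqP; apply: eq_integral => y' _; rewrite /= normrM.
  rewrite -ge0_integralZl//; last first.
    by apply/measurable_EFinP; apply: measurable_funM; exact: measurableT_comp.
  apply: ge0_le_integral => //.
  - apply: measurable_funeM; apply/measurable_EFinP.
    by apply: measurable_funM; exact: measurableT_comp.
  - apply: (@measurable_fun_pair2 _ _ _ _ _ _ (Q1 \+ Q2)%E).
    exact: emeasurable_funD.
  move=> y' _; rewrite /Q1 /Q2 /= -EFinM -EFinD lee_fin -mulrDl mulrA.
  rewrite ler_wpM2r//.
  have := sqr_ge0 (`|h y| - `|h y'|).
  rewrite -(real_normK (num_real (h y))) -(real_normK (num_real (h y'))); nra.
under eq_integral => y _.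
  rewrite ge0_integralD//; last 2 first.
  - exact: (measurable_fun_pair2 y mQ1).
  - exact: (measurable_fun_pair2 y mQ2).
  over.
rewrite ge0_integralD//; last 4 first.
- by move=> y _; exact: integral_ge0.
- exact: (measurable_fun_fubini_tonelli_F Q1).
- by move=> y _; exact: integral_ge0.
- exact: (measurable_fun_fubini_tonelli_F Q2).
have -> : (\int[nu]_y \int[nu]_y' Q2 (y, y') = \int[nu]_y \int[nu]_y' Q1 (y, y'))%E.
  have -> := @fubini_tonelli _ _ _ _ _ nu nu Q2 mQ2 Q20.
  by apply: eq_integral => y _; apply: eq_integral => y' _; rewrite /Q2 /Q1/= Ksym.
apply: le_trans (leeD half half) _.
rewrite -ge0_muleDr ?integral_ge0//; last 2 first.
- by move=> y _; rewrite lee_fin.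
- by move=> y _; rewrite lee_fin.
rewrite lee_wpmul2l ?lee_fin//.
rewrite -ge0_integralD//; last 4 first.
- by move=> y _; rewrite lee_fin.
- exact/measurable_EFinP.
- by move=> y _; rewrite lee_fin.
- exact/measurable_EFinP.
rewrite le_eqVlt; apply/orP; left; apply/eqP; apply: eq_integral => y _.
by rewrite -EFinD; congr EFin; lra.
Qed.

End schur.

(** * The exponential weight and its cosine transform *)

Section exponential_weight.
Variable R : realType.
Local Notation mu := (@lebesgue_measure R).

Lemma is_derive_continuous (f : R -> R) (x l : R) :
  is_derive x 1 f l -> f y @[y --> x] --> f x.
Proof. by case=> /derivable1_diffP/differentiable_continuous. Qed.

Definition expw (e x : R) : R := expR (- (e * `|x|)).

Lemma expw_ge0 e x : 0 <= expw e x. Proof. exact: expR_ge0. Qed.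

Lemma continuous_expw e : continuous (expw e).
Proof.
move=> x; apply: continuous_comp; last exact: continuous_expR.
by apply: cvgN; apply: cvgMl_tmp; exact: norm_continuous.
Qed.

Lemma measurable_expw e : measurable_fun setT (expw e).
Proof. by apply: continuous_measurable_fun; exact: continuous_expw. Qed.

Lemma is_derive_expNM (e x : R) :
  is_derive x 1 (fun x => expR (- (e * x))) (expR (- (e * x)) * - e).
Proof.
apply: (@is_derive1_comp R expR (fun x => - (e * x))).
rewrite -[in X in is_derive _ _ _ X](mulr1 e) -[X in is_derive _ _ _ (- X)]/(e *: 1).
exact: is_deriveN.
Qed.

Lemma is_derive_cosM (z x : R) :
  is_derive x 1 (fun x => cos (z * x)) (- sin (z * x) * z).
Proof.
apply: (@is_derive1_comp R cos (fun x => z * x)).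
rewrite -[in X in is_derive _ _ _ X](mulr1 z) -[X in is_derive _ _ _ X]/(z *: 1).
exact: is_deriveZ.
Qed.

Lemma is_derive_sinM (z x : R) :
  is_derive x 1 (fun x => sin (z * x)) (cos (z * x) * z).
Proof.
apply: (@is_derive1_comp R sin (fun x => z * x)).
rewrite -[in X in is_derive _ _ _ X](mulr1 z) -[X in is_derive _ _ _ X]/(z *: 1).
exact: is_deriveZ.
Qed.

Lemma continuous_cosM (z : R) : continuous (fun x : R => cos (z * x)).
Proof.
move=> x; apply: continuous_comp; last exact: continuous_cos.
by apply: cvgMl_tmp; exact: cvg_id.
Qed.

Lemma continuous_sinM (z : R) : continuous (fun x : R => sin (z * x)).
Proof.
move=> x; apply: continuous_comp; last exact: continuous_sin.
by apply: cvgMl_tmp; exact: cvg_id.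
Qed.

Lemma cvg_expNM (e : R) : 0 < e -> expR (- (e * x)) @[x --> +oo] --> (0 : R).
Proof.
move=> e0.
apply: (cvg_comp (fun x => e * x) (fun x => expR (- x))); last exact: cvgr_expR.
by apply: gt0_cvgMry => //; exact: cvg_id.
Qed.

(** Adding 1 to the cosine makes the integrand nonnegative, so the fundamental theorem on a
    half-line applies before integrability is known. It also yields that integrability, at z = 0. *)
Lemma integral_expw_1cos (e z : R) : 0 < e ->
  (\int[mu]_x (expw e x * (1 + cos (z * x)))%:E =
   (2 / e + 2 * e / (e ^+ 2 + z ^+ 2))%:E)%E.
Proof.
move=> e0.
have ez0 : e ^+ 2 + z ^+ 2 != 0 by rewrite gt_eqF// ltr_wpDr ?sqr_ge0// exprn_gt0.
have f0 x : 0 <= expw e x * (1 + cos (z * x)).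
  by rewrite mulr_ge0 ?expw_ge0//; have := cos_geN1 (z * x); lra.
have cf : continuous (fun x => expw e x * (1 + cos (z * x))).
  move=> x; apply: continuousM; first exact: continuous_expw.
  by apply: continuousD; [exact: cst_continuous|exact: continuous_cosM].
rewrite ge0_symfun_integralT//; last first.
  by move=> x /=; rewrite /expw normrN mulrN cosN.
pose k := (e ^+ 2 + z ^+ 2)^-1.
(* The real part of exp((- e + i z) x) / (- e + i z), plus the antiderivative - exp(- e x) / e of
   the term 1. It vanishes at infinity. *)
pose F (x : R) := expR (- (e * x)) * (k * (z * sin (z * x) - e * cos (z * x)) - e^-1).
have dF (x : R) : is_derive x 1 F (expR (- (e * x)) * (1 + cos (z * x))).
  have d1 := is_derive_expNM e x; have d2 := is_derive_cosM z x.
  have d3 := is_derive_sinM z x.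
  apply: is_derive_eq.
  rewrite /GRing.scale /=.
  by rewrite /k; field; rewrite ?ez0 ?gt_eqF.
rewrite -set_itvcy.
have -> : (\int[mu]_(x in `[0%R, +oo[) (expw e x * (1 + cos (z * x)))%:E =
  \int[mu]_(x in `[0%R, +oo[) (expR (- (e * x)) * (1 + cos (z * x)))%:E)%E.
  apply: eq_integral => x /set_mem/=; rewrite in_itv/= andbT => x0.
  by rewrite /expw ger0_norm.
rewrite (@ge0_continuous_FTC2y _ _ F 0 0).
- rewrite /F mulr0 oppr0 expR0 mulr0 sin0 cos0 -EFinB -EFinM; congr EFin.
  by rewrite /k; field; rewrite ?ez0 ?gt_eqF.
- move=> x _; rewrite mulr_ge0 ?expR_ge0//; have := cos_geN1 (z * x); lra.
- apply: continuous_subspaceT.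
  have cg : continuous (fun x : R => expR (- (e * x)) * (1 + cos (z * x))).
    move=> x; apply: cvgM.
      exact: is_derive_continuous (is_derive_expNM e x).
    by apply: cvgD; [exact: cvg_cst|exact: continuous_cosM].
  exact: cg.
- pose B := `|k| * (`|z| + `|e|) + `|e^-1|.
  apply: (@squeeze_cvgr _ _ _ _ (fun x => - (B * expR (- (e * x)))) (fun x => B * expR (- (e * x)))).
  + apply: nearW => x; rewrite -ler_norml /F normrM ger0_norm ?expR_ge0// mulrC.
    rewrite ler_wpM2r ?expR_ge0//; apply: le_trans (ler_normB _ _) _.
    rewrite /B lerD2r normrM ler_wpM2l//; apply: le_trans (ler_normB _ _) _.
    rewrite !normrM lerD// ler_piMr// ler_norml.
      by rewrite sin_geN1 sin_le1.
    by rewrite cos_geN1 cos_le1.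
  + rewrite -oppr0 -(mulr0 B); apply: cvgN; apply: cvgMl_tmp; exact: cvg_expNM.
  + rewrite -(mulr0 B); apply: cvgMl_tmp; exact: cvg_expNM.
- by move=> x _; case: (dF x).
- apply: cvg_at_right_filter.
  exact: is_derive_continuous (dF 0).
- by move=> x _; rewrite derive1E; exact: derive_val.
Qed.

Lemma integrable_expw (e : R) : 0 < e -> mu.-integrable setT (EFin \o expw e).
Proof.
move=> e0.
apply: (@dominated_integrable R _ (measurableTypeR R) mu setT (expw e)
  (fun x : R => expw e x * (1 + cos (0 * x)))) => //.
- exact: measurable_expw.
- move=> x _; rewrite mul0r cos0 ger0_norm ?expw_ge0//.
  by have := expw_ge0 e x; lra.
- apply: ge0_integrable => //; last first.
  + by rewrite integral_expw_1cos.
  + by move=> x _; rewrite mul0r cos0 mulr_ge0 ?expw_ge0.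
  + apply: measurable_funM; first exact: measurable_expw.
    apply: measurable_funD => //.
    by apply: continuous_measurable_fun; exact: continuous_cosM.
Qed.

Lemma integrable_expwM (e : R) (g : R -> R) : 0 < e -> measurable_fun setT g ->
  (forall x, `|g x| <= 1) -> mu.-integrable setT (EFin \o (fun x => expw e x * g x)).
Proof.
move=> e0 mg g1; apply: (@dominated_integrable R _ (measurableTypeR R) mu setT _ (expw e)) => //.
- by apply: measurable_funM => //; exact: measurable_expw.
- by move=> x _; rewrite normrM ger0_norm ?expw_ge0// ler_piMr ?expw_ge0.
- exact: integrable_expw.
Qed.

Lemma normr_cos_le1 (x : R) : `|cos x| <= 1.
Proof. by rewrite ler_norml cos_geN1 cos_le1. Qed.

Lemma normr_sin_le1 (x : R) : `|sin x| <= 1.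
Proof. by rewrite ler_norml sin_geN1 sin_le1. Qed.

Lemma Rintegral_expw_cos (e z : R) : 0 < e ->
  (\int[mu]_x (expw e x * cos (z * x)))%R = 2 * e / (e ^+ 2 + z ^+ 2).
Proof.
move=> e0.
have mcz y : measurable_fun setT (fun x : R => cos (y * x)).
  by apply: continuous_measurable_fun; exact: continuous_cosM.
have Ic y := integrable_expwM e0 (mcz y) (fun x => normr_cos_le1 _).
have E y : (\int[mu]_x (expw e x * cos (y * x)))%R =
    2 / e + 2 * e / (e ^+ 2 + y ^+ 2) - (\int[mu]_x (expw e x))%R.
  have := integral_expw_1cos y e0; rewrite -EFin_Rintegral//; last first.
    rewrite (_ : _ \o _ = (EFin \o expw e) \+ (EFin \o (fun x => expw e x * cos (y * x))%R))%E.
      by apply: integrableD => //; exact: integrable_expw.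
    by apply/funext => x /=; rewrite -EFinD mulrDr mulr1.
  move=> /(congr1 fine) /=.
  under eq_Rintegral do rewrite mulrDr mulr1.
  by rewrite RintegralD//; [move=> <-; ring|exact: integrable_expw].
(* At frequency 0 the identity [E] reads I = 2/e + 2/e - I, which determines the integral I of the
   weight. *)
have h := E 0; rewrite expr0n/= addr0 in h; rewrite E.
have h0 : (\int[mu]_x (expw e x * cos (0 * x)))%R = (\int[mu]_x (expw e x))%R.
  by apply: eq_Rintegral => x _; rewrite mul0r cos0 mulr1.
rewrite h0 in h.
have -> : (\int[mu]_x (expw e x))%R = 2 / e.
  have h2 : 2 * e / e ^+ 2 = 2 / e by field; rewrite gt_eqF.
  by move: h; rewrite h2; move: (\int[mu]_x _)%R (2 / e); clear; move=> I J; lra.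
by rewrite addrAC subrr add0r.
Qed.

Lemma Rintegral_expw_sin (e z : R) : 0 < e ->
  (\int[mu]_x (expw e x * sin (z * x)))%R = 0.
Proof.
move=> e0.
have msz : measurable_fun setT (fun x : R => sin (z * x)).
  by apply: continuous_measurable_fun; exact: continuous_sinM.
have Is := integrable_expwM e0 msz (fun x => normr_sin_le1 _).
have mS : measurable_fun setT (fun x => (expw e x * sin (z * x))%:E).
  exact: measurable_int Is.
have := integral_reflection mS => /=.
under eq_integral do rewrite /expw normrN mulrN sinN mulrN -/(expw e _) -mulN1r.
rewrite -!EFin_Rintegral//; last exact: (integrableZl _ (-1) Is).
by rewrite RintegralZl// => /(congr1 fine)/=; move: (\int[mu]_x _)%R; clear; move=> I; lra.
Qed.

(** The cosine transform of [expw e], left unnormalized: its mass is 2 pi for every positive [e]. *)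
Definition poissonk (e z : R) : R := 2 * e / (e ^+ 2 + z ^+ 2).

Lemma poissonk_ge0 e z : 0 < e -> 0 <= poissonk e z.
Proof.
by move=> e0; rewrite divr_ge0// ?mulr_ge0 ?addr_ge0 ?sqr_ge0// ltW.
Qed.

Lemma continuous_poissonk e : 0 < e -> continuous (poissonk e).
Proof.
move=> e0 x; apply: cvgMl_tmp; apply: cvgV.
  by rewrite gt_eqF// ltr_wpDr ?sqr_ge0// exprn_gt0.
by apply: cvgD; [exact: cvg_cst|exact: exprn_continuous].
Qed.

Lemma integral_poissonk e : 0 < e ->
  (\int[mu]_z (poissonk e z)%:E = (2 * pi)%:E)%E.
Proof.
move=> e0; have e0' : e != 0 by rewrite gt_eqF.
rewrite ge0_symfun_integralT//; last 3 first.
- by move=> x; exact: poissonk_ge0.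
- exact: continuous_poissonk.
- by move=> x; rewrite /poissonk/= sqrrN.
pose F (x : R) := 2 * atan (e^-1 * x).
have dF (x : R) : is_derive x 1 F (poissonk e x).
  have d1 : is_derive x 1 (fun x => atan (e^-1 * x)) ((1 + (e^-1 * x) ^+ 2)^-1 * e^-1).
    apply: (@is_derive1_comp R (@atan R) (fun x => e^-1 * x)).
    rewrite -[in X in is_derive _ _ _ X](mulr1 e^-1) -[X in is_derive _ _ _ X]/(e^-1 *: 1).
    exact: is_deriveZ.
  apply: is_derive_eq; rewrite /GRing.scale /= /poissonk; field.
  by rewrite e0' andbT gt_eqF// ltr_wpDr ?sqr_ge0// exprn_gt0.
rewrite -set_itvcy (@ge0_continuous_FTC2y _ _ F 0 pi).
- by rewrite /F mulr0 atan0 mulr0 -EFinB subr0 -EFinM.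
- by move=> x _; exact: poissonk_ge0.
- by apply: continuous_subspaceT; exact: continuous_poissonk.
- have -> : pi = 2 * (pi / 2) :> R by field.
  apply: cvgMl_tmp.
  apply: (cvg_comp (fun x => e^-1 * x) (@atan R)); last exact: cvgy_atan.
  by apply: gt0_cvgMry; [rewrite invr_gt0|exact: cvg_id].
- by move=> x _; case: (dF x).
- apply: cvg_at_right_filter.
  exact: is_derive_continuous (dF 0).
- by move=> x _; rewrite derive1E; exact: derive_val.
Qed.

End exponential_weight.

(** * Product functions and their integrals over tuples *)

Section tensor.
Variable R : realType.
Local Notation mu := (@lebesgue_measure R).

Definition tensor n (f : 'I_n -> R -> R) (x : n.-tuple R) : R :=
  \prod_(i < n) f i (tnth x i).

Lemma tensor_cons n (f : 'I_n.+1 -> R -> R) h (x : n.-tuple R) :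
  tensor f (cons_pair (h, x)) = f ord0 h * tensor (fun i => f (lift ord0 i)) x.
Proof.
rewrite /tensor big_ord_recl tnth0; congr (_ * _).
by apply: eq_bigr => i _; rewrite tnthS.
Qed.

Lemma tensor_ge0 n (f : 'I_n -> R -> R) x :
  (forall i z, 0 <= f i z) -> 0 <= tensor f x.
Proof. by move=> f0; apply: prodr_ge0 => i _. Qed.

Lemma measurable_tensor n (f : 'I_n -> R -> R) :
  (forall i, measurable_fun setT (f i)) -> measurable_fun setT (tensor f).
Proof.
move=> mf; apply: measurable_prod => i _.
by apply: measurableT_comp => //; exact: measurable_tnth.
Qed.

Lemma ge0_integral_tensor n (f : 'I_n -> R -> R) (c : 'I_n -> R) :
  (forall i, measurable_fun setT (f i)) -> (forall i z, 0 <= f i z) ->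
  (forall i, \int[mu]_z (f i z)%:E = (c i)%:E)%E ->
  (\int[lebesgue_tuple R n]_x (tensor f x)%:E = (\prod_(i < n) c i)%:E)%E.
Proof.
elim: n f c => [|n IH] f c mf f0 fc.
  have mE : measurable_fun setT (fun x => (tensor f x)%:E).
    by apply/measurable_EFinP; exact: measurable_tensor.
  rewrite big_ord0 /= integral_dirac//.
  by rewrite diracE mem_set// mul1e /tensor big_ord0.
rewrite ge0_integral_tupleS//; last 2 first.
- by apply/measurable_EFinP; exact: measurable_tensor.
- by move=> x; rewrite lee_fin tensor_ge0.
have c0 i : 0 <= c i.
  by rewrite -lee_fin -fc; apply: integral_ge0 => z _; rewrite lee_fin.
under eq_integral => h _.
  under eq_integral do rewrite tensor_cons EFinM.
  rewrite ge0_integralZl//; last 3 first.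
  - by apply/measurable_EFinP; exact: measurable_tensor.
  - by move=> x _; rewrite lee_fin tensor_ge0.
  - by rewrite lee_fin.
  rewrite (IH _ (fun i => c (lift ord0 i)))// muleC.
  over.
rewrite /= ge0_integralZl//; last 3 first.
- by apply/measurable_EFinP; exact: mf.
- by move=> x _; rewrite lee_fin.
- by rewrite lee_fin prodr_ge0.
by rewrite fc -EFinM big_ord_recl mulrC.
Qed.

Lemma integrable_cons n (f : n.+1.-tuple R -> R) :
  (lebesgue_tuple R n.+1).-integrable setT (EFin \o f) ->
  (mu \x lebesgue_tuple R n)%E.-integrable setT
    (EFin \o (f \o (@cons_pair R n))).
Proof.
move=> /integrableP[mf foo]; apply/integrableP; split.
  exact: (measurableT_comp mf (@measurable_cons_pair R n)).
rewrite ge0_integral_tupleS// in foo; last exact: measurableT_comp.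
have mc := @measurable_cons_pair R n.
rewrite (fubini_tonelli1 (fun p : measurableTypeR R * n.-tuple R => `|(f (cons_pair p))%:E|%E))//.
by apply: measurableT_comp => //; exact: (measurableT_comp mf mc).
Qed.

Lemma integral_tupleS n (f : n.+1.-tuple R -> R) :
  (lebesgue_tuple R n.+1).-integrable setT (EFin \o f) ->
  (\int[lebesgue_tuple R n.+1]_x (f x)%:E =
   \int[mu]_h \int[lebesgue_tuple R n]_x (f (cons_pair (h, x)))%:E)%E.
Proof.
move=> If; have Ic := integrable_cons If.
have mf := measurable_int _ If.
have mc := @measurable_cons_pair R n.
have := @integral_pushforward _ _ (measurableTypeR R * n.-tuple R)%type _ R
  _ mc (mu \x (lebesgue_tuple R n))%E setT (EFin \o f) mf.
rewrite preimage_setT => /(_ Ic measurableT) E; rewrite [LHS]E.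
by rewrite -(integral12_prod_meas1 Ic).
Qed.

Lemma dotp_cons n (z : n.+1.-tuple R) h (x : n.-tuple R) :
  dotp z (cons_pair (h, x)) = thead z * h + dotp [tuple of behead z] x.
Proof.
rewrite /dotp big_ord_recl tnth0; congr (_ + _).
apply: eq_bigr => i _; rewrite tnthS tnth_behead; congr (tnth _ _ * _).
by apply: val_inj; rewrite /= inordK// ltnS.
Qed.

Definition expwt (e : R) n (x : n.-tuple R) : R := tensor (fun=> expw e) x.

Definition poissont (e : R) n (z : n.-tuple R) : R := tensor (fun=> poissonk e) z.

Lemma expwt_ge0 e n (x : n.-tuple R) : 0 <= expwt e x.
Proof. by apply: tensor_ge0 => _ z; exact: expw_ge0. Qed.

Lemma measurable_expwt e n : measurable_fun setT (@expwt e n).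
Proof. by apply: measurable_tensor => _; exact: measurable_expw. Qed.

Lemma integrable_expwt e n : 0 < e ->
  (lebesgue_tuple R n).-integrable setT (EFin \o (@expwt e n)).
Proof.
move=> e0.
apply: (ge0_integrable (M := \prod_(i < n) (\int[mu]_x expw e x)%R)) => //.
- exact: measurable_expwt.
- by move=> x _; exact: expwt_ge0.
- rewrite (@ge0_integral_tensor _ _ (fun=> (\int[mu]_x expw e x)%R))//.
  + by move=> _; exact: measurable_expw.
  + by move=> _ z; exact: expw_ge0.
  + by move=> _; rewrite (EFin_Rintegral _ (integrable_expw e0)).
Qed.

Lemma integrable_expwtM e n (g : n.-tuple R -> R) : 0 < e ->
  measurable_fun setT g -> (forall x, `|g x| <= 1) ->
  (lebesgue_tuple R n).-integrable setT (EFin \o (fun x => expwt e x * g x)).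
Proof.
move=> e0 mg g1; apply: (dominated_integrable (g := @expwt e n)) => //.
- by apply: measurable_funM => //; exact: measurable_expwt.
- by move=> x _; rewrite normrM ger0_norm ?expwt_ge0// ler_piMr ?expwt_ge0.
- exact: integrable_expwt.
Qed.

Lemma measurable_cos_dotp n (z : n.-tuple R) :
  measurable_fun setT (fun x => cos (dotp z x)).
Proof.
apply: measurableT_comp; last exact: measurable_dotp.
by apply: continuous_measurable_fun; exact: continuous_cos.
Qed.

Lemma measurable_sin_dotp n (z : n.-tuple R) :
  measurable_fun setT (fun x => sin (dotp z x)).
Proof.
apply: measurableT_comp; last exact: measurable_dotp.
by apply: continuous_measurable_fun; exact: continuous_sin.
Qed.

Lemma integrable_expwt_cos e n (z : n.-tuple R) : 0 < e ->
  (lebesgue_tuple R n).-integrable setT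
    (EFin \o (fun x => expwt e x * cos (dotp z x))).
Proof.
move=> e0; apply: integrable_expwtM => //; first exact: measurable_cos_dotp.
by move=> x; exact: normr_cos_le1.
Qed.

Lemma integrable_expwt_sin e n (z : n.-tuple R) : 0 < e ->
  (lebesgue_tuple R n).-integrable setT
    (EFin \o (fun x => expwt e x * sin (dotp z x))).
Proof.
move=> e0; apply: integrable_expwtM => //; first exact: measurable_sin_dotp.
by move=> x; exact: normr_sin_le1.
Qed.

(** The two integrals go through one induction: splitting off the first coordinate by the addition
    formulas mixes cosine and sine of the remaining scalar product. The sine term vanishes at every
    stage, and a product of one-dimensional kernels remains. *)
Lemma Rintegral_expwt_cos_sin e n (z : n.-tuple R) : 0 < e ->
  (\int[lebesgue_tuple R n]_x (expwt e x * cos (dotp z x)))%R = poissont e z /\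
  (\int[lebesgue_tuple R n]_x (expwt e x * sin (dotp z x)))%R = 0.
Proof.
move=> e0; elim: n z => [|n IH] z.
  have d0 (x : 0.-tuple R) : dotp z x = 0 by rewrite /dotp big_ord0.
  have w0 (x : 0.-tuple R) : expwt e x = 1 by rewrite /expwt /tensor big_ord0.
  split; rewrite /Rintegral; under eq_integral do rewrite d0 w0.
    rewrite cos0 mulr1 integral_cst// mul1e [X in fine X]diracE mem_set//=.
    by rewrite /poissont /tensor big_ord0.
  by rewrite sin0 mulr0 integral0.
have [IHc IHs] := IH [tuple of behead z].
set z' := [tuple of behead z] in IHc IHs *.
have Ic := integrable_expwt_cos z' e0; have Is := integrable_expwt_sin z' e0.
(* [a] and [b] stand for the factors that depend only on the first coordinate in the addition
   formula. *)
have inner (a b : R) : (\int[lebesgue_tuple R n]_x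
    (a * (expwt e x * cos (dotp z' x)) + b * (expwt e x * sin (dotp z' x))))%R
    = a * poissont e z'.
  rewrite RintegralD//; [|exact: (integrableZl _ a Ic)|exact: (integrableZl _ b Is)].
  by rewrite !RintegralZl// IHc IHs mulr0 addr0.
have Iinner (a b : R) : (lebesgue_tuple R n).-integrable setT (EFin \o (fun x =>
    (a * (expwt e x * cos (dotp z' x)) + b * (expwt e x * sin (dotp z' x))))).
  apply: eq_integrable (integrableD _ (integrableZl _ a Ic) (integrableZl _ b Is)) => //.
split.
- apply: EFin_inj; rewrite EFin_Rintegral//; last exact: integrable_expwt_cos.
  rewrite integral_tupleS; last exact: integrable_expwt_cos.
  transitivity (\int[mu]_h (poissont e z' * (expw e h * cos (thead z * h)))%:E)%E.
    apply: eq_integral => h _.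
    rewrite [RHS](_ : _ = ((\int[lebesgue_tuple R n]_x
      ((expw e h * cos (thead z * h)) * (expwt e x * cos (dotp z' x)) +
       (- (expw e h * sin (thead z * h))) * (expwt e x * sin (dotp z' x))))%R)%:E); last first.
      by rewrite inner mulrC.
    rewrite EFin_Rintegral//; apply: eq_integral => x _; congr EFin.
    by rewrite /expwt tensor_cons dotp_cons cosD; ring.
  have mcz : measurable_fun setT (fun x : R => cos (thead z * x)).
    by apply: continuous_measurable_fun; exact: continuous_cosM.
  have Ih := integrable_expwM e0 mcz (fun x => normr_cos_le1 _).
  rewrite -[LHS]EFin_Rintegral//; last exact: (integrableZl _ (poissont e z') Ih).
  congr EFin; rewrite RintegralZl// Rintegral_expw_cos// mulrC.
  rewrite /poissont /tensor big_ord_recl; congr (_ * _).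
  apply: eq_bigr => i _; rewrite tnth_behead; congr (poissonk e (tnth _ _)).
  by apply: val_inj; rewrite /= inordK// ltnS.
- apply: EFin_inj; rewrite EFin_Rintegral//; last exact: integrable_expwt_sin.
  rewrite integral_tupleS; last exact: integrable_expwt_sin.
  transitivity (\int[mu]_h (poissont e z' * (expw e h * sin (thead z * h)))%:E)%E.
    apply: eq_integral => h _.
    rewrite [RHS](_ : _ = ((\int[lebesgue_tuple R n]_x
      ((expw e h * sin (thead z * h)) * (expwt e x * cos (dotp z' x)) +
       ((expw e h * cos (thead z * h))) * (expwt e x * sin (dotp z' x))))%R)%:E); last first.
      by rewrite inner mulrC.
    rewrite EFin_Rintegral//; apply: eq_integral => x _; congr EFin.
    by rewrite /expwt tensor_cons dotp_cons sinD; ring.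
  have mcz : measurable_fun setT (fun x : R => sin (thead z * x)).
    by apply: continuous_measurable_fun; exact: continuous_sinM.
  have Ih := integrable_expwM e0 mcz (fun x => normr_sin_le1 _).
  rewrite -[LHS]EFin_Rintegral//; last exact: (integrableZl _ (poissont e z') Ih).
  by congr EFin; rewrite RintegralZl// Rintegral_expw_sin// mulr0.
Qed.

End tensor.

(** * Bessel inequalities for cosine and sine integrals *)

Section bessel.
Variables (R : realType) (n : nat).
Local Notation mu := (@lebesgue_measure R).
Local Notation leb := (lebesgue_tuple R n).
Implicit Types x y z : n.-tuple R.

Lemma dotpDl x y z : dotp (tadd x y) z = dotp x z + dotp y z.
Proof.
rewrite /dotp -big_split/=; apply: eq_bigr => i _.
by rewrite tnth_mktuple mulrDl.
Qed.

Lemma dotpZl c x y : dotp (tscale c x) y = c * dotp x y.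
Proof.
rewrite /dotp mulr_sumr; apply: eq_bigr => i _.
by rewrite tnth_mktuple mulrA.
Qed.

Lemma poissont_ge0 e z : 0 < e -> 0 <= poissont e z.
Proof. by move=> e0; apply: tensor_ge0 => _ u; exact: poissonk_ge0. Qed.

Lemma measurable_poissonk e : 0 < e -> measurable_fun setT (@poissonk R e).
Proof. by move=> e0; apply: continuous_measurable_fun; exact: continuous_poissonk. Qed.

Lemma integral_poissont_sub e x : 0 < e ->
  (\int[leb]_y (poissont e (tadd x (tscale (-1) y)))%:E = ((2 * pi) ^+ n)%:E)%E.
Proof.
move=> e0.
transitivity (\int[leb]_y (tensor (fun i u => poissonk e (u - tnth x i)) y)%:E)%E.
  apply: eq_integral => y _; congr EFin; apply: eq_bigr => i _.
  by rewrite !tnth_mktuple /poissonk mulN1r -(opprB (tnth y i)) sqrrN.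
have mP (i : 'I_n) : measurable_fun setT (fun u : R => poissonk e (u - tnth x i)).
  by apply: measurableT_comp; [exact: measurable_poissonk|exact: measurable_funB].
rewrite (@ge0_integral_tensor _ _ _ (fun=> 2 * pi))//.
- by rewrite prodr_const card_ord.
- by move=> i u; exact: poissonk_ge0.
- move=> i; rewrite -(integral_poissonk e0).
  apply: (@ge0_integral_translation R (- tnth x i) (fun u => (poissonk e u)%:E)).
    by apply/measurable_EFinP; exact: measurable_poissonk.
  by move=> u; rewrite lee_fin poissonk_ge0.
Qed.

Lemma integral_poissont_add e x : 0 < e ->
  (\int[leb]_y (poissont e (tadd x y))%:E = ((2 * pi) ^+ n)%:E)%E.
Proof.
move=> e0.
transitivity (\int[leb]_y (tensor (fun i u => poissonk e (u + tnth x i)) y)%:E)%E.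
  apply: eq_integral => y _; congr EFin; apply: eq_bigr => i _.
  by rewrite !tnth_mktuple addrC.
have mP (i : 'I_n) : measurable_fun setT (fun u : R => poissonk e (u + tnth x i)).
  by apply: measurableT_comp; [exact: measurable_poissonk|exact: measurable_funD].
rewrite (@ge0_integral_tensor _ _ _ (fun=> 2 * pi))//.
- by rewrite prodr_const card_ord.
- by move=> i u; exact: poissonk_ge0.
- move=> i; rewrite -(integral_poissonk e0).
  apply: (@ge0_integral_translation R (tnth x i) (fun u => (poissonk e u)%:E)).
    by apply/measurable_EFinP; exact: measurable_poissonk.
  by move=> u; rewrite lee_fin poissonk_ge0.
Qed.

Lemma measurable_poissont_sub e x : 0 < e ->
  measurable_fun setT (fun y => poissont e (tadd x (tscale (-1) y))).
Proof.
move=> e0; apply: (measurableT_comp (f := @poissont R e n)).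
  by apply: measurable_tensor => _; exact: measurable_poissonk.
apply: measurable_tuple_fun => i; apply: measurable_funD => //.
apply: (measurableT_comp (measurable_tnth i)); exact: measurable_tscale.
Qed.

Lemma measurable_poissont_add e x : 0 < e ->
  measurable_fun setT (fun y => poissont e (tadd x y)).
Proof.
move=> e0; apply: (measurableT_comp (f := @poissont R e n)).
  by apply: measurable_tensor => _; exact: measurable_poissonk.
apply: measurable_tuple_fun => i; apply: measurable_funD => //.
exact: measurable_tnth.
Qed.

(** By the product-to-sum formula the Gram kernel of the cosines is half the sum of the Poisson
    kernels at x - y and x + y; this is its row integral, the [M] of the Schur test. *)
Lemma integral_half_poissont e x : 0 < e ->
  (\int[leb]_y ((poissont e (tadd x (tscale (-1) y)) + poissont e (tadd x y)) / 2)%:E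
   = ((2 * pi) ^+ n)%:E)%E.
Proof.
move=> e0.
have mS := measurable_poissont_sub x e0; have mA := measurable_poissont_add x e0.
under eq_integral do rewrite mulrC EFinM EFinD.
rewrite ge0_integralZl//; last 2 first.
- by apply: emeasurable_funD; apply/measurable_EFinP.
- by move=> y _; rewrite adde_ge0// lee_fin poissont_ge0.
rewrite ge0_integralD//; last 4 first.
- by move=> y _; rewrite lee_fin poissont_ge0.
- exact/measurable_EFinP.
- by move=> y _; rewrite lee_fin poissont_ge0.
- exact/measurable_EFinP.
rewrite integral_poissont_sub// integral_poissont_add// -EFinD -EFinM.
by congr EFin; field.
Qed.

Section real.
Variable h : n.-tuple R -> R.
Hypothesis Ih : leb.-integrable setT (EFin \o h).

Let mdot : measurable_fun setT (fun p : n.-tuple R * n.-tuple R => dotp p.1 p.2).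
Proof. exact: measurable_dotp. Qed.

Lemma weighted_bessel_cos e : 0 < e ->
  (\int[leb]_x (expwt e x * (\int[leb]_y (cos (dotp y x) * h y))%R ^+ 2)%:E <=
   ((2 * pi) ^+ n)%:E * \int[leb]_y (h y ^+ 2)%:E)%E.
Proof.
move=> e0.
apply: (@schur_bessel _ _ _ _ _ leb leb (@expwt R e n)
  (fun p => cos (dotp p.1 p.2)) h) => //.
- exact: expwt_ge0.
- exact: integrable_expwt.
- apply: measurableT_comp mdot.
  by apply: continuous_measurable_fun; exact: continuous_cos.
- by move=> p; exact: normr_cos_le1.
move=> x; rewrite -(integral_half_poissont x e0) /=.
apply: ge0_le_integral => //=.
- apply/measurable_EFinP; apply: measurableT_comp => //.
  apply: (@measurable_Rintegral_param R _ _ (n.-tuple R) (n.-tuple R) leb setT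
    (fun q : n.-tuple R * n.-tuple R =>
      expwt e q.2 * (cos (dotp x q.2) * cos (dotp q.1 q.2)))) => //.
  apply: measurable_funM; first by apply: measurableT_comp => //; exact: measurable_expwt.
  apply: measurable_funM.
    by apply: (measurableT_comp (measurable_cos_dotp x)).
  apply: measurableT_comp mdot.
  by apply: continuous_measurable_fun; exact: continuous_cos.
- apply/measurable_EFinP; apply: measurable_funM => //.
  apply: measurable_funD; first exact: measurable_poissont_sub.
  exact: measurable_poissont_add.
move=> y _; rewrite lee_fin.
have E u : expwt e u * (cos (dotp x u) * cos (dotp y u)) =
  2^-1 * (expwt e u * cos (dotp (tadd x (tscale (-1) y)) u)) +
  2^-1 * (expwt e u * cos (dotp (tadd x y) u)).
  by rewrite !dotpDl dotpZl mulN1r cosB cosD; field.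
under eq_Rintegral do rewrite E.
have Ia := integrable_expwt_cos (tadd x y) e0.
have Is := integrable_expwt_cos (tadd x (tscale (-1) y)) e0.
rewrite RintegralD//; [|exact: (integrableZl _ 2^-1 Is)|exact: (integrableZl _ 2^-1 Ia)].
rewrite !RintegralZl// (Rintegral_expwt_cos_sin _ e0).1 (Rintegral_expwt_cos_sin _ e0).1.
rewrite ger0_norm ?addr_ge0 ?mulr_ge0 ?poissont_ge0// le_eqVlt.
by apply/orP; left; apply/eqP; field.
Qed.

(** For sines the product-to-sum formula gives half a difference of Poisson kernels. Its absolute
    value is bounded by the half-sum, so the constant is that of the cosines. *)
Lemma weighted_bessel_sin e : 0 < e ->
  (\int[leb]_x (expwt e x * (\int[leb]_y (sin (dotp y x) * h y))%R ^+ 2)%:E <=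
   ((2 * pi) ^+ n)%:E * \int[leb]_y (h y ^+ 2)%:E)%E.
Proof.
move=> e0.
apply: (@schur_bessel _ _ _ _ _ leb leb (@expwt R e n)
  (fun p => sin (dotp p.1 p.2)) h) => //.
- exact: expwt_ge0.
- exact: integrable_expwt.
- apply: measurableT_comp mdot.
  by apply: continuous_measurable_fun; exact: continuous_sin.
- by move=> p; exact: normr_sin_le1.
move=> x; rewrite -(integral_half_poissont x e0) /=.
apply: ge0_le_integral => //=.
- apply/measurable_EFinP; apply: measurableT_comp => //.
  apply: (@measurable_Rintegral_param R _ _ (n.-tuple R) (n.-tuple R) leb setT
    (fun q : n.-tuple R * n.-tuple R =>
      expwt e q.2 * (sin (dotp x q.2) * sin (dotp q.1 q.2)))) => //.
  apply: measurable_funM; first by apply: measurableT_comp => //; exact: measurable_expwt.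
  apply: measurable_funM.
    by apply: (measurableT_comp (measurable_sin_dotp x)).
  apply: measurableT_comp mdot.
  by apply: continuous_measurable_fun; exact: continuous_sin.
- apply/measurable_EFinP; apply: measurable_funM => //.
  apply: measurable_funD; first exact: measurable_poissont_sub.
  exact: measurable_poissont_add.
move=> y _; rewrite lee_fin.
have E u : expwt e u * (sin (dotp x u) * sin (dotp y u)) =
  2^-1 * (expwt e u * cos (dotp (tadd x (tscale (-1) y)) u)) -
  2^-1 * (expwt e u * cos (dotp (tadd x y) u)).
  by rewrite !dotpDl dotpZl mulN1r cosB cosD; field.
under eq_Rintegral do rewrite E.
have Ia := integrable_expwt_cos (tadd x y) e0.
have Is := integrable_expwt_cos (tadd x (tscale (-1) y)) e0.
rewrite RintegralB//; [|exact: (integrableZl _ 2^-1 Is)|exact: (integrableZl _ 2^-1 Ia)].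
rewrite !RintegralZl// (Rintegral_expwt_cos_sin _ e0).1 (Rintegral_expwt_cos_sin _ e0).1.
apply: le_trans (ler_normB _ _) _.
rewrite !ger0_norm ?mulr_ge0 ?poissont_ge0// le_eqVlt.
by apply/orP; left; apply/eqP; field.
Qed.

End real.

Lemma expwtE (e : R) x : expwt e x = expR (- (e * \sum_(i < n) `|tnth x i|)).
Proof. by rewrite mulr_sumr -sumrN expR_sum. Qed.

(** Along e = 1/(m + 1) the weights increase to 1 pointwise, so monotone convergence transfers a
    bound uniform in [e] to the unweighted integral, with no prior integrability of [C]. *)
Lemma bessel_limit (C : n.-tuple R -> R) (B : \bar R) :
  measurable_fun setT C -> (forall x, 0 <= C x) ->
  (forall e : R, (0 < e)%R -> \int[leb]_x (expwt e x * C x)%:E <= B)%E ->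
  (\int[leb]_x (C x)%:E <= B)%E.
Proof.
move=> mC C0 H.
pose g (m : nat) x := (expwt m.+1%:R^-1 x * C x)%:E.
have mg m : measurable_fun setT (g m).
  by apply/measurable_EFinP; apply: measurable_funM => //; exact: measurable_expwt.
have g0 m x : (0 <= g m x)%E by rewrite lee_fin mulr_ge0 ?expwt_ge0.
have gl x : g m x @[m --> \oo] --> (C x)%:E.
  apply: cvg_EFin; first exact: nearW.
  pose S := \sum_(i < n) `|tnth x i|.
  have e1 : expR (- (m.+1%:R^-1 * S)) @[m --> \oo] --> expR (- (0 * S)).
    apply: continuous_cvg; first exact: continuous_expR.
    by apply: cvgN; apply: cvgMr_tmp; exact: cvg_harmonic.
  rewrite mul0r oppr0 expR0 in e1.
  have e2 : expR (- (m.+1%:R^-1 * S)) * C x @[m --> \oo] --> 1 * C x.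
    exact: cvgMr_tmp.
  rewrite mul1r in e2; apply: cvg_trans e2; apply: near_eq_cvg.
  by apply: nearW => m; rewrite /= expwtE.
have gnd x : {homo g ^~ x : p q / (p <= q)%N >-> (p <= q)%E}.
  move=> p q pq; rewrite lee_fin ler_wpM2r// !expwtE ler_expR lerN2.
  rewrite ler_wpM2r ?sumr_ge0// lef_pV2 ?posrE//.
  by rewrite ler_nat ltnS.
have := @cvg_monotone_convergence _ _ _ leb setT measurableT g mg
  (fun m x _ => g0 m x) (fun x _ => gnd x).
have -> : (\int[leb]_x (fun x0 => limn (g^~ x0)) x = \int[leb]_x (C x)%:E)%E.
  by apply: eq_integral => x _; apply/cvg_lim => //; exact: gl.
move=> /cvg_lim <-//; apply: lime_le.
  by apply/cvg_ex; exists (\int[leb]_x (limn (g^~ x)))%E; exact: cvg_monotone_convergence.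
by apply: nearW => m; apply: H; rewrite invr_gt0.
Qed.

End bessel.

Local Open Scope complex_scope.
Local Notation Re := complex.Re.
Local Notation Im := complex.Im.
Local Notation normc := Normc.normc.

(** * Complex-valued integrals and the inverse Fourier transform *)

Section complex_facts.
Variable R : realType.
Implicit Types z w : R[i].

Lemma sqr_normcE z : normc z ^+ 2 = Re z ^+ 2 + Im z ^+ 2.
Proof. by case: z => a b; rewrite /normc/= sqr_sqrtr// addr_ge0 ?sqr_ge0. Qed.

Lemma normc_ge0 z : 0 <= normc z.
Proof. by case: z => a b; exact: sqrtr_ge0. Qed.

Lemma normr_Re_normc z : `|Re z| <= normc z.
Proof.
rewrite -(@ler_pXn2r _ 2) ?nnegrE ?normc_ge0// sqr_normcE real_normK ?num_real//.
by rewrite lerDl sqr_ge0.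
Qed.

Lemma normr_Im_normc z : `|Im z| <= normc z.
Proof.
rewrite -(@ler_pXn2r _ 2) ?nnegrE ?normc_ge0// sqr_normcE real_normK ?num_real//.
by rewrite lerDr sqr_ge0.
Qed.

Lemma normc_leD z w : normc (z + w) <= normc z + normc w.
Proof. exact: (@le_normcD R). Qed.

Lemma normc_leB z w : normc (z - w) <= normc z + normc w.
Proof. by rewrite -[leRHS](_ : normc z + normc (- w) = _) ?normc_leD// (@normcN R). Qed.

Lemma normc_real (r : R) : normc r%:C = `|r|.
Proof. by rewrite /normc/= expr0n addr0 sqrtr_sqr. Qed.

Lemma normcX z n : normc (z ^+ n) = normc z ^+ n.
Proof.
elim: n => [|n IH]; first by rewrite !expr0 Normc.normc1.
by rewrite !exprS Normc.normcM IH.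
Qed.

Lemma cReM z w : Re (z * w) = Re z * Re w - Im z * Im w.
Proof. by case: z w => a b [c e]. Qed.

Lemma cImM z w : Im (z * w) = Re z * Im w + Im z * Re w.
Proof. by case: z w => a b [c e]. Qed.

Lemma cReD z w : Re (z + w) = Re z + Re w.
Proof. by case: z w => a b [c e]. Qed.

Lemma cImD z w : Im (z + w) = Im z + Im w.
Proof. by case: z w => a b [c e]. Qed.

Lemma cReN z : Re (- z) = - Re z.
Proof. by case: z. Qed.

Lemma cImN z : Im (- z) = - Im z.
Proof. by case: z. Qed.

Lemma complexP z w : Re z = Re w -> Im z = Im w -> z = w.
Proof. by case: z w => a b [c e] /= -> ->. Qed.

Lemma cexpi (t : R) : cexp (t *i) = cos t +i* sin t.
Proof. by apply: complexP; rewrite /cexp/= expR0; ring. Qed.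

Lemma cexpD z w : cexp (z + w) = cexp z * cexp w.
Proof.
by apply: complexP; rewrite /cexp ?cReM ?cImM ?cReM ?cImM/= ?cReD ?cImD expRD cosD sinD; ring.
Qed.

Lemma normc_cexp z : normc (cexp z) = expR (Re z).
Proof.
rewrite Normc.normcM normc_real ger0_norm ?expR_ge0//.
by rewrite /normc cos2Dsin2 sqrtr1 mulr1.
Qed.

Lemma sqr_normc_cexpi_sub1 (t : R) : normc (cexp (t *i) - 1) ^+ 2 = 2 - 2 * cos t.
Proof.
rewrite sqr_normcE cexpi /= oppr0 addr0.
by have := cos2Dsin2 t; rewrite sqrrB; lra.
Qed.

End complex_facts.

Section cintegrable.
Variables (R : realType) (n : nat).
Local Notation leb := (lebesgue_tuple R n).
Implicit Types (f g : n.-tuple R -> R[i]).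

Definition cintegrable f : Prop :=
  leb.-integrable setT (EFin \o (fun x => Re (f x))) /\
  leb.-integrable setT (EFin \o (fun x => Im (f x))).

Lemma measurable_normc (dT : measure_display) (T : measurableType dT) (f : T -> R[i]) :
  cmeasurable f -> measurable_fun setT (fun x => normc (f x)).
Proof.
move=> [m1 m2].
rewrite (_ : (fun x => _) = (fun x => Num.sqrt (Re (f x) ^+ 2 + Im (f x) ^+ 2))).
  apply: measurableT_comp; first by apply: continuous_measurable_fun; exact: sqrt_continuous.
  by apply: measurable_funD; exact: measurable_funX.
by apply/funext => x; rewrite -sqr_normcE sqrtr_sqr ger0_norm// normc_ge0.
Qed.

Lemma cmeasurableM (dT : measure_display) (T : measurableType dT) (f g : T -> R[i]) :
  cmeasurable f -> cmeasurable g -> cmeasurable (fun x => f x * g x).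
Proof.
move=> [f1 f2] [g1 g2]; split.
  by under eq_fun do rewrite cReM; apply: measurable_funB; exact: measurable_funM.
by under eq_fun do rewrite cImM; apply: measurable_funD; exact: measurable_funM.
Qed.

Lemma cmeasurableX (dT : measure_display) (T : measurableType dT) (f : T -> R[i]) k :
  cmeasurable f -> cmeasurable (fun x => f x ^+ k).
Proof.
move=> mf; elim: k => [|k IH]; first by split.
by under eq_fun do rewrite exprS; exact: cmeasurableM.
Qed.

Lemma cmeasurable_cexp (dT : measure_display) (T : measurableType dT) (f : T -> R[i]) :
  cmeasurable f -> cmeasurable (fun x => cexp (f x)).
Proof.
move=> [f1 f2]; apply: cmeasurableM; split => //=.
- by apply: measurableT_comp => //; exact: measurable_expR.
- by apply: measurableT_comp f2; apply: continuous_measurable_fun; exact: continuous_cos.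
- by apply: measurableT_comp f2; apply: continuous_measurable_fun; exact: continuous_sin.
Qed.

Lemma cintegrable_cmeasurable f : cintegrable f -> cmeasurable f.
Proof.
by move=> [f1 f2]; split; apply/measurable_EFinP; [exact: measurable_int f1|exact: measurable_int f2].
Qed.

Lemma dominated_cintegrable f (u : n.-tuple R -> R) : cmeasurable f ->
  (forall x, normc (f x) <= u x) -> leb.-integrable setT (EFin \o u) ->
  cintegrable f.
Proof.
move=> [f1 f2] fu Iu; split; apply: (dominated_integrable _ _ _ Iu) => // x _.
  exact: le_trans (normr_Re_normc _) (fu x).
exact: le_trans (normr_Im_normc _) (fu x).
Qed.

Lemma cintegrable_normc f : cintegrable f ->
  leb.-integrable setT (EFin \o (fun x => normc (f x))).
Proof.
move=> If; have [f1 f2] := If; have mf := cintegrable_cmeasurable If.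
apply: (dominated_integrable (g := fun x => `|Re (f x)| + `|Im (f x)|)) => //.
- exact: measurable_normc.
- move=> x _; rewrite ger0_norm ?normc_ge0//.
  rewrite -(@ler_pXn2r _ 2) ?nnegrE ?normc_ge0 ?addr_ge0// sqr_normcE sqrrD.
  by rewrite !real_normK ?num_real// lerD2r lerDl mulrn_wge0// mulr_ge0.
- exact: (integrableD _ (integrable_norm f1) (integrable_norm f2)).
Qed.

Lemma cintegrableM f g (B : R) : cintegrable f -> cmeasurable g ->
  (forall x, normc (g x) <= B) -> cintegrable (fun x => g x * f x).
Proof.
move=> If mg gB.
apply: (dominated_cintegrable (u := fun x => B * normc (f x))).
- exact/cmeasurableM/cintegrable_cmeasurable.
- by move=> x; rewrite Normc.normcM ler_wpM2r// normc_ge0.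
- exact: (integrableZl _ B (cintegrable_normc If)).
Qed.

Lemma cintegrableB f g : cintegrable f -> cintegrable g ->
  cintegrable (fun x => f x - g x).
Proof.
move=> [f1 f2] [g1 g2]; split.
  rewrite (_ : _ \o _ = (EFin \o (fun x => Re (f x))) \- (EFin \o (fun x => Re (g x))))%E.
    exact: integrableB.
  by apply/funext => x /=; rewrite cReD cReN.
rewrite (_ : _ \o _ = (EFin \o (fun x => Im (f x))) \- (EFin \o (fun x => Im (g x))))%E.
  exact: integrableB.
by apply/funext => x /=; rewrite cImD cImN.
Qed.

Lemma cintegrable_tadd f y : cintegrable f -> cintegrable (fun x => f (tadd x y)).
Proof.
have H u : leb.-integrable setT (EFin \o u) ->
    leb.-integrable setT (EFin \o (fun x => u (tadd x y))).
  move=> /integrableP[mu uoo]; apply/integrableP; split.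
    exact: (measurableT_comp mu (measurable_tadd y)).
  rewrite (ge0_integral_tadd y (f := fun x => `|(u x)%:E|%E))//.
  exact: measurableT_comp.
by move=> [f1 f2]; split; [exact: H f1|exact: H f2].
Qed.

Lemma cintegralB f g : cintegrable f -> cintegrable g ->
  cintegral leb setT (fun x => f x - g x) =
  cintegral leb setT f - cintegral leb setT g.
Proof.
move=> [f1 f2] [g1 g2]; apply: complexP; rewrite ?cReD ?cReN ?cImD ?cImN /=.
  by under eq_Rintegral do rewrite cReD cReN; exact: RintegralB.
by under eq_Rintegral do rewrite cImD cImN; exact: RintegralB.
Qed.

Lemma cintegralZl (c : R[i]) f : cintegrable f ->
  cintegral leb setT (fun x => c * f x) = c * cintegral leb setT f.
Proof.
move=> [f1 f2]; apply: complexP; rewrite ?cReM ?cImM /=.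
  under eq_Rintegral do rewrite cReM.
  rewrite RintegralB//; [|exact: (integrableZl _ _ f1)|exact: (integrableZl _ _ f2)].
  by rewrite !RintegralZl.
under eq_Rintegral do rewrite cImM.
rewrite RintegralD//; [|exact: (integrableZl _ _ f2)|exact: (integrableZl _ _ f1)].
by rewrite !RintegralZl.
Qed.

Lemma cintegral_tadd f y : cmeasurable f ->
  cintegral leb setT (fun x => f (tadd x y)) = cintegral leb setT f.
Proof.
move=> [m1 m2]; apply: complexP; rewrite /= /Rintegral.
  rewrite (integral_tadd y (f := fun x => (Re (f x))%:E))//.
  exact/measurable_EFinP.
rewrite (integral_tadd y (f := fun x => (Im (f x))%:E))//.
exact/measurable_EFinP.
Qed.

End cintegrable.

(** * The L^2 bound for the inverse Fourier transform *)

Section fourier.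
Variables (R : realType) (n : nat).
Local Notation leb := (lebesgue_tuple R n).
Implicit Types (f g : n.-tuple R -> R[i]) (x y : n.-tuple R).

Lemma cmeasurable_character x :
  cmeasurable (fun xi : n.-tuple R => cexp ((dotp xi x) *i)).
Proof.
apply: cmeasurable_cexp; split => //=.
exact: measurable_dotp.
Qed.

Lemma normc_character (t : R) : normc (cexp (t *i)) = 1.
Proof. by rewrite normc_cexp/= expR0. Qed.

Lemma cintegrable_character f x : cintegrable f ->
  cintegrable (fun xi => cexp ((dotp xi x) *i) * f xi).
Proof.
move=> If; apply: (cintegrableM (B := 1)) => //; first exact: cmeasurable_character.
by move=> xi; rewrite normc_character.
Qed.

Lemma measurable_trig_integral (c : R -> R) (u : n.-tuple R -> R) : continuous c ->
  measurable_fun setT u ->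
  measurable_fun setT (fun x => (\int[leb]_y (c (dotp y x) * u y))%R).
Proof.
move=> cc mu.
apply: (@measurable_Rintegral_param R _ _ (n.-tuple R) (n.-tuple R) leb setT
  (fun p => c (dotp p.2 p.1) * u p.2)) => //.
apply: measurable_funM; last exact: measurableT_comp.
by apply: measurableT_comp; [exact: continuous_measurable_fun|exact: measurable_dotp].
Qed.

Lemma trig_bessel (c : R -> R) (u : n.-tuple R -> R) : continuous c ->
  leb.-integrable setT (EFin \o u) ->
  (forall e, 0 < e ->
    (\int[leb]_x (expwt e x * (\int[leb]_y (c (dotp y x) * u y))%R ^+ 2)%:E <=
     ((2 * pi) ^+ n)%:E * \int[leb]_y (u y ^+ 2)%:E)%E) ->
  (\int[leb]_x ((\int[leb]_y (c (dotp y x) * u y))%R ^+ 2)%:E <=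
     ((2 * pi) ^+ n)%:E * \int[leb]_y (u y ^+ 2)%:E)%E.
Proof.
move=> cc Iu H; apply: bessel_limit => //; last by move=> x; exact: sqr_ge0.
apply: measurable_funX; apply: measurable_trig_integral => //.
by apply/measurable_EFinP; exact: measurable_int Iu.
Qed.

Lemma integrable_trig (c : R -> R) u x : continuous c -> (forall t, `|c t| <= 1) ->
  leb.-integrable setT (EFin \o u) ->
  leb.-integrable setT (EFin \o (fun y => c (dotp y x) * u y)).
Proof.
move=> cc c1 Iu; apply: (dominated_integrable _ _ _ (integrable_norm Iu)) => //.
  apply: measurable_funM; last by apply/measurable_EFinP; exact: measurable_int Iu.
  by apply: measurableT_comp; [exact: continuous_measurable_fun|exact: measurable_dotp].
by move=> y _; rewrite normrM ler_piMl.
Qed.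

Lemma Re_fourier g x : cintegrable g ->
  Re (cintegral leb setT (fun xi => cexp ((dotp xi x) *i) * g xi)) =
  (\int[leb]_y (cos (dotp y x) * Re (g y)))%R -
  (\int[leb]_y (sin (dotp y x) * Im (g y)))%R.
Proof.
move=> [g1 g2] /=; under eq_Rintegral do rewrite cReM cexpi/=.
rewrite RintegralB//; apply: integrable_trig => //.
- exact: continuous_cos.
- exact: normr_cos_le1.
- exact: continuous_sin.
- exact: normr_sin_le1.
Qed.

Lemma Im_fourier g x : cintegrable g ->
  Im (cintegral leb setT (fun xi => cexp ((dotp xi x) *i) * g xi)) =
  (\int[leb]_y (cos (dotp y x) * Im (g y)))%R +
  (\int[leb]_y (sin (dotp y x) * Re (g y)))%R.
Proof.
move=> [g1 g2] /=; under eq_Rintegral do rewrite cImM cexpi/=.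
rewrite RintegralD//; apply: integrable_trig => //.
- exact: continuous_cos.
- exact: normr_cos_le1.
- exact: continuous_sin.
- exact: normr_sin_le1.
Qed.

Lemma cmeasurable_inverse_fourier g : cintegrable g ->
  cmeasurable (inverse_fourier g).
Proof.
move=> Ig; have [m1 m2] := cintegrable_cmeasurable Ig.
apply: cmeasurableM; first by split.
split.
  under eq_fun do rewrite Re_fourier//.
  apply: measurable_funB; apply: measurable_trig_integral => //.
    exact: continuous_cos.
  exact: continuous_sin.
under eq_fun do rewrite Im_fourier//.
apply: measurable_funD; apply: measurable_trig_integral => //.
  exact: continuous_cos.
exact: continuous_sin.
Qed.

(** Four times the Plancherel constant (2 pi)^(-n). One factor 2 comes from (p + q)^2 <= 2 (p^2 +
    q^2) in the real and imaginary parts of the transform, the other from bounding a cosine and a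
    sine integral for each component of g. *)
Definition bessel_cst : R := ((2 * pi) ^- n) ^+ 2 * (4 * (2 * pi) ^+ n).

Lemma bessel_cst_ge0 : 0 <= bessel_cst.
Proof.
by rewrite mulr_ge0 ?sqr_ge0// mulr_ge0// exprn_ge0// mulr_ge0// pi_ge0.
Qed.

Lemma bessel_inverse_fourier g : cintegrable g ->
  (\int[leb]_x (normc (inverse_fourier g x) ^+ 2)%:E <=
   bessel_cst%:E * \int[leb]_y (normc (g y) ^+ 2)%:E)%E.
Proof.
move=> Ig; have [g1 g2] := Ig; have [m1 m2] := cintegrable_cmeasurable Ig.
pose C1 x := (\int[leb]_y (cos (dotp y x) * Re (g y)))%R.
pose S1 x := (\int[leb]_y (sin (dotp y x) * Re (g y)))%R.
pose C2 x := (\int[leb]_y (cos (dotp y x) * Im (g y)))%R.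
pose S2 x := (\int[leb]_y (sin (dotp y x) * Im (g y)))%R.
pose B : R := (2 * pi) ^+ n.
have B0 : 0 <= B by rewrite exprn_ge0// mulr_ge0// pi_ge0.
pose I1 := (\int[leb]_y ((Re (g y)) ^+ 2)%:E)%E.
pose I2 := (\int[leb]_y ((Im (g y)) ^+ 2)%:E)%E.
have I10 : (0 <= I1)%E by apply: integral_ge0 => y _; rewrite lee_fin sqr_ge0.
have I20 : (0 <= I2)%E by apply: integral_ge0 => y _; rewrite lee_fin sqr_ge0.
have bC u : leb.-integrable setT (EFin \o u) ->
    (\int[leb]_x ((\int[leb]_y (cos (dotp y x) * u y))%R ^+ 2)%:E <=
     B%:E * \int[leb]_y (u y ^+ 2)%:E)%E.
  move=> Iu; apply: trig_bessel => //; first exact: continuous_cos.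
  by move=> e e0; exact: weighted_bessel_cos.
have bS u : leb.-integrable setT (EFin \o u) ->
    (\int[leb]_x ((\int[leb]_y (sin (dotp y x) * u y))%R ^+ 2)%:E <=
     B%:E * \int[leb]_y (u y ^+ 2)%:E)%E.
  move=> Iu; apply: trig_bessel => //; first exact: continuous_sin.
  by move=> e e0; exact: weighted_bessel_sin.
have mC u : measurable_fun setT u ->
   measurable_fun setT (fun x => ((\int[leb]_y (cos (dotp y x) * u y))%R ^+ 2)%:E).
  move=> mu; apply/measurable_EFinP; apply: measurable_funX.
  by apply: measurable_trig_integral => //; exact: continuous_cos.
have mS u : measurable_fun setT u ->
   measurable_fun setT (fun x => ((\int[leb]_y (sin (dotp y x) * u y))%R ^+ 2)%:E).
  move=> mu; apply/measurable_EFinP; apply: measurable_funX.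
  by apply: measurable_trig_integral => //; exact: continuous_sin.
have mC1 : measurable_fun setT (fun x => (C1 x ^+ 2)%:E) := mC _ m1.
have mS1 : measurable_fun setT (fun x => (S1 x ^+ 2)%:E) := mS _ m1.
have mC2 : measurable_fun setT (fun x => (C2 x ^+ 2)%:E) := mC _ m2.
have mS2 : measurable_fun setT (fun x => (S2 x ^+ 2)%:E) := mS _ m2.
have bC1 : (\int[leb]_x (C1 x ^+ 2)%:E <= B%:E * I1)%E := bC _ g1.
have bS1 : (\int[leb]_x (S1 x ^+ 2)%:E <= B%:E * I1)%E := bS _ g1.
have bC2 : (\int[leb]_x (C2 x ^+ 2)%:E <= B%:E * I2)%E := bC _ g2.
have bS2 : (\int[leb]_x (S2 x ^+ 2)%:E <= B%:E * I2)%E := bS _ g2.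
move: mC1 mS1 mC2 mS2 bC1 bS1 bC2 bS2 {mC mS bC bS} => mC1 mS1 mC2 mS2 bC1 bS1 bC2 bS2.
have m12 : measurable_fun setT (fun x => (C1 x ^+ 2)%:E + (S1 x ^+ 2)%:E)%E.
  exact: emeasurable_funD.
have m34 : measurable_fun setT (fun x => (C2 x ^+ 2)%:E + (S2 x ^+ 2)%:E)%E.
  exact: emeasurable_funD.
pose c : R := ((2 * pi) ^- n) ^+ 2.
have c0 : 0 <= c by exact: sqr_ge0.
have sq0 (f : n.-tuple R -> R) x : setT x -> (0 <= (f x ^+ 2)%:E)%E.
  by rewrite lee_fin sqr_ge0.
apply: (@le_trans _ _ (\int[leb]_x ((c * 2)%:E *
   (((C1 x ^+ 2)%:E + (S1 x ^+ 2)%:E) + ((C2 x ^+ 2)%:E + (S2 x ^+ 2)%:E))))%E).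
  apply: ge0_le_integral => //.
  - by move=> x _; rewrite lee_fin sqr_ge0.
  - apply/measurable_EFinP; apply: measurable_funX; apply: measurable_normc.
    exact: cmeasurable_inverse_fourier.
  - by apply: measurable_funeM; exact: emeasurable_funD.
  move=> x _; rewrite -!EFinD -EFinM lee_fin /inverse_fourier Normc.normcM.
  rewrite normc_real exprMn real_normK ?num_real// -/c -(mulrA c) ler_wpM2l//.
  rewrite sqr_normcE Re_fourier// Im_fourier// -/(C1 x) -/(S1 x) -/(C2 x) -/(S2 x).
  have := sqr_ge0 (C1 x + S2 x); have := sqr_ge0 (C2 x - S1 x); nra.
rewrite ge0_integralZl//; last 3 first.
- exact: emeasurable_funD.
- by move=> x _; rewrite !adde_ge0// lee_fin sqr_ge0.
- by rewrite lee_fin mulr_ge0.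
rewrite ge0_integralD//; last 2 first.
- by move=> x _; rewrite !adde_ge0// lee_fin sqr_ge0.
- by move=> x _; rewrite !adde_ge0// lee_fin sqr_ge0.
rewrite (ge0_integralD _ _ (sq0 C1) mC1 (sq0 S1) mS1)//.
rewrite (ge0_integralD _ _ (sq0 C2) mC2 (sq0 S2) mS2)//.
apply: (@le_trans _ _ ((c * 2)%:E * ((B%:E * I1 + B%:E * I1) + (B%:E * I2 + B%:E * I2)))%E).
  apply: lee_wpmul2l; first by rewrite lee_fin mulr_ge0.
  exact: leeD (leeD bC1 bS1) (leeD bC2 bS2).
have -> : (\int[leb]_y (normc (g y) ^+ 2)%:E = I1 + I2)%E.
  rewrite -ge0_integralD//; last 4 first.
  - by move=> x _; rewrite lee_fin sqr_ge0.
  - by apply/measurable_EFinP; exact: measurable_funX.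
  - by move=> x _; rewrite lee_fin sqr_ge0.
  - by apply/measurable_EFinP; exact: measurable_funX.
  by apply: eq_integral => y _; rewrite -EFinD sqr_normcE.
have two (I : \bar R) : (0 <= I -> B%:E * I + B%:E * I = (2 * B)%:E * I)%E.
  move=> I0; rewrite -ge0_muleDl ?lee_fin// -EFinD.
  by congr (_%:E * _)%E; ring.
rewrite !two// -ge0_muleDr// muleA -EFinM le_eqVlt; apply/orP; left; apply/eqP.
by congr (_%:E * _)%E; rewrite /bessel_cst -/c -/B; ring.
Qed.

End fourier.

(** Stated for any radius and any p > d because it is used twice: with p = 2 (k - beta) at radius
    2ky for the differences, and with p = d + 1 at radius 1 for the integrability of the symbol. *)
Lemma integral_ball_tail_le (R : realType) (d : nat) (p : R) : d%:R < p ->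
  exists2 C : R, 0 <= C & forall (f : d.-tuple R -> R) (r A B : R),
    measurable_fun setT f -> (forall x, 0 <= f x) -> 0 < r -> 0 <= A -> 0 <= B ->
    (forall x, enorm x < r -> f x <= A) ->
    (forall x, r <= enorm x -> f x <= B * enorm x `^ (- p)) ->
    (\int[lebesgue_tuple R d]_x (f x)%:E <=
      (A * (2 * r) ^+ d + B * (C * r `^ (d%:R - p)))%:E)%E.
Proof.
move=> /integral_enorm_tail[C C0 HC]; exists C => // f r A B mf f0 r0 A0 B0 fA fB.
have mL : measurable [set x : d.-tuple R | enorm x <= r].
  rewrite -[X in measurable X]setTI.
  by apply: measurable_fun_le => //; exact: measurable_enorm.
have mT : measurable [set x : d.-tuple R | r <= enorm x].
  rewrite -[X in measurable X]setTI.
  by apply: measurable_fun_le => //; exact: measurable_enorm.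
have mS : measurable [set x : d.-tuple R | enorm x < r].
  rewrite (_ : [set x | _] = ~` [set x | r <= enorm x]); first exact: measurableC.
  by apply/seteqP; split=> x /=; rewrite ltNge => /negP.
have ST : [set x : d.-tuple R | enorm x < r] `|` [set x | r <= enorm x] = setT.
  by apply/seteqP; split => // x _ /=; have [|] := ltP (enorm x) r; [left|right].
rewrite -ST ge0_integral_setU//; last 3 first.
- by apply/measurable_EFinP; exact: measurable_funTS.
- by move=> x _; rewrite lee_fin.
- by apply/disj_set2P/seteqP; split => // x [/= h1 h2]; move: (lt_le_trans h1 h2); rewrite ltxx.
rewrite EFinD; apply: leeD.
  apply: (@le_trans _ _ (\int[lebesgue_tuple R d]_(x in [set x | enorm x < r]%R) A%:E)%E).
    apply: ge0_le_integral => //.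
    - by move=> x _; rewrite lee_fin.
    - by apply/measurable_EFinP; exact: measurable_funTS.
  rewrite integral_cst// EFinM lee_wpmul2l ?lee_fin//.
  apply: le_trans (lebesgue_tuple_ball d r0).
  by apply: le_measure; rewrite ?inE// => x /= /ltW.
have mp : measurable_fun setT (fun x : d.-tuple R => enorm x `^ (- p)).
  by apply: (measurableT_comp (measurable_powR _)); exact: measurable_enorm.
apply: (@le_trans _ _ (\int[lebesgue_tuple R d]_(x in [set x | r <= enorm x]%R)
   (B%:E * (enorm x `^ (- p))%:E))%E).
  apply: ge0_le_integral => //.
  - by move=> x _; rewrite lee_fin.
  - by apply/measurable_EFinP; exact: measurable_funTS.
  - by apply: measurable_funeM; apply/measurable_EFinP; exact: measurable_funTS.
rewrite ge0_integralZl//; last 2 first.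
- by apply/measurable_EFinP; exact: measurable_funTS.
- by move=> x _; rewrite lee_fin powR_ge0.
by rewrite EFinM lee_wpmul2l ?lee_fin// HC.
Qed.

(** * Finite differences and the inverse Fourier transform *)

Section differences.
Variables (R : realType) (d : nat).
Implicit Types (f g : d.-tuple R -> R[i]) (x xi : d.-tuple R) (i : 'I_d).

Definition coord_vec i (y : R) : d.-tuple R := [tuple if j == i then y else 0 | j < d].

Definition diffq i (y : R) f xi : R[i] := f (tadd xi (coord_vec i y)) - f xi.

Lemma dotp_coord_vec i y x : dotp (coord_vec i y) x = y * tnth x i.
Proof.
rewrite /dotp (bigD1 i)//= tnth_mktuple eqxx big1 ?addr0// => j ji.
by rewrite tnth_mktuple (negbTE ji) mul0r.
Qed.

Lemma enorm_tadd_coord_vec i y xi : 0 <= y ->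
  enorm (tadd xi (coord_vec i y)) <= enorm xi + y.
Proof.
move=> y0; rewrite -(@ler_pXn2r _ 2) ?nnegrE ?addr_ge0 ?enorm_ge0// sqr_enorm.
have -> : dotp (tadd xi (coord_vec i y)) (tadd xi (coord_vec i y)) =
    dotp xi xi + 2 * (y * tnth xi i) + y ^+ 2.
  have dC u v : @dotp R d u v = dotp v u.
    by apply: eq_bigr => j _; rewrite mulrC.
  rewrite dotpDl (dC xi) (dC (coord_vec i y)) !dotpDl (dC xi (coord_vec i y)).
  by rewrite !dotp_coord_vec tnth_mktuple eqxx; ring.
rewrite -sqr_enorm; have := le_tnth_enorm xi i; rewrite ler_norml => /andP[_ h].
by have := ler_wpM2l y0 h; nra.
Qed.

Lemma cintegrable_diffq i y f : cintegrable f -> cintegrable (diffq i y f).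
Proof. by move=> If; apply: cintegrableB => //; exact: cintegrable_tadd. Qed.

Lemma cintegrable_iter_diffq i y f k :
  cintegrable f -> cintegrable (iter k (diffq i y) f).
Proof. by move=> If; elim: k => //= k; exact: cintegrable_diffq. Qed.

Lemma inverse_fourier_diffq i y f x : cintegrable f ->
  inverse_fourier (diffq i y f) x =
  (cexp ((- (y * tnth x i)) *i) - 1) * inverse_fourier f x.
Proof.
move=> If; have Is := cintegrable_tadd (coord_vec i y) If.
rewrite /inverse_fourier mulrCA; congr (_ * _).
transitivity (cintegral (lebesgue_tuple R d) setT
   (fun xi => cexp ((dotp xi x) *i) * f (tadd xi (coord_vec i y)) -
              cexp ((dotp xi x) *i) * f xi)).
  by congr cintegral; apply/funext => xi; rewrite /diffq mulrBr.
rewrite cintegralB; [|exact: cintegrable_character|exact: cintegrable_character].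
rewrite mulrBl mul1r; congr (_ - _).
rewrite -cintegralZl; last exact: cintegrable_character.
(* Translating the right-hand integrand by y e_i puts f(xi + y e_i) on both sides; the phase that
   the character gains cancels exp(- i y x_i). *)
rewrite -[RHS](cintegral_tadd (coord_vec i y)); last first.
  apply: cmeasurableM; first by split; exact: measurable_cst.
  exact/cintegrable_cmeasurable/cintegrable_character.
congr cintegral; apply/funext => xi; rewrite mulrA -cexpD dotpDl dotp_coord_vec.
congr (cexp _ * _); apply: complexP => /=; ring.
Qed.

Lemma inverse_fourier_iter_diffq i y f x k : cintegrable f ->
  inverse_fourier (iter k (diffq i y) f) x =
  (cexp ((- (y * tnth x i)) *i) - 1) ^+ k * inverse_fourier f x.
Proof.
move=> If; elim: k => [|k IH]; first by rewrite expr0 mul1r.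
rewrite iterS inverse_fourier_diffq; last exact: cintegrable_iter_diffq.
by rewrite IH mulrA -exprS.
Qed.

Lemma sqr_normc_iter_diffq i y f x k : cintegrable f ->
  normc (inverse_fourier (iter k (diffq i y) f) x) ^+ 2 =
  (2 - 2 * cos (y * tnth x i)) ^+ k * normc (inverse_fourier f x) ^+ 2.
Proof.
move=> If; rewrite inverse_fourier_iter_diffq// Normc.normcM normcX exprMn.
by rewrite exprAC sqr_normc_cexpi_sub1 cosN.
Qed.

(** Constants disappear after one difference, hence the order [k.+1]. This allows the symbol to be
    measured against its limit at the origin when that limit is not 0. *)
Lemma iter_diffq_sub_cst i y f (c : R[i]) k xi :
  iter k.+1 (diffq i y) (fun u => f u - c) xi = iter k.+1 (diffq i y) f xi.
Proof.
elim: k xi => [|k IH] xi; first by rewrite /= /diffq; ring.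
by rewrite iterS [in LHS]/diffq !IH.
Qed.

(** The 2^k values that enter the difference are all taken within distance k y of [xi]. *)
Lemma normc_iter_diffq_le i y f (r M : R) k xi : 0 <= y ->
  (forall u, enorm u <= r -> normc (f u) <= M) -> enorm xi + k%:R * y <= r ->
  normc (iter k (diffq i y) f xi) <= 2 ^+ k * M.
Proof.
move=> y0 fM; elim: k xi => [|k IH] xi kr.
  by rewrite expr0 mul1r; apply: fM; move: kr; rewrite mul0r addr0.
rewrite iterS; apply: le_trans (normc_leB _ _) _.
rewrite exprS -mulrA mulr_natl mulr2n; rewrite -natr1 in kr.
have h := enorm_tadd_coord_vec i xi y0.
by apply: lerD; apply: IH; nra.
Qed.

End differences.

(** * Weighted estimate from finite differences *)

Section powR_facts.
Variable R : realType.
Implicit Types y s t : R.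

Lemma powRDpos y s t : 0 < y -> y `^ (s + t) = y `^ s * y `^ t.
Proof. by move=> y0; rewrite powRD//; apply/implyP => _; rewrite gt_eqF. Qed.

Lemma powRX y s n : (y `^ s) ^+ n = y `^ (s * n%:R).
Proof. by rewrite -powR_mulrn ?powR_ge0// -powRrM. Qed.

Lemma powR_half_pow (s : R) j : (2 ^- j) `^ s = (2 `^ (- s)) ^+ j.
Proof.
rewrite -powR_invn// -powRrM powRX; congr (_ `^ _); ring.
Qed.

End powR_facts.

Section weighted.
Variables (R : realType) (d k : nat).
Local Notation leb := (lebesgue_tuple R d).

(** The space is cut at |xi| = 2ky. Inside, all points entering the difference have norm at most
    3ky, so the sup bound squared times the volume is of order y^(2 beta) y^d. Outside, the tail
    integral gives y^(2k) y^(d - 2 (k - beta)). Both equal y^(d + 2 beta), and [C3] adds the two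
    coefficients. *)
Lemma diffq_l2_bound (beta C1 C2 : R) : (0 < k)%N -> 0 < beta ->
  d%:R < 2 * (k%:R - beta) -> 0 <= C1 -> 0 <= C2 ->
  exists2 C3 : R, 0 <= C3 & forall (g : d.-tuple R -> R[i]) (c : R[i]) i y,
    0 < y -> cmeasurable (iter k (diffq i y) g) ->
    (forall xi, normc (g xi - c) <= C1 * enorm xi `^ beta) ->
    (forall xi, 2 * k%:R * y <= enorm xi ->
      normc (iter k (diffq i y) g xi) <= C2 * y ^+ k * enorm xi `^ (beta - k%:R)) ->
    (\int[leb]_xi (normc (iter k (diffq i y) g xi) ^+ 2)%:E <=
       (C3 * y `^ (d%:R + 2 * beta))%:E)%E.
Proof.
move=> k0 b0 dp C10 C20.
have [Ct Ct0 HCt] := integral_ball_tail_le dp.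
have kR0 : 0 < (k%:R : R) by rewrite ltr0n.
exists ((2 ^+ k * (C1 * (3 * k%:R) `^ beta)) ^+ 2 * (4 * k%:R) ^+ d +
   C2 ^+ 2 * (Ct * (2 * k%:R) `^ (d%:R - 2 * (k%:R - beta)))).
  by rewrite addr_ge0// mulr_ge0 ?sqr_ge0 ?exprn_ge0 ?mulr_ge0 ?powR_ge0// ltW.
move=> g c i y y0 mg gc gf.
pose A := (2 ^+ k * (C1 * (3 * k%:R * y) `^ beta)) ^+ 2.
pose B := (C2 * y ^+ k) ^+ 2.
have ky0 : 0 < k%:R * y by rewrite mulr_gt0.
have := HCt (fun xi => normc (iter k (diffq i y) g xi) ^+ 2) (2 * k%:R * y) A B.
have -> : A * (2 * (2 * k%:R * y)) ^+ d +
   B * (Ct * (2 * k%:R * y) `^ (d%:R - 2 * (k%:R - beta))) =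
  ((2 ^+ k * (C1 * (3 * k%:R) `^ beta)) ^+ 2 * (4 * k%:R) ^+ d +
   C2 ^+ 2 * (Ct * (2 * k%:R) `^ (d%:R - 2 * (k%:R - beta)))) * y `^ (d%:R + 2 * beta).
  have e1 : y `^ (d%:R + 2 * beta) = (y `^ beta) ^+ 2 * y ^+ d.
    by rewrite powRX -(powR_mulrn _ (ltW y0)) -powRDpos//; congr (_ `^ _); ring.
  have e2 : y `^ (d%:R + 2 * beta) = (y ^+ k) ^+ 2 * y `^ (d%:R - 2 * (k%:R - beta)).
    by rewrite -!(powR_mulrn _ (ltW y0)) powRX -powRDpos//; congr (_ `^ _); ring.
  rewrite [RHS]mulrDl; congr (_ + _).
    rewrite e1 /A (powRM _ _ (ltW y0)); last by rewrite mulr_ge0// ltW.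
    have -> : 2 * (2 * k%:R * y) = (4 * k%:R) * y by ring.
    by rewrite [in LHS](exprMn d _ y); ring.
  by rewrite e2 /B (powRM _ _ (ltW y0)); [ring|rewrite mulr_ge0// ltW].
apply.
- by apply: measurable_funX; exact: measurable_normc.
- by move=> xi; exact: sqr_ge0.
- by rewrite -mulrA mulr_gt0.
- exact: sqr_ge0.
- exact: sqr_ge0.
- move=> xi xr; rewrite /A lerXn2r ?nnegrE ?normc_ge0//.
    by rewrite !mulr_ge0 ?powR_ge0 ?exprn_ge0.
  case: k k0 kR0 ky0 xr {A B gf mg HCt dp} => // k' _ kR0 ky0 xr.
  rewrite -(iter_diffq_sub_cst i y g c).
  apply: (@normc_iter_diffq_le R d i y _ (3 * k'.+1%:R * y)); first exact: ltW.
    move=> u ur; apply: le_trans (gc u) _; rewrite ler_wpM2l//.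
    apply: ge0_ler_powR => //; rewrite ?nnegrE ?enorm_ge0 ?ltW//.
    by rewrite -mulrA mulr_gt0.
  by move: xr; nra.
- move=> xi xr; apply: le_trans (lerXn2r 2 _ _ (gf xi xr)) _; rewrite ?nnegrE ?normc_ge0//.
    by rewrite !mulr_ge0 ?powR_ge0 ?exprn_ge0// ltW.
  rewrite exprMn -/B powRX le_eqVlt; apply/orP; left; apply/eqP; congr (_ * _ `^ _); ring.
Qed.

Lemma coord_weight_bound (beta delta C1 C2 : R) : (0 < k)%N -> 0 < delta ->
  delta < beta -> d%:R < 2 * (k%:R - beta) -> 0 <= C1 -> 0 <= C2 ->
  exists2 M : R, 0 <= M & forall (g : d.-tuple R -> R[i]) (c : R[i]) i,
    cintegrable g ->
    (forall xi, normc (g xi - c) <= C1 * enorm xi `^ beta) ->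
    (forall y xi, 0 < y -> 2 * k%:R * y <= enorm xi ->
      normc (iter k (diffq i y) g xi) <= C2 * y ^+ k * enorm xi `^ (beta - k%:R)) ->
    (\int[leb]_(x in [set x | 1 <= `|tnth x i|]%R)
       (`|tnth x i| `^ (d%:R + 2 * delta) * normc (inverse_fourier g x) ^+ 2)%:E
     <= M%:E)%E.
Proof.
move=> k0 dl0 dlb dp C10 C20; have b0 : 0 < beta by exact: lt_trans dlb.
have [C3 C30 HC3] := diffq_l2_bound k0 b0 dp C10 C20.
pose s := d%:R + 2 * delta.
(* Lower bound of |exp(i theta) - 1|^2 for 1 <= |theta| <= 2: the cosine decreases on [0, pi] and 2
   <= pi, so the minimum is at 1. *)
pose cc : R := 2 - 2 * cos 1.
have cc0 : 0 < cc.
  suff : cos 1 < cos (0 : R) by rewrite cos0 /cc; lra.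
  by rewrite ltr_cos// in_itv/=; have := pi_ge2 R; lra.
(* The exponent is 2 (delta - beta) < 0: growth of the weight against decay of the differences when
   j increases by 1. *)
pose q : R := 2 `^ (s - (d%:R + 2 * beta)).
pose A : R := 2 `^ s * (cc ^- k * (bessel_cst R d * C3)).
have ck0 : 0 <= cc ^- k by rewrite invr_ge0 exprn_ge0// ltW.
have A0 : 0 <= A.
  rewrite mulr_ge0 ?powR_ge0// mulr_ge0// mulr_ge0//; exact: bessel_cst_ge0.
have q0 : 0 <= q by exact: powR_ge0.
have q1 : q < 1 by apply: powR2_lt1; rewrite /s; lra.
exists (A / (1 - q)); first by rewrite divr_ge0// subr_ge0 ltW.
move=> g c i Ig gc gf.
pose G j x := ((2 ^+ j.+1) `^ s * cc ^- k *
   normc (inverse_fourier (iter k (diffq i (2 ^- j)) g) x) ^+ 2)%:E.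
have ID j := cintegrable_iter_diffq i (2 ^- j) k Ig.
have mq : measurable_fun setT (fun x => normc (inverse_fourier g x) ^+ 2).
  by apply: measurable_funX; apply: measurable_normc; exact: cmeasurable_inverse_fourier.
have mqj j : measurable_fun setT
    (fun x => normc (inverse_fourier (iter k (diffq i (2 ^- j)) g) x) ^+ 2).
  by apply: measurable_funX; apply: measurable_normc; exact: cmeasurable_inverse_fourier.
have mxi : measurable_fun setT (fun x : d.-tuple R => `|tnth x i|).
  by apply: measurableT_comp => //; exact: measurable_tnth.
have mD : measurable [set x : d.-tuple R | 1 <= `|tnth x i|].
  by rewrite -[X in measurable X]setTI; apply: measurable_fun_le.
have mG j : measurable_fun setT (G j).
  by apply/measurable_EFinP; apply: measurable_funM.
have a0 j : 0 <= (2 ^+ j.+1) `^ s * cc ^- k.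
  by rewrite mulr_ge0 ?powR_ge0// invr_ge0 exprn_ge0// ltW.
apply: (@dyadic_integral_le _ _ _ _ _ _ G) => //.
- by rewrite q0.
- apply: measurable_funTS; apply/measurable_EFinP; apply: measurable_funM => //.
  exact: (measurableT_comp (measurable_powR _)).
- by move=> j; exact: measurable_funTS.
- by move=> x _; rewrite lee_fin mulr_ge0 ?powR_ge0 ?sqr_ge0.
- by move=> j x _; rewrite lee_fin mulr_ge0 ?sqr_ge0.
- move=> x /= /dyadic_bracket[j /andP[j1 j2]]; exists j.
  rewrite lee_fin sqr_normc_iter_diffq// -mulrA; apply: ler_pM.
  + exact: powR_ge0.
  + exact: sqr_ge0.
  + apply: ge0_ler_powR; rewrite ?nnegrE ?exprn_ge0//.
    by rewrite /s addr_ge0// mulr_ge0// ltW.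
  rewrite mulrA ler_peMl ?sqr_ge0// mulrC ler_pdivlMr ?exprn_gt0// mul1r.
  apply: lerXn2r; rewrite ?nnegrE; first exact: ltW.
    by rewrite subr_ge0 ler_piMr// cos_le1.
  rewrite /cc lerD2l lerN2 ler_pM2l//.
  have p2 : 0 < (2 : R) ^+ j by rewrite exprn_gt0.
  rewrite -cos_norm normrM ger0_norm ?invr_ge0 ?(ltW p2)//.
  (* On the j-th shell the step 2^-j brings the phase into [1, 2], away from the zeros of exp(i
     theta) - 1. *)
  have h1 : 1 <= 2 ^- j * `|tnth x i| by rewrite mulrC ler_pdivlMr// mul1r.
  have h2 : 2 ^- j * `|tnth x i| <= 2.
    by rewrite mulrC ler_pdivrMr// -exprS.
  have p22 := pi_ge2 R.
  by rewrite leNgt ltr_cos ?in_itv/= -?leNgt//; apply/andP; split; lra.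
- move=> j; apply: (@le_trans _ _ (\int[leb]_x G j x)%E).
    by apply: ge0_subset_integral => // x _; rewrite lee_fin mulr_ge0 ?sqr_ge0.
  rewrite /G; under eq_integral do rewrite EFinM.
  rewrite ge0_integralZl//; last 3 first.
  + exact/measurable_EFinP.
  + by move=> x _; rewrite lee_fin sqr_ge0.
  + by rewrite lee_fin.
  apply: (@le_trans _ _ (((2 ^+ j.+1) `^ s * cc ^- k)%:E *
    ((bessel_cst R d)%:E * (C3 * (2 ^- j) `^ (d%:R + 2 * beta))%:E))%E).
    apply: lee_wpmul2l; first by rewrite lee_fin.
    apply: le_trans (bessel_inverse_fourier (ID j)) _.
    apply: lee_wpmul2l; first by rewrite lee_fin bessel_cst_ge0.
    apply: (HC3 g c i (2 ^- j)) => //.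
    + exact: cintegrable_cmeasurable.
    + by move=> xi; exact: gf.
  rewrite -!EFinM lee_fin le_eqVlt; apply/orP; left; apply/eqP.
  have -> : q = 2 `^ s * 2 `^ (- (d%:R + 2 * beta)) by exact: powRDpos.
  rewrite powR2n powR_half_pow /A (exprMn j) exprS.
  by move: (2 `^ s) (2 `^ (- (d%:R + 2 * beta))) (cc ^- k) => u v w; ring.
Qed.

(** Boundedness near the origin and decay of order d + 1 give an L^1 bound, and |g|^2 <= C0 |g|
    turns it into an L^2 bound. [N0] is fixed before [g]. *)
Lemma decay_cintegrable (C0 : R) : 0 <= C0 ->
  exists2 N0 : R, 0 <= N0 & forall g : d.-tuple R -> R[i],
  cmeasurable g -> (forall xi, normc (g xi) <= C0) ->
  (forall xi, 0 < enorm xi -> normc (g xi) <= C0 * enorm xi `^ (- (d%:R + 1))) ->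
  cintegrable g /\ (\int[leb]_xi (normc (g xi) ^+ 2)%:E <= N0%:E)%E.
Proof.
move=> C00.
have dp : d%:R < (d%:R + 1 : R) by lra.
have [Ct Ct0 HCt] := integral_ball_tail_le dp.
pose N1 := C0 * (2 * 1) ^+ d + C0 * (Ct * 1 `^ (d%:R - (d%:R + 1))).
have N10 : 0 <= N1 by rewrite addr_ge0// !mulr_ge0// ?powR_ge0 ?exprn_ge0// mulr1.
exists (C0 * N1); first exact: mulr_ge0.
move=> g mg gC gf.
have mn := measurable_normc mg.
have gN1 : (\int[leb]_xi (normc (g xi))%:E <= N1%:E)%E.
  apply: HCt => //; first by move=> xi; exact: normc_ge0.
  by move=> xi x1; apply: gf; exact: lt_le_trans x1.
split.
  apply: (dominated_cintegrable (u := fun xi => normc (g xi))) => //.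
  by apply: (ge0_integrable _ _ _ gN1) => // xi _; exact: normc_ge0.
apply: (@le_trans _ _ (\int[leb]_xi (C0%:E * (normc (g xi))%:E))%E).
  apply: ge0_le_integral => //.
  - by move=> xi _; rewrite lee_fin sqr_ge0.
  - by apply/measurable_EFinP; exact: measurable_funX.
  - by apply: measurable_funeM; exact/measurable_EFinP.
  - by move=> xi _; rewrite -EFinM lee_fin expr2 ler_wpM2r ?normc_ge0.
rewrite ge0_integralZl//; last 2 first.
- exact/measurable_EFinP.
- by move=> xi _; rewrite lee_fin normc_ge0.
by rewrite EFinM lee_wpmul2l ?lee_fin.
Qed.

Lemma enorm_le_coord (x : d.-tuple R) : (0 < d)%N ->
  exists i, enorm x <= d%:R * `|tnth x i|.
Proof.
move=> d0.
have [i _ im] := @arg_maxP _ _ _ (Ordinal d0) xpredT (fun i => `|tnth x i|) isT.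
exists i; rewrite -(@ler_pXn2r _ 2) ?nnegrE ?enorm_ge0 ?mulr_ge0// sqr_enorm.
apply: (@le_trans _ _ (\sum_(j < d) `|tnth x i| ^+ 2)).
  apply: ler_sum => j _; rewrite -expr2 -real_normK ?num_real//.
  by rewrite lerXn2r ?nnegrE//; exact: im.
rewrite sumr_const card_ord exprMn -[leLHS]mulr_natl ler_wpM2r ?sqr_ge0//.
by rewrite -natrX ler_nat expnS expn1 leq_pmulr.
Qed.

(** The radial weight is dominated by that of the largest coordinate, hence by the sum over all
    coordinates. For each of them the part |x_i| < 1 needs only the unweighted Bessel inequality,
    and the part |x_i| >= 1 is handled by differences. [N] precedes [g] and [c], which gives the
    uniformity in s, t and psi. *)
Theorem weighted_fourier_bound (beta delta C0 C1 C2 : R) : (0 < d)%N -> (0 < k)%N ->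
  0 < delta -> delta < beta -> d%:R < 2 * (k%:R - beta) ->
  0 <= C0 -> 0 <= C1 -> 0 <= C2 ->
  exists N : R, forall (g : d.-tuple R -> R[i]) (c : R[i]),
    cmeasurable g -> (forall xi, normc (g xi) <= C0) ->
    (forall xi, 0 < enorm xi -> normc (g xi) <= C0 * enorm xi `^ (- (d%:R + 1))) ->
    (forall xi, normc (g xi - c) <= C1 * enorm xi `^ beta) ->
    (forall i y xi, 0 < y -> 2 * k%:R * y <= enorm xi ->
      normc (iter k (diffq i y) g xi) <= C2 * y ^+ k * enorm xi `^ (beta - k%:R)) ->
    (\int[leb]_x (normc ((enorm x `^ (d%:R / 2 + delta))%:C *
        inverse_fourier g x) ^+ 2)%:E <= N%:E)%E.
Proof.
move=> d0 k0 dl0 dlb dp C00 C10 C20.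
have [N0 N00 HN0] := decay_cintegrable C00.
have [M M0 HM] := coord_weight_bound k0 dl0 dlb dp C10 C20.
pose s := d%:R + 2 * delta.
have s0 : 0 <= s by rewrite addr_ge0// mulr_ge0// ltW.
exists (d%:R `^ s * \sum_(i < d) (bessel_cst R d * N0 + M)).
move=> g c mg gC gf gc gD.
have [Ig g2] := HN0 g mg gC gf.
have mq : measurable_fun setT (fun x => normc (inverse_fourier g x) ^+ 2).
  by apply: measurable_funX; apply: measurable_normc; exact: cmeasurable_inverse_fourier.
have mxi i : measurable_fun setT (fun x : d.-tuple R => `|tnth x i|).
  by apply: measurableT_comp => //; exact: measurable_tnth.
have mD i : measurable [set x : d.-tuple R | 1 <= `|tnth x i|].
  by rewrite -[X in measurable X]setTI; apply: measurable_fun_le.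
pose F i x := (`|tnth x i| `^ s * normc (inverse_fourier g x) ^+ 2)%:E.
have mF i : measurable_fun setT (F i).
  apply/measurable_EFinP; apply: measurable_funM => //.
  exact: (measurableT_comp (measurable_powR _)).
have F0 i x : (0 <= F i x)%E by rewrite lee_fin mulr_ge0 ?powR_ge0 ?sqr_ge0.
have IF i : (\int[leb]_x F i x <= (bessel_cst R d * N0 + M)%:E)%E.
  rewrite -(setvU [set x : d.-tuple R | 1 <= `|tnth x i|]).
  rewrite ge0_integral_setU//; last 3 first.
  - exact: measurableC.
  - exact: measurable_funTS.
  - by apply/disj_set2P; rewrite setICl.
  rewrite EFinD; apply: leeD; last exact: HM (gD i).
  apply: (@le_trans _ _ (\int[leb]_x (normc (inverse_fourier g x) ^+ 2)%:E)%E).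
    apply: (@le_trans _ _ (\int[leb]_(x in ~` [set x : d.-tuple R | 1 <= `|tnth x i|]%R)
        (normc (inverse_fourier g x) ^+ 2)%:E)%E).
      apply: ge0_le_integral => //.
      - exact: measurableC.
      - exact: measurable_funTS.
      - by apply/measurable_EFinP; exact: measurable_funTS.
      move=> x /= /negP; rewrite -ltNge => /ltW x1.
      rewrite lee_fin ler_piMl ?sqr_ge0//.
      have -> : 1 = (1 : R) `^ s by rewrite powR1.
      by apply: ge0_ler_powR; rewrite ?nnegrE.
    apply: ge0_subset_integral => //; first exact: measurableC.
      exact/measurable_EFinP.
    by move=> x _; rewrite lee_fin sqr_ge0.
  apply: le_trans (bessel_inverse_fourier Ig) _.
  rewrite (EFinM (bessel_cst R d)); apply: lee_wpmul2l => //.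
  by rewrite lee_fin bessel_cst_ge0.
apply: (@le_trans _ _ (\int[leb]_x ((d%:R `^ s)%:E * \sum_(i < d) F i x))%E).
  apply: ge0_le_integral => //.
  - by move=> x _; rewrite lee_fin sqr_ge0.
  - apply/measurable_EFinP; apply: measurable_funX; apply: measurable_normc.
    apply: cmeasurableM; last exact: cmeasurable_inverse_fourier.
    split => //=; apply: (measurableT_comp (measurable_powR _)).
    exact: measurable_enorm.
  - by apply: measurable_funeM; apply: emeasurable_sum.
  move=> x _; have [i xi] := enorm_le_coord x d0.
  apply: (@le_trans _ _ ((d%:R `^ s)%:E * F i x)%E); last first.
    apply: lee_wpmul2l; first by rewrite lee_fin powR_ge0.
    rewrite (bigD1 i)//= leeDl// sume_ge0// => j _; exact: F0.
  rewrite -EFinM lee_fin Normc.normcM normc_real ger0_norm ?powR_ge0// exprMn.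
  rewrite [leRHS]mulrA ler_wpM2r ?sqr_ge0// powRX -powRM//.
  rewrite (_ : (d%:R / 2 + delta) * 2 = s); last by rewrite /s; field.
  by apply: ge0_ler_powR; rewrite ?nnegrE ?enorm_ge0// mulr_ge0.
rewrite ge0_integralZl ?lee_fin ?powR_ge0//; last 2 first.
- exact: emeasurable_sum.
- by move=> x _; apply: sume_ge0 => i _; exact: F0.
rewrite EFinM lee_wpmul2l ?lee_fin ?powR_ge0//.
rewrite ge0_integral_sum// -sumEFin; apply: lee_sum => i _; exact: IF.
Qed.

End weighted.

(** * Symbol classes along lines *)

Section cderiv.
Variable R : realType.
Implicit Types (f g : R -> R[i]) (u : R) (l m : R[i]).

Definition cderiv f u l : Prop :=
  is_derive u 1 (fun v => Re (f v) : R) (Re l) /\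
  is_derive u 1 (fun v => Im (f v) : R) (Im l).

Lemma cderiv_cst (c : R[i]) u : cderiv (fun=> c) u 0.
Proof. by split; exact: is_derive_cst. Qed.

Lemma cderivD f g u l m : cderiv f u l -> cderiv g u m ->
  cderiv (fun v => f v + g v) u (l + m).
Proof.
move=> [f1 f2] [g1 g2]; split.
  rewrite (_ : (fun v => _) = (fun v => Re (f v) : R) \+ (fun v => Re (g v) : R)).
    by rewrite cReD; exact: is_deriveD.
  by apply/funext => v; rewrite cReD.
rewrite (_ : (fun v => _) = (fun v => Im (f v) : R) \+ (fun v => Im (g v) : R)).
  by rewrite cImD; exact: is_deriveD.
by apply/funext => v; rewrite cImD.
Qed.

Lemma cderivN f u l : cderiv f u l -> cderiv (fun v => - f v) u (- l).
Proof.
move=> [f1 f2]; split.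
  rewrite (_ : (fun v => _) = - (fun v => Re (f v) : R)).
    by rewrite cReN; exact: is_deriveN.
  by apply/funext => v; rewrite cReN.
rewrite (_ : (fun v => _) = - (fun v => Im (f v) : R)).
  by rewrite cImN; exact: is_deriveN.
by apply/funext => v; rewrite cImN.
Qed.

Lemma cderivM f g u l m : cderiv f u l -> cderiv g u m ->
  cderiv (fun v => f v * g v) u (l * g u + f u * m).
Proof.
move=> [f1 f2] [g1 g2]; split.
  rewrite (_ : (fun v => _) = (fun v => Re (f v) * Re (g v) - Im (f v) * Im (g v))).
    by apply: is_derive_eq; rewrite /GRing.scale/= cReD !cReM; ring.
  by apply/funext => v; rewrite cReM.
rewrite (_ : (fun v => _) = (fun v => Re (f v) * Im (g v) + Im (f v) * Re (g v))).
  by apply: is_derive_eq; rewrite /GRing.scale/= cImD !cImM; ring.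
by apply/funext => v; rewrite cImM.
Qed.

Lemma cderiv_exp f u l : cderiv f u l ->
  cderiv (fun v => cexp (f v)) u (l * cexp (f u)).
Proof.
move=> [f1 f2].
have e1 : is_derive u 1 (fun v => expR (Re (f v)) : R) (expR (Re (f u)) * Re l).
  exact: (@is_derive1_comp R expR (fun v => Re (f v))).
have e2 : is_derive u 1 (fun v => cos (Im (f v)) : R) (- sin (Im (f u)) * Im l).
  exact: (@is_derive1_comp R cos (fun v => Im (f v))).
have e3 : is_derive u 1 (fun v => sin (Im (f v)) : R) (cos (Im (f u)) * Im l).
  exact: (@is_derive1_comp R sin (fun v => Im (f v))).
split.
  rewrite (_ : (fun v => _) = (fun v => expR (Re (f v)) * cos (Im (f v)))).
    by apply: is_derive_eq; rewrite /GRing.scale/= cReM /cexp cReM cImM /=; ring.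
  by apply/funext => v; rewrite /cexp cReM/=; ring.
rewrite (_ : (fun v => _) = (fun v => expR (Re (f v)) * sin (Im (f v)))).
  by apply: is_derive_eq; rewrite /GRing.scale/= cImM /cexp cReM cImM /=; ring.
by apply/funext => v; rewrite /cexp cImM/=; ring.
Qed.

Lemma cderiv_affine f (a u : R) l : cderiv f (a * u) l ->
  cderiv (fun v => f (a * v)) u (a%:C * l).
Proof.
move=> [f1 f2].
have da : is_derive u 1 (fun v : R => a * v) a.
  rewrite -[in X in is_derive _ _ _ X](mulr1 a) -[X in is_derive _ _ _ X]/(a *: 1).
  exact: is_deriveZ.
split.
  rewrite (_ : Re _ = Re l * a); last by rewrite cReM/=; ring.
  exact: (@is_derive1_comp R (fun v => Re (f v)) (fun v => a * v)).
rewrite (_ : Im _ = Im l * a); last by rewrite cImM/=; ring.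
exact: (@is_derive1_comp R (fun v => Im (f v)) (fun v => a * v)).
Qed.

End cderiv.

(** * Differentiation under a time integral *)

Lemma integrable_cst_itv (R : realType) (s t c : R) :
  (@lebesgue_measure R).-integrable `[s, t] (EFin \o (fun=> c)).
Proof.
apply/integrableP; split; first exact/measurable_EFinP.
rewrite (eq_integral (cst `|c|%:E))// integral_cst//= lebesgue_measure_itv/=.
by case: ifP => _; rewrite ?mule0// -EFinB -EFinM ltry.
Qed.

Section param_integral.
Variable R : realType.
Local Notation mu := (@lebesgue_measure R).
Variables (f f' : R -> R -> R) (s t u e H G : R).
Hypothesis e0 : 0 < e.
Hypothesis st : s <= t.
Hypothesis mf : forall v, u - e < v < u + e ->
  measurable_fun `[s, t]%classic (f ^~ v).
Hypothesis fH : forall r v, s <= r <= t -> u - e < v < u + e -> `|f r v| <= H.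
Hypothesis df : forall r v, s <= r <= t -> u - e < v < u + e ->
  is_derive v 1 (f r) (f' r v).
Hypothesis f'G : forall r v, s <= r <= t -> u - e < v < u + e -> `|f' r v| <= G.

(** A pointwise limit of difference quotients with steps e/2/(m + 1) < e. The symbol is assumed
    measurable but nothing is said of its derivatives, so their measurability in time has to be
    derived. *)
Lemma measurable_param_derivative : measurable_fun `[s, t]%classic (f' ^~ u).
Proof.
pose h (m : nat) : R := e / 2 / m.+1%:R.
have h0 m : 0 < h m by rewrite !divr_gt0.
have he m : h m < e.
  rewrite /h ltr_pdivrMr// (@lt_le_trans _ _ e)//; first by rewrite ltr_pdivrMr// ltr_pMr// ltr1n.
  by rewrite ler_peMr ?(ltW e0)// ler1n.
have hcv : h m @[m --> \oo] --> 0.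
  rewrite -(mulr0 (e / 2)); apply: cvgMl_tmp; exact: cvg_harmonic.
apply: (@measurable_fun_cvg _ _ _ _ (fun m r => (h m)^-1 * (f r (h m + u) - f r u))).
  move=> m; apply: measurable_funM => //; apply: measurable_funB; apply: mf.
    by have := h0 m; have := he m; lra.
  by rewrite ltrBlDr !ltrDl e0.
move=> r /=; rewrite in_itv/= => rst.
have ue : u - e < u < u + e by rewrite ltrBlDr !ltrDl e0.
have [/cvg_ex[/= l fl] D] := df rst ue.
have {D}lE : f' r u = l.
  by rewrite -D; apply/cvg_lim.
have xa0 : (forall m, h m != 0) /\ h m @[m --> \oo] --> 0.
  by split => // m; rewrite gt_eqF.
move: fl => /cvgr_dnbhsP/(_ _ xa0).
under [in X in X -> _]eq_fun do rewrite scaler1.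
by rewrite lE.
Qed.

Lemma is_derive_param_integral :
  is_derive u 1 (fun v => (\int[mu]_(r in `[s, t]) f r v)%R)
    (\int[mu]_(r in `[s, t]) f' r u)%R.
Proof.
have ue : u - e < u < u + e by rewrite ltrBlDr !ltrDl e0.
pose F v r := f r v.
have Ia : `]u - e, u + e[%classic u by rewrite /= in_itv/=.
have Icst := integrable_cst_itv s t.
have intf v : `]u - e, u + e[%classic v -> mu.-integrable `[s, t] (EFin \o F v).
  rewrite /= in_itv/= => ve.
  apply: (@dominated_integrable R _ (measurableTypeR R) mu `[s, t] (F v) (fun=> H)) => //.
    exact: mf.
  by move=> r /=; rewrite in_itv/= => rst; exact: fH.
have derf v r : `]u - e, u + e[%classic v -> `[s, t]%classic r -> derivable (F ^~ r) v 1.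
  by rewrite /= !in_itv/= => ve rst; case: (df rst ve).
have d1E v r : `]u - e, u + e[%classic v -> `[s, t]%classic r ->
    partial1of2 F v r = f' r v.
  rewrite /= !in_itv/= => ve rst; rewrite partial1of2E.
  by have := df rst ve => D; exact: derive_val.
have G_ub v r : `]u - e, u + e[%classic v -> `[s, t]%classic r ->
    `|partial1of2 F v r| <= `|G|.
  move=> ve rst; rewrite d1E//; apply: le_trans (ler_norm _).
  by move: ve rst; rewrite /= !in_itv/= => ve rst; exact: f'G.
have dI := @derivable_under_integral R _ (measurableTypeR R) mu F `[s, t]%classic
  (measurable_itv _) u (u - e) (u + e) Ia intf derf (fun=> `|G|)
  (fun=> normr_ge0 _) (Icst _) G_ub.
have vI := @differentiation_under_integral R _ (measurableTypeR R) mu F `[s, t]%classic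
  (measurable_itv _) u (u - e) (u + e) Ia intf derf (fun=> `|G|)
  (fun=> normr_ge0 _) (Icst _) G_ub.
split; first exact: dI.
rewrite -derive1E vI; apply: eq_Rintegral => r /set_mem rst.
by rewrite d1E.
Qed.

End param_integral.

(** * Calculus of weighted symbol classes in one variable *)

Section symbol_class.
Variables (R : realType) (c2 : R).
Hypothesis c20 : 0 <= c2.
Implicit Types (f g : R -> R[i]) (w : R -> R) (u v : R).

Definition rho u : R := Num.sqrt (c2 + u ^+ 2).

(* [sym n w f] says that away from the zero of [rho] the derivative of order
   [j <= n] of [f] exists and is bounded by [w / rho ^+ j]. *)
Fixpoint sym n w f : Prop :=
  (forall u, 0 < rho u -> normc (f u) <= w u) /\
  (if n is m.+1 then exists f' : R -> R[i],
     (forall u, 0 < rho u -> cderiv f u (f' u)) /\ sym m (fun u => w u / rho u) f'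
   else True).

Lemma rho_ge0 u : 0 <= rho u. Proof. exact: sqrtr_ge0. Qed.

Lemma sqr_rho u : rho u ^+ 2 = c2 + u ^+ 2.
Proof. by rewrite sqr_sqrtr// addr_ge0// sqr_ge0. Qed.

Lemma normr_le_rho u : `|u| <= rho u.
Proof.
rewrite -(@ler_pXn2r _ 2) ?nnegrE ?rho_ge0// sqr_rho real_normK ?num_real//.
by rewrite lerDr.
Qed.

Lemma continuous_rho : continuous rho.
Proof.
move=> u; apply: continuous_comp; last exact: sqrt_continuous.
by apply: cvgD; [exact: cvg_cst|exact: exprn_continuous].
Qed.

Lemma sym_bound n w f u : sym n w f -> 0 < rho u -> normc (f u) <= w u.
Proof. by case: n => [|n] [H _]; exact: H. Qed.

Lemma sym_le n w w' f : sym n w f -> (forall u, 0 < rho u -> w u <= w' u) ->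
  sym n w' f.
Proof.
elim: n w w' f => [|n IH] w w' f [H1 H2] ww'; split => //.
- by move=> u u0; exact: le_trans (H1 _ u0) (ww' _ u0).
- by move=> u u0; exact: le_trans (H1 _ u0) (ww' _ u0).
move: H2 => [f' [df sf']]; exists f'; split => //.
by apply: IH sf' _ => u u0; rewrite ler_wpM2r ?invr_ge0 ?rho_ge0 ?ww'.
Qed.

Lemma sym_weak n w f : sym n.+1 w f -> sym n w f.
Proof.
elim: n w f => [|n IH] w f [H1 [f' [df sf']]]; split => //.
by exists f'; split => //; exact: IH.
Qed.

Lemma sym0 n w : (forall u, 0 < rho u -> 0 <= w u) -> sym n w (fun=> 0).
Proof.
elim: n w => [|n IH] w w0; split => //; try by move=> u u0; rewrite Normc.normc0 w0.
exists (fun=> 0); split; first by move=> u _; exact: cderiv_cst.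
by apply: IH => u u0; rewrite divr_ge0 ?w0 ?rho_ge0.
Qed.

Lemma sym_cst n (c : R[i]) : sym n (fun=> normc c) (fun=> c).
Proof.
case: n => [|n]; split => //; exists (fun=> 0); split.
  by move=> u _; exact: cderiv_cst.
by apply: sym0 => u _; rewrite divr_ge0 ?normc_ge0 ?rho_ge0.
Qed.

Lemma symD n w w' f g : sym n w f -> sym n w' g ->
  sym n (fun u => w u + w' u) (fun u => f u + g u).
Proof.
elim: n w w' f g => [|n IH] w w' f g [f1 f2] [g1 g2].
  by split=> // u u0; exact: le_trans (normc_leD _ _) (lerD (f1 _ u0) (g1 _ u0)).
split=> [u u0|]; first exact: le_trans (normc_leD _ _) (lerD (f1 _ u0) (g1 _ u0)).
move: f2 g2 => [f' [df sf']] [g' [dg sg']].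
exists (fun u => f' u + g' u); split.
  by move=> u u0; exact: cderivD (df _ u0) (dg _ u0).
by apply: sym_le (IH _ _ _ _ sf' sg') _ => u _; rewrite mulrDl.
Qed.

(** The factor 2^n counts the Leibniz terms: each order doubles their number, and every term carries
    the same power of [rho]. *)
Lemma symM n w w' f g : sym n w f -> sym n w' g ->
  sym n (fun u => 2 ^+ n * (w u * w' u)) (fun u => f u * g u).
Proof.
elim: n w w' f g => [|n IH] w w' f g sf sg.
  split=> // u u0; rewrite expr0 mul1r Normc.normcM.
  by apply: ler_pM; rewrite ?normc_ge0 ?(sym_bound sf) ?(sym_bound sg).
have sf1 := sym_weak sf; have sg1 := sym_weak sg.
move: (sf) (sg) => [f1 [f' [df sf']]] [g1 [g' [dg sg']]]; split.
  move=> u u0; rewrite Normc.normcM; apply: (@le_trans _ _ (w u * w' u)).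
    by apply: ler_pM; rewrite ?normc_ge0 ?f1 ?g1.
  have w0 := le_trans (normc_ge0 _) (f1 _ u0).
  have w'0 := le_trans (normc_ge0 _) (g1 _ u0).
  by rewrite ler_peMl ?mulr_ge0// exprn_ege1// ler1n.
exists (fun u => f' u * g u + f u * g' u); split.
  by move=> u u0; exact: cderivM (df _ u0) (dg _ u0).
apply: sym_le (symD (IH _ _ _ _ sf' sg1) (IH _ _ _ _ sf1 sg')) _ => u _.
by rewrite exprS le_eqVlt; apply/orP; left; apply/eqP; ring.
Qed.

(** The product of [W] and the factors 1 + 2^m w for m < n. Since exp f has derivative f' exp f, the
    product rule costs at most one such factor per order; [W] bounds the modulus of exp f and [w] is
    the weight of f. *)
Fixpoint expweight (n : nat) (W w : R) : R :=
  if n is m.+1 then expweight m W w * (1 + 2 ^+ m * w) else W.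

Lemma expweight_ge n (W w : R) : 0 <= W -> 0 <= w -> W <= expweight n W w.
Proof.
move=> W0 w0; elim: n => //= n IH; apply: le_trans IH _.
rewrite ler_peMr ?lerDl ?mulr_ge0 ?exprn_ge0//.
elim: n => //= n IH; rewrite mulr_ge0// addr_ge0// mulr_ge0// exprn_ge0//.
Qed.

Lemma sym_exp n w W f : sym n w f ->
  (forall u, 0 < rho u -> expR (Re (f u)) <= W u) ->
  sym n (fun u => expweight n (W u) (w u)) (fun u => cexp (f u)).
Proof.
move=> sf eW; elim: n sf => [|n IH] sf.
  by split => // u u0; rewrite normc_cexp eW.
have sfn := sym_weak sf; have sE := IH sfn.
split.
  move=> u u0; rewrite normc_cexp; apply: le_trans (eW _ u0) _.
  apply: expweight_ge; first exact: le_trans (expR_ge0 _) (eW _ u0).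
  exact: le_trans (normc_ge0 _) (sym_bound sf u0).
move: (sf) => [_ [f' [df sf']]].
exists (fun u => f' u * cexp (f u)); split.
  by move=> u u0; exact: cderiv_exp (df _ u0).
apply: sym_le (symM sf' sE) _ => u u0 /=.
have W0 : 0 <= expweight n (W u) (w u).
  exact: le_trans (normc_ge0 _) (sym_bound sE u0).
rewrite mulrDr mulr1 [leRHS]mulrDl.
have -> : 2 ^+ n * (w u / rho u * expweight n (W u) (w u)) =
          expweight n (W u) (w u) * (2 ^+ n * w u) / rho u by ring.
by rewrite lerDr divr_ge0 ?rho_ge0.
Qed.

(** Subtracting 1 affects order zero only. All derivatives contain f', so they carry a factor [w],
    and the weight [w'] may tend to 0 at the origin, which the weight of exp f itself cannot do. *)
Lemma sym_exp_sub1 n w W w' f : sym n.+1 w f ->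
  (forall u, 0 < rho u -> expR (Re (f u)) <= W u) ->
  (forall u, 0 < rho u -> normc (cexp (f u) - 1) <= w' u) ->
  (forall u, 0 < rho u -> 2 ^+ n * (w u * expweight n (W u) (w u)) <= w' u) ->
  sym n.+1 w' (fun u => cexp (f u) - 1).
Proof.
move=> sf eW ew' ww'; split=> //.
have sE := sym_exp (sym_weak sf) eW.
move: (sf) => [_ [f' [df sf']]].
exists (fun u => f' u * cexp (f u)); split.
  move=> u u0; rewrite -[X in cderiv _ _ X]addr0.
  exact: cderivD (cderiv_exp (df _ u0)) (cderiv_cst _ _).
apply: sym_le (symM sf' sE) _ => u u0 /=.
have -> : 2 ^+ n * (w u / rho u * expweight n (W u) (w u)) =
          2 ^+ n * (w u * expweight n (W u) (w u)) / rho u by ring.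
by rewrite ler_wpM2r ?ww'// invr_ge0 rho_ge0.
Qed.

Lemma sym_id n : sym n rho (fun u => u%:C).
Proof.
case: n => [|n]; split => //; try by move=> u _; rewrite normc_real normr_le_rho.
exists (fun=> 1); split.
  by move=> u _; split => /=; [exact: is_derive_id|exact: is_derive_cst].
apply: sym_le (sym_cst n 1) _ => u u0.
by rewrite Normc.normc1 divff// gt_eqF.
Qed.

Lemma is_derive_rho_powR (b u : R) : 0 < rho u ->
  is_derive u 1 (fun v => rho v `^ b) (b * u * rho u `^ (b - 2)).
Proof.
move=> u0.
have p0 : 0 < c2 + u ^+ 2 by rewrite -sqr_rho exprn_gt0.
have rE (s v : R) : rho v `^ s = (c2 + v ^+ 2) `^ (s / 2).
  by rewrite /rho -powR12_sqrt ?addr_ge0 ?sqr_ge0// -powRrM mulrC.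
under eq_fun do rewrite rE.
have d1 : is_derive u 1 (fun v : R => c2 + v ^+ 2) (2 * u).
  by apply: is_derive_eq; rewrite /GRing.scale/=; ring.
rewrite (_ : b * u * _ = (b / 2 * (c2 + u ^+ 2) `^ (b / 2 - 1)) * (2 * u)).
  apply: (@is_derive1_comp R (fun x => x `^ (b / 2)) (fun v => c2 + v ^+ 2)).
  exact: is_derive1_powR.
by rewrite rE (_ : (b - 2) / 2 = b / 2 - 1); field.
Qed.

End symbol_class.

(** The derivative b u rho^(b - 2) is a constant times the identity, which has weight rho, times a
    power of rho. The induction therefore runs over all real exponents at once, negative ones
    included. [C] does not depend on [c2], so it serves every line. *)
Lemma sym_rho_powR (R : realType) n (b : R) : exists2 C : R, 0 <= C &
  forall c2, 0 <= c2 -> sym c2 n (fun u => C * rho c2 u `^ b)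
    (fun u => (rho c2 u `^ b)%:C).
Proof.
elim: n b => [|n IH] b.
  exists 1 => // c2 c20; split => // u _.
  by rewrite normc_real ger0_norm ?powR_ge0// mul1r.
have [C C0 HC] := IH (b - 2).
exists (1 + 2 ^+ n * (2 ^+ n * `|b| * C)).
  by rewrite addr_ge0// !mulr_ge0// ?exprn_ge0.
move=> c2 c20; split.
  move=> u u0; rewrite normc_real ger0_norm ?powR_ge0// ler_peMl ?powR_ge0//.
  by rewrite lerDl !mulr_ge0// ?exprn_ge0.
exists (fun u => (b%:C * u%:C) * (rho c2 u `^ (b - 2))%:C); split.
  move=> u u0; rewrite -!rmorphM /=; split => /=; last exact: is_derive_cst.
  exact: is_derive_rho_powR.
apply: sym_le (symM (symM (sym_cst c2 n b%:C) (sym_id c20 n)) (HC _ c20)) _ => u u0.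
rewrite normc_real.
have -> : rho c2 u `^ b = rho c2 u `^ (b - 2) * (rho c2 u * rho c2 u).
  rewrite -expr2 -powR_mulrn ?rho_ge0// -powRDpos//; congr (_ `^ _); ring.
have -> : (1 + 2 ^+ n * (2 ^+ n * `|b| * C)) *
    (rho c2 u `^ (b - 2) * (rho c2 u * rho c2 u)) / rho c2 u =
    (1 + 2 ^+ n * (2 ^+ n * `|b| * C)) * (rho c2 u `^ (b - 2) * rho c2 u).
  by rewrite !mulrA mulfK// gt_eqF.
rewrite mulrDl mul1r.
have -> : 2 ^+ n * (2 ^+ n * (`|b| * rho c2 u) * (C * rho c2 u `^ (b - 2))) =
   2 ^+ n * (2 ^+ n * `|b| * C) * (rho c2 u `^ (b - 2) * rho c2 u) by ring.
by rewrite lerDr mulr_ge0 ?powR_ge0 ?rho_ge0.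
Qed.

Lemma symX (R : realType) (c2 : R) n a w f : sym c2 n w f ->
  sym c2 n (fun u => (2 ^+ n) ^+ a * w u ^+ a) (fun u => f u ^+ a).
Proof.
move=> sf; elim: a => [|a IH].
  apply: sym_le (sym_cst c2 n 1) _ => u _.
  by rewrite Normc.normc1 !expr0 mul1r.
rewrite (_ : (fun u => f u ^+ a.+1) = (fun u => f u * f u ^+ a)); last first.
  by apply/funext => u; rewrite exprS.
apply: sym_le (symM sf IH) _ => u _.
by rewrite !exprS le_eqVlt; apply/orP; left; apply/eqP; ring.
Qed.

Section sym_integral.
Variables (R : realType) (c2 s t : R).
Hypotheses (c20 : 0 <= c2) (st : s <= t).
Local Notation mu := (@lebesgue_measure R).
Local Notation rho := (rho c2).

Lemma near_continuous_le (w : R -> R) (u : R) : w v @[v --> u] --> w u ->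
  0 < rho u -> exists2 e, 0 < e &
  forall v, u - e < v < u + e -> 0 < rho v /\ w v <= w u + 1.
Proof.
move=> cw u0.
have /cvgrPdist_lt/(_ _ u0) := @continuous_rho R c2 u.
have /cvgrPdist_lt/(_ _ (@ltr01 R)) := cw.
move=> /nbhs_ballP[e1 /= e10 H1] /nbhs_ballP[e2 /= e20 H2].
exists (Num.min e1 e2); first by rewrite lt_min e10.
move=> v; rewrite -ltr_distl distrC lt_min => /andP[h1 h2].
have {}H1 : `|w u - w v| < 1 by exact: H1.
have {}H2 : `|rho u - rho v| < rho u by exact: H2.
move: H1 H2; rewrite !ltr_norml => /andP[H1 _] /andP[_ H2].
by split; lra.
Qed.

Lemma norm_Rintegral_itv_le (h : R -> R) (B : R) :
  measurable_fun `[s, t]%classic h -> (forall r, s <= r <= t -> `|h r| <= B) ->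
  `|(\int[mu]_(r in `[s, t]) h r)%R| <= B * (t - s).
Proof.
move=> mh hB.
have Icst := integrable_cst_itv s t B.
have Ih : mu.-integrable `[s, t] (EFin \o h).
  apply: (@dominated_integrable R _ (measurableTypeR R) mu `[s, t] h (fun=> B)) => //.
apply: le_trans (le_normr_Rintegral _ Ih) _ => //.
apply: (@le_trans _ _ (\int[mu]_(r in `[s, t]) B)%R).
  apply: le_Rintegral => //; exact: (integrable_norm Ih).
rewrite Rintegral_cst//= lebesgue_measure_itv/=.
(* The measure of the interval is given by cases on s < t; the remaining case is s = t, where both
   sides are 0. *)
case: ifP => //=; rewrite lte_fin => /negbT; rewrite -leNgt => ts.
by rewrite (_ : t = s) ?subrr//; apply/le_anti; rewrite ts.
Qed.

Lemma normc_cintegral_itv_le (h : R -> R[i]) (B : R) :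
  measurable_fun `[s, t]%classic (fun r => Re (h r) : R) ->
  measurable_fun `[s, t]%classic (fun r => Im (h r) : R) ->
  (forall r, s <= r <= t -> normc (h r) <= B) ->
  normc (cintegral mu `[s, t] h) <= 2 * (t - s) * B.
Proof.
move=> m1 m2 hB.
have h1 : `|Re (cintegral mu `[s, t] h)| <= B * (t - s).
  apply: norm_Rintegral_itv_le => // r rst.
  exact: le_trans (normr_Re_normc _) (hB _ rst).
have h2 : `|Im (cintegral mu `[s, t] h)| <= B * (t - s).
  apply: norm_Rintegral_itv_le => // r rst.
  exact: le_trans (normr_Im_normc _) (hB _ rst).
apply: (@le_trans _ _ (`|Re (cintegral mu `[s, t] h)| + `|Im (cintegral mu `[s, t] h)|)).
  rewrite -(@ler_pXn2r _ 2) ?nnegrE ?normc_ge0 ?addr_ge0// sqr_normcE sqrrD.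
  by rewrite !real_normK ?num_real// lerD2r lerDl mulrn_wge0// mulr_ge0.
by apply: le_trans (lerD h1 h2) _; rewrite le_eqVlt; apply/orP; left; apply/eqP; ring.
Qed.

(** One order is gained by differentiating under the integral, with domination from the continuity
    of [w]. Measurability in time passes from [f] to its derivatives, so the induction closes. The
    factor 2 comes from bounding real and imaginary parts separately and does not accumulate with
    the order. *)
Lemma sym_integral n (w : R -> R) (f : R -> R -> R[i]) :
  (forall u, 0 < rho u -> w v @[v --> u] --> w u) ->
  (forall r, s <= r <= t -> sym c2 n w (f r)) ->
  (forall u, 0 < rho u ->
    measurable_fun `[s, t]%classic (fun r => Re (f r u) : R) /\
    measurable_fun `[s, t]%classic (fun r => Im (f r u) : R)) ->
  sym c2 n (fun u => 2 * (t - s) * w u)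
    (fun u => cintegral mu `[s, t] (f ^~ u)).
Proof.
elim: n w f => [|n IH] w f cw sf mf.
  split => // u u0; have [m1 m2] := mf u u0.
  by apply: normc_cintegral_itv_le => // r rst; exact: sym_bound (sf r rst) u0.
split=> [u u0|].
  have [m1 m2] := mf u u0.
  by apply: normc_cintegral_itv_le => // r rst; exact: sym_bound (sf r rst) u0.
(* The class gives a derivative for each time separately; choice collects them into one function,
   equal to anything outside the interval. *)
have /choice[f' Hf'] : forall r, exists f' : R -> R[i], s <= r <= t ->
    (forall u, 0 < rho u -> cderiv (f r) u (f' u)) /\
    sym c2 n (fun u => w u / rho u) f'.
  move=> r; have [rst|nrst] := boolP (s <= r <= t); last by exists (fun=> 0).
  by have [_ [f' Hf']] := sf r rst; exists f'.
have cw' u : 0 < rho u -> w v / rho v @[v --> u] --> w u / rho u.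
  move=> u0; apply: cvgM; first exact: cw.
  by apply: cvgV; [rewrite gt_eqF|exact: continuous_rho].
have key u : 0 < rho u ->
    [/\ cderiv (fun v => cintegral mu `[s, t] (f ^~ v)) u (cintegral mu `[s, t] (f' ^~ u)),
     measurable_fun `[s, t]%classic (fun r => Re (f' r u) : R) &
     measurable_fun `[s, t]%classic (fun r => Im (f' r u) : R)].
  move=> u0.
  have [e1 e10 H1] := near_continuous_le (cw u u0) u0.
  have [e2 e20 H2] := near_continuous_le (cw' u u0) u0.
  pose e := Num.min e1 e2.
  have e0 : 0 < e by rewrite lt_min e10.
  have ve1 v : u - e < v < u + e -> 0 < rho v /\ w v <= w u + 1.
    rewrite -ltr_distl lt_min => /andP[h1 h2]; apply: H1.
    by rewrite -ltr_distl.
  have ve2 v : u - e < v < u + e -> w v / rho v <= w u / rho u + 1.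
    rewrite -ltr_distl lt_min => /andP[h1 h2]; apply: (H2 v _).2.
    by rewrite -ltr_distl.
  have bf r v : s <= r <= t -> u - e < v < u + e -> normc (f r v) <= w u + 1.
    move=> rst /ve1[v0 wv]; apply: le_trans wv; exact: sym_bound (sf r rst) v0.
  have bf' r v : s <= r <= t -> u - e < v < u + e -> normc (f' r v) <= w u / rho u + 1.
    move=> rst ve; have [v0 _] := ve1 v ve; apply: le_trans (ve2 v ve).
    exact: sym_bound (Hf' r rst).2 v0.
  have dRe r v : s <= r <= t -> u - e < v < u + e ->
      is_derive v 1 (fun v => Re (f r v) : R) (Re (f' r v)).
    by move=> rst /ve1[v0 _]; exact: ((Hf' r rst).1 v v0).1.
  have dIm r v : s <= r <= t -> u - e < v < u + e ->
      is_derive v 1 (fun v => Im (f r v) : R) (Im (f' r v)).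
    by move=> rst /ve1[v0 _]; exact: ((Hf' r rst).1 v v0).2.
  split.
  - split.
    + apply: (@is_derive_param_integral R (fun r v => Re (f r v)) (fun r v => Re (f' r v))
        s t u e (w u + 1) (w u / rho u + 1)) => //.
      * by move=> v /ve1[v0 _]; exact: (mf v v0).1.
      * by move=> r v rst ve; exact: le_trans (normr_Re_normc _) (bf r v rst ve).
      * by move=> r v rst ve; exact: le_trans (normr_Re_normc _) (bf' r v rst ve).
    + apply: (@is_derive_param_integral R (fun r v => Im (f r v)) (fun r v => Im (f' r v))
        s t u e (w u + 1) (w u / rho u + 1)) => //.
      * by move=> v /ve1[v0 _]; exact: (mf v v0).2.
      * by move=> r v rst ve; exact: le_trans (normr_Im_normc _) (bf r v rst ve).
      * by move=> r v rst ve; exact: le_trans (normr_Im_normc _) (bf' r v rst ve).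
  - apply: (@measurable_param_derivative R (fun r v => Re (f r v)) (fun r v => Re (f' r v))
      s t u e) => // v /ve1[v0 _]; exact: (mf v v0).1.
  - apply: (@measurable_param_derivative R (fun r v => Im (f r v)) (fun r v => Im (f' r v))
      s t u e) => // v /ve1[v0 _]; exact: (mf v v0).2.
exists (fun u => cintegral mu `[s, t] (f' ^~ u)); split.
  by move=> u /key[].
have := IH (fun u => w u / rho u) f' cw' (fun r rst => (Hf' r rst).2)
  (fun u u0 => let: And3 _ a b := key u u0 in conj a b).
by move=> h; apply: sym_le h _ => u _; rewrite mulrA.
Qed.

End sym_integral.

(** * Finite differences of symbols along a line *)

Section sym_differences.
Variables (R : realType) (c2 : R).
Local Notation rho := (rho c2).

Definition ldiff (y : R) (L : R -> R[i]) (u : R) : R[i] := L (u + y) - L u.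

Lemma cderiv_shift (L : R -> R[i]) (u y : R) l : cderiv L (u + y) l ->
  cderiv (fun v => L (v + y)) u l.
Proof.
move=> [h1 h2].
have da : is_derive u 1 (fun v : R => v + y) 1.
  by apply: is_derive_eq; rewrite addr0.
split.
  rewrite -[Re l]mulr1.
  exact: (@is_derive1_comp R (fun v => Re (L v)) (fun v => v + y)).
rewrite -[Im l]mulr1.
exact: (@is_derive1_comp R (fun v => Im (L v)) (fun v => v + y)).
Qed.

Lemma cderiv_iter_ldiff k (L L' : R -> R[i]) (y u : R) : 0 <= y ->
  (forall v, u <= v <= u + k%:R * y -> cderiv L v (L' v)) ->
  cderiv (iter k (ldiff y) L) u (iter k (ldiff y) L' u).
Proof.
move=> y0; elim: k u => [|k IH] u H.
  by apply: H; rewrite mul0r addr0 lexx.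
have ky0 : 0 <= k%:R * y by rewrite mulr_ge0.
rewrite !iterS; apply: cderivD.
  apply: cderiv_shift; apply: IH => v /andP[h1 h2]; apply: H.
  by rewrite -natr1 mulrDl mul1r; apply/andP; split; lra.
apply: cderivN; apply: IH => v /andP[h1 h2]; apply: H.
by rewrite -natr1 mulrDl mul1r; apply/andP; split; lra.
Qed.

Lemma derivative_bound (p p' : R -> R) (u y B : R) : 0 < y ->
  (forall v, u <= v <= u + y -> is_derive v 1 p (p' v)) ->
  (forall v, u <= v <= u + y -> `|p' v| <= B) -> `|p (u + y) - p u| <= y * B.
Proof.
move=> y0 dp p'B.
have [|v||v vI ->] := @MVT R p p' u (u + y).
- by rewrite ltrDl.
- by rewrite in_itv/= => /andP[/ltW h1 /ltW h2]; apply: dp; rewrite h1.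
- apply: derivable_within_continuous => v; rewrite in_itv/= => vI.
  by case: (dp v vI).
- move: vI; rewrite in_itv/= => /andP[/ltW h1 /ltW h2].
  rewrite addrAC subrr add0r normrM (ger0_norm (ltW y0)) mulrC.
  by rewrite ler_wpM2l ?(ltW y0)// p'B// h1.
Qed.

(** Differences commute with the derivative: the k-th difference of L has derivative the k-th
    difference of L', whose class has one order less and weight w / rho. Each mean value step gains
    a factor y. Real and imaginary parts are kept apart because their intermediate points differ. *)
Lemma sym_iter_ldiff k (w : R -> R) (L : R -> R[i]) (u y B : R) : 0 < y ->
  sym c2 k w L ->
  (forall v, u <= v <= u + k%:R * y -> 0 < rho v /\ w v / rho v ^+ k <= B) ->
  `|Re (iter k (ldiff y) L u)| <= y ^+ k * B /\
  `|Im (iter k (ldiff y) L u)| <= y ^+ k * B.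
Proof.
move=> y0; elim: k w L u => [|k IH] w L u sL H.
  have [u0 wB] : 0 < rho u /\ w u / rho u ^+ 0 <= B.
    by apply: H; rewrite mul0r addr0 lexx.
  rewrite expr0 divr1 in wB; rewrite expr0 mul1r.
  have LB := le_trans (sym_bound sL u0) wB.
  by split; [exact: le_trans (normr_Re_normc _) LB|exact: le_trans (normr_Im_normc _) LB].
move: (sL) => [_ [L' [dL sL']]].
have ky0 : 0 <= k%:R * y by rewrite mulr_ge0// ltW.
have kE : k.+1%:R * y = k%:R * y + y by rewrite -natr1 mulrDl mul1r.
have sub v v' : u <= v <= u + y -> v <= v' <= v + k%:R * y -> u <= v' <= u + k.+1%:R * y.
  by move=> /andP[h1 h2] /andP[h3 h4]; rewrite kE; apply/andP; split; lra.
have dP v : u <= v <= u + y ->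
    cderiv (iter k (ldiff y) L) v (iter k (ldiff y) L' v).
  move=> vu; apply: cderiv_iter_ldiff; first exact: ltW.
  by move=> v' vv'; apply: dL; have [] := H _ (sub _ _ vu vv').
have bP v : u <= v <= u + y ->
    `|Re (iter k (ldiff y) L' v)| <= y ^+ k * B /\
    `|Im (iter k (ldiff y) L' v)| <= y ^+ k * B.
  move=> vu; apply: IH sL' _ => v' vv'.
  have [v'0 wB] := H _ (sub _ _ vu vv'); split => //.
  by rewrite -mulrA -invfM -exprS.
rewrite iterS /ldiff !cReD !cImD !cReN !cImN exprS -mulrA; split.
- apply: (@derivative_bound (fun v => Re (iter k (ldiff y) L v))
    (fun v => Re (iter k (ldiff y) L' v))) => // v vu; first exact: (dP v vu).1.
  exact: (bP v vu).1.
- apply: (@derivative_bound (fun v => Im (iter k (ldiff y) L v))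
    (fun v => Im (iter k (ldiff y) L' v))) => // v vu; first exact: (dP v vu).2.
  exact: (bP v vu).2.
Qed.

Lemma eq_iter_ldiff k (L L' : R -> R[i]) (u y : R) : 0 <= y ->
  (forall v, u <= v <= u + k%:R * y -> L v = L' v) ->
  iter k (ldiff y) L u = iter k (ldiff y) L' u.
Proof.
move=> y0; elim: k u => [|k IH] u H.
  by apply: H; rewrite mul0r addr0 lexx.
have ky0 : 0 <= k%:R * y by rewrite mulr_ge0.
rewrite !iterS /ldiff; congr (_ - _); apply: IH => v /andP[h1 h2]; apply: H.
  by rewrite -natr1 mulrDl mul1r; apply/andP; split; lra.
by rewrite -natr1 mulrDl mul1r; apply/andP; split; lra.
Qed.

End sym_differences.

(** * The symbol of the kernel *)

Section lines.
Variables (R : realType) (d : nat).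
Implicit Types (x : d.-tuple R) (i : 'I_d) (u v y : R).

Definition transverse x i : R := \sum_(j < d | j != i) tnth x j ^+ 2.

Lemma transverse_ge0 x i : 0 <= transverse x i.
Proof. by apply: sumr_ge0 => j _; exact: sqr_ge0. Qed.

Lemma enorm_set_coord x i u : enorm (set_coord x i u) = rho (transverse x i) u.
Proof.
rewrite /enorm /rho /dotp (bigD1 i)//= !tnth_mktuple eqxx addrC; congr (Num.sqrt (_ + _)).
by apply: eq_bigr => j ji; rewrite tnth_mktuple (negbTE ji).
Qed.

Lemma set_coord_id x i : set_coord x i (tnth x i) = x.
Proof.
by apply: eq_from_tnth => j; rewrite tnth_mktuple; case: eqP => // ->.
Qed.

Lemma tnth_set_coord x i u : tnth (set_coord x i u) i = u.
Proof. by rewrite tnth_mktuple eqxx. Qed.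

Lemma set_coord_set_coord x i u v : set_coord (set_coord x i u) i v = set_coord x i v.
Proof.
by apply: eq_from_tnth => j; rewrite !tnth_mktuple; case: eqP.
Qed.

Lemma tadd_set_coord x i u y :
  tadd (set_coord x i u) (coord_vec i y) = set_coord x i (u + y).
Proof.
by apply: eq_from_tnth => j; rewrite !tnth_mktuple; case: eqP => // _; rewrite addr0.
Qed.

Lemma tscale_set_coord c x i u :
  tscale c (set_coord x i u) = set_coord (tscale c x) i (c * u).
Proof.
by apply: eq_from_tnth => j; rewrite !tnth_mktuple; case: eqP.
Qed.

Lemma iter_diffq_line k i y (g : d.-tuple R -> R[i]) x u :
  iter k (diffq i y) g (set_coord x i u) =
  iter k (ldiff y) (fun v => g (set_coord x i v)) u.
Proof.
elim: k u => // k IH u.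
by rewrite !iterS /diffq /ldiff tadd_set_coord !IH.
Qed.

Lemma le_rho_dist (c2 u v : R) : 0 <= c2 -> rho c2 u <= rho c2 v + `|u - v|.
Proof.
move=> c20.
rewrite -(@ler_pXn2r _ 2) ?nnegrE ?rho_ge0 ?addr_ge0 ?rho_ge0// sqrrD !sqr_rho//.
rewrite real_normK ?num_real//.
have h : v * (u - v) <= rho c2 v * `|u - v|.
  apply: le_trans (ler_norm _) _; rewrite normrM ler_wpM2r//.
  exact: normr_le_rho.
by rewrite -mulr_natl; lra.
Qed.

End lines.

Section pure_derivatives.
Variables (R : realType) (d : nat).

Definition pure_index (i : 'I_d) (j : nat) : d.-tuple nat :=
  [tuple if l == i then j else 0%N | l < d].

Lemma msize_pure_index i j : msize (pure_index i j) = j.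
Proof.
rewrite /msize (bigD1 i)//= tnth_mktuple eqxx big1 ?addn0// => l li.
by rewrite tnth_mktuple (negbTE li).
Qed.

Lemma mword_pure_index i j : mword (pure_index i j) = nseq j i.
Proof.
have H (s : seq 'I_d) : uniq s ->
    flatten [seq nseq (tnth (pure_index i j) l) l | l <- s] =
    if i \in s then nseq j i else [::].
  elim: s => //= l s IH /andP[ls us]; rewrite tnth_mktuple in_cons IH// (eq_sym i).
  have [li|//] := eqVneq l i.
  by rewrite li in ls *; rewrite (negbTE ls) cats0.
by rewrite /mword H ?enum_uniq// mem_enum.
Qed.

End pure_derivatives.

Section psi_lines.
Variables (R : realType) (d : nat) (gamma nu : R) (psi : R -> d.-tuple R -> R[i]).
Hypotheses (gamma0 : 0 < gamma) (nu0 : 0 < nu).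
Hypothesis Hpsi : symbol_assumptions gamma nu psi.

(** The parameter [j] counts derivatives already taken, so that the induction on [n] can pass from
    one pure derivative to the next. The chain rule gives lam^j and the symbol bound (lam
    rho)^(gamma - j); their product lam^gamma rho^gamma / rho^j has a power of lam that does not
    depend on j. *)
Lemma sym_psi_line (lam r : R) x (i : 'I_d) n j : 0 < lam ->
  (n + j <= d./2 + 1)%N ->
  sym (transverse x i) n
    (fun u => nu^-1 * lam `^ gamma * rho (transverse x i) u `^ gamma /
              rho (transverse x i) u ^+ j)
    (fun u => (lam ^+ j)%:C *
       partials (nseq j i) (psi r) (tscale lam (set_coord x i u))).
Proof.
move=> lam0; have [_ _ exD bD] := Hpsi.
have nz u : 0 < rho (transverse x i) u -> tscale lam (set_coord x i u) != tzero R d.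
  by move=> u0; rewrite -enorm_gt0 enorm_tscale mulr_gt0 ?normr_gt0 ?gt_eqF// enorm_set_coord.
elim: n j => [|n IH] j nj.
  split => // u u0.
  rewrite Normc.normcM normc_real ger0_norm ?exprn_ge0 ?(ltW lam0)//.
  have := bD (pure_index i j) r (tscale lam (set_coord x i u)).
  rewrite msize_pure_index /mderiv mword_pure_index => /(_ nj (nz u u0)) h.
  apply: le_trans (ler_wpM2l _ h) _; first by rewrite exprn_ge0// ltW.
  rewrite enorm_tscale enorm_set_coord (gtr0_norm lam0) powRM ?rho_ge0 ?(ltW lam0)//.
  have pB (z : R) : 0 < z -> z `^ (gamma - j%:R) = z `^ gamma / z ^+ j.
    by move=> z0; rewrite powRDpos// powRN powR_mulrn// ltW.
  rewrite !pB// le_eqVlt; apply/orP; left; apply/eqP.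
  by field; rewrite !expf_neq0 ?gt_eqF.
split.
  by move=> u u0; exact: sym_bound (IH j (ltnW nj)) u0.
exists (fun u => (lam ^+ j.+1)%:C *
  partials (nseq j.+1 i) (psi r) (tscale lam (set_coord x i u))); split; last first.
  have := IH j.+1; rewrite addnS => /(_ nj) h; apply: sym_le h _ => u u0.
  by rewrite exprSr invfM mulrA.
move=> u u0.
have := exD (pure_index i j.+1) r (tscale lam (set_coord x i u)).
rewrite msize_pure_index => /(_ _ (nz u u0)) h.
have {h}h : ex_mderiv (pure_index i j.+1) (psi r) (tscale lam (set_coord x i u)).
  by apply: h; rewrite (leq_trans _ nj)// addSn ltnS leq_addl.
(* Splitting the word i^(j+1) at its first letter yields the existence of the partial derivative of
   the j-fold derivative. *)
have := h [::] (nseq j i) i; rewrite mword_pure_index => /(_ erefl).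
rewrite /ex_partial tscale_set_coord tnth_set_coord => -[d1 d2].
set G := partials (nseq j i) (psi r) in d1 d2 *.
set eta := tscale lam x.
have dG : cderiv (fun h => G (set_coord eta i h)) (lam * u)
    (partial i G (set_coord eta i (lam * u))).
  rewrite /partial tnth_set_coord; split.
    have -> : (fun v => Re (G (set_coord eta i v)) : R) =
       (fun h => Re (G (set_coord (set_coord eta i (lam * u)) i h)) : R).
      by apply/funext => h'; rewrite set_coord_set_coord.
    by split => //=; rewrite derive1E.
  have -> : (fun v => Im (G (set_coord eta i v)) : R) =
       (fun h => Im (G (set_coord (set_coord eta i (lam * u)) i h)) : R).
    by apply/funext => h'; rewrite set_coord_set_coord.
  by split => //=; rewrite derive1E.
have := cderivM (cderiv_cst (lam ^+ j)%:C u) (cderiv_affine dG).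
rewrite mul0r add0r mulrA -rmorphM /= -exprSr.
rewrite (_ : (fun v => _ * G (set_coord eta i (lam * v))) =
  (fun v => (lam ^+ j)%:C * G (tscale lam (set_coord x i v)))) //.
by apply/funext => v; rewrite tscale_set_coord.
Qed.

End psi_lines.

(** * Absorbing powers by the exponential factor *)

Section decay.
Variable R : realType.

Lemma expR_ge_pow (z : R) N : 0 <= z -> (z / N.+1%:R) ^+ N.+1 <= expR z.
Proof.
move=> z0; have -> : expR z = expR (z / N.+1%:R) ^+ N.+1.
  by rewrite -expRM_natr mulrAC -mulrA divff ?mulr1// pnatr_eq0.
apply: lerXn2r; rewrite ?nnegrE ?divr_ge0 ?expR_ge0//.
by apply: le_trans (expR_ge1Dx _); rewrite lerDr.
Qed.

(** In terms of tau = z^gamma the power is tau^(m / gamma). For tau <= 1 both factors are at most 1,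
    the summand 1 of the constant. For tau > 1 the exponent is raised to an integer N + 1 and
    compared with the lower bound (x / (N + 1))^(N + 1) of exp x at x = nu tau. *)
Lemma powR_expR_bound (gamma nu m : R) : 0 < gamma -> 0 < nu -> 0 <= m ->
  exists2 C : R, 0 <= C & forall z, 0 < z -> z `^ m * expR (- (nu * z `^ gamma)) <= C.
Proof.
move=> g0 nu0 m0.
pose N := Num.bound (m / gamma).
have Nm : m / gamma <= N.+1%:R.
  have /ltW := archi_boundP (divr_ge0 m0 (ltW g0)); rewrite -/N => h.
  by apply: le_trans h _; rewrite ler_nat.
exists (1 + (N.+1%:R / nu) ^+ N.+1); first by rewrite addr_ge0// exprn_ge0// divr_ge0// ltW.
move=> z z0; pose tau := z `^ gamma.
have tau0 : 0 < tau by exact: powR_gt0.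
have e1 : expR (- (nu * tau)) <= 1 by rewrite -expR0 ler_expR oppr_le0 mulr_ge0 ?ltW.
have -> : z `^ m = tau `^ (m / gamma).
  by rewrite /tau -powRrM; congr (_ `^ _); field; rewrite gt_eqF.
rewrite -/tau.
have [t1|t1] := leP tau 1.
  apply: (@le_trans _ _ 1); last by rewrite lerDl exprn_ge0// divr_ge0// ltW.
  rewrite -[leRHS]mulr1; apply: ler_pM; rewrite ?powR_ge0 ?expR_ge0//.
  have -> : 1 = (1 : R) `^ (m / gamma) by rewrite powR1.
  by apply: ge0_ler_powR; rewrite ?nnegrE ?divr_ge0 ?(ltW tau0)// ltW.
apply: (@le_trans _ _ (tau ^+ N.+1 * expR (- (nu * tau)))).
  rewrite ler_wpM2r ?expR_ge0// -powR_mulrn ?(ltW tau0)//.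
  exact: ler_powR (ltW t1) _ _ Nm.
rewrite expRN ler_pdivrMr ?expR_gt0//.
have := expR_ge_pow N (mulr_ge0 (ltW nu0) (ltW tau0)) => h.
have c0 : 0 <= (N.+1%:R / nu) ^+ N.+1 by rewrite exprn_ge0// divr_ge0// ltW.
have E : tau ^+ N.+1 = (N.+1%:R / nu) ^+ N.+1 * (nu * tau / N.+1%:R) ^+ N.+1.
  have K0 : (N.+1%:R : R) != 0 by rewrite pnatr_eq0.
  rewrite -exprMn; congr (_ ^+ _); move: (N.+1%:R : R) K0 => K K0.
  by field; rewrite K0 gt_eqF.
rewrite E; apply: le_trans (ler_wpM2l c0 h) _.
by rewrite ler_wpM2r ?expR_ge0// lerDr.
Qed.

(** Each factor of [expweight] adds at most one power z^gamma, which is moved into z^m; hence the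
    induction is over all m at once. *)
Lemma expweight_bound (gamma nu M : R) n (m : R) : 0 < gamma -> 0 < nu -> 0 <= M -> 0 <= m ->
  exists2 C : R, 0 <= C & forall z, 0 < z ->
    z `^ m * expweight n (expR (- (nu * z `^ gamma))) (M * z `^ gamma) <= C.
Proof.
move=> g0 nu0 M0; elim: n m => [|n IH] m m0; first exact: powR_expR_bound.
have [C1 C10 H1] := IH m m0.
have [C2 C20 H2] := IH (m + gamma) (addr_ge0 m0 (ltW g0)).
exists (C1 + 2 ^+ n * M * C2).
  by rewrite addr_ge0// !mulr_ge0// exprn_ge0.
move=> z z0 /=.
rewrite mulrDr mulr1 mulrDr lerD ?H1//.
set E := expweight _ _ _.
have -> : z `^ m * (E * (2 ^+ n * (M * z `^ gamma))) =
  2 ^+ n * M * (z `^ (m + gamma) * E) by rewrite powRDpos//; ring.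
by rewrite ler_wpM2l ?H2// mulr_ge0// exprn_ge0.
Qed.

Lemma normr_cos_sub1_le (z : R) : `|cos z - 1| <= `|z|.
Proof.
wlog z0 : z / 0 < z => [H|].
  have [z0|z0|->] := ltgtP z 0.
  - by have := H (- z); rewrite cosN normrN; apply; rewrite oppr_gt0.
  - exact: H.
  - by rewrite cos0 subrr.
have := @derivative_bound R cos (fun v => - sin v) 0 z 1 z0.
rewrite add0r cos0 mulr1 (gtr0_norm z0); apply => v _.
by rewrite normrN normr_sin_le1.
Qed.

Lemma normr_sin_le (z : R) : `|sin z| <= `|z|.
Proof.
wlog z0 : z / 0 < z => [H|].
  have [z0|z0|->] := ltgtP z 0.
  - by have := H (- z); rewrite sinN !normrN; apply; rewrite oppr_gt0.
  - exact: H.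
  - by rewrite sin0.
have := @derivative_bound R sin (fun v => cos v) 0 z 1 z0.
rewrite add0r sin0 subr0 mulr1 (gtr0_norm z0); apply => v _.
exact: normr_cos_le1.
Qed.

Lemma normc_cexp_sub1 (z : R[i]) : Re z <= 0 -> normc (cexp z - 1) <= 3 * normc z.
Proof.
move=> z0.
have eu : expR (Re z) <= 1 by rewrite -expR0 ler_expR.
have eu0 := expR_ge0 (Re z).
have e1 : 1 - expR (Re z) <= `|Re z|.
  by have := expR_ge1Dx (Re z); rewrite ler0_norm//; lra.
(* Rotation and dilation are separated: the first is at most 2 |Im z|, the second at most |Re z|,
   which gives the constant 3. *)
have -> : cexp z - 1 = (expR (Re z))%:C * (cexp ((Im z) *i) - 1) + (expR (Re z) - 1)%:C.
  by rewrite cexpi; apply: complexP; rewrite /cexp ?cReD ?cImD ?cReN ?cImN ?cReM ?cImM /=; ring.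
apply: le_trans (normc_leD _ _) _; rewrite Normc.normcM !normc_real.
rewrite (ger0_norm eu0) (ler0_norm (_ : expR (Re z) - 1 <= 0)); last by lra.
have h1 : normc (cexp ((Im z) *i) - 1) <= 2 * `|Im z|.
  rewrite cexpi (_ : _ - 1 = (cos (Im z) - 1)%:C + (sin (Im z)) *i); last first.
    by apply: complexP => /=; ring.
  apply: le_trans (normc_leD _ _) _; rewrite normc_real.
  have -> : normc (sin (Im z)) *i = `|sin (Im z)|.
    by rewrite /normc expr0n add0r sqrtr_sqr.
  by have := normr_cos_sub1_le (Im z); have := normr_sin_le (Im z); lra.
have h2 : expR (Re z) * normc (cexp ((Im z) *i) - 1) <= 1 * (2 * `|Im z|).
  by apply: ler_pM => //; exact: normc_ge0.
have := normr_Re_normc z; have := normr_Im_normc z; lra.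
Qed.

End decay.

(** * The rescaled symbol of the kernel *)

Definition q_symbol (R : realType) (d : nat) (gamma : R)
    (psi : R -> d.-tuple R -> R[i]) (a : nat) (b s t : R) (xi : d.-tuple R) : R[i] :=
  let eta := tscale ((t - s) `^ (- (1 / gamma))) xi in
  ((t - s)%:C * psi t eta) ^+ a * (enorm xi `^ b)%:C *
  cexp (cintegral (@lebesgue_measure R) `[s, t] (psi ^~ eta)).

Section symbol.
Variables (R : realType) (d : nat) (gamma nu : R) (psi : R -> d.-tuple R -> R[i]).
Hypotheses (d0 : (0 < d)%N) (gamma0 : 0 < gamma) (nu0 : 0 < nu).
Hypothesis Hpsi : symbol_assumptions gamma nu psi.
Variables (a : nat) (b s t : R).
Hypothesis st : s < t.
Local Notation mu := (@lebesgue_measure R).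
Local Notation k := (d./2.+1).
Local Notation lam := ((t - s) `^ (- (1 / gamma))).
Local Notation phase xi := (cintegral mu `[s, t] (psi ^~ (tscale lam xi))).

Let T0 : 0 < t - s. Proof. by rewrite subr_gt0. Qed.

Let lam0 : 0 < lam. Proof. exact: powR_gt0. Qed.

(** The scaling identity behind the uniformity in s < t: it cancels the length of the time interval
    and the factor t - s in front of psi. *)
Let lamE : lam `^ gamma = (t - s)^-1.
Proof.
rewrite -powRrM (_ : - (1 / gamma) * gamma = -1); last by field; rewrite gt_eqF.
by rewrite powR_inv1// ltW.
Qed.

Let nuV0 : 0 <= nu^-1. Proof. by rewrite invr_ge0 ltW. Qed.

Let sym_psi r x i : sym (transverse x i) k
  (fun u => nu^-1 * lam `^ gamma * rho (transverse x i) u `^ gamma)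
  (fun u => psi r (tscale lam (set_coord x i u))).
Proof.
have := @sym_psi_line R d gamma nu psi nu0 Hpsi lam r x i k 0 lam0.
rewrite addn0 addn1 => /(_ (leqnn _)).
rewrite (_ : (fun u => (lam ^+ 0)%:C * _) =
  (fun u => psi r (tscale lam (set_coord x i u)))); last first.
  by apply/funext => u; rewrite expr0; exact: mul1r.
by move=> h; apply: sym_le h _ => u _; rewrite expr0 divr1.
Qed.

Lemma measurable_psi_time eta :
  measurable_fun [set: R] (fun r => Re (psi r eta) : R) /\
  measurable_fun [set: R] (fun r => Im (psi r eta) : R).
Proof.
have [[m1 m2] _ _ _] := Hpsi; split.
  exact: (@measurable_fun_pair1 _ _ _ R _ _ (fun p : R * d.-tuple R => Re (psi p.1 p.2)) eta m1).
exact: (@measurable_fun_pair1 _ _ _ R _ _ (fun p : R * d.-tuple R => Im (psi p.1 p.2)) eta m2).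
Qed.

Lemma sym_phase x i : sym (transverse x i) k
  (fun u => 2 * nu^-1 * rho (transverse x i) u `^ gamma)
  (fun u => phase (set_coord x i u)).
Proof.
have h := @sym_integral R (transverse x i) s t (ltW st) k
  (fun u => nu^-1 * lam `^ gamma * rho (transverse x i) u `^ gamma)
  (fun r u => psi r (tscale lam (set_coord x i u))).
have {}h := h _ (fun r _ => sym_psi r x i).
apply: sym_le (h _ _) _.
- move=> u u0; apply: cvgMl_tmp.
  exact: is_derive_continuous (is_derive_rho_powR (transverse_ge0 x i) gamma u0).
- move=> u u0; have [m1 m2] := measurable_psi_time (tscale lam (set_coord x i u)).
  by split; exact: measurable_funTS.
- move=> u u0; rewrite lamE le_eqVlt; apply/orP; left; apply/eqP.
  by field; rewrite !gt_eqF.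
Qed.

Lemma normc_psi_le r eta : eta != tzero R d ->
  normc (psi r eta) <= nu^-1 * enorm eta `^ gamma.
Proof.
move=> e0; have [_ _ _ bD] := Hpsi.
have := bD (pure_index (Ordinal d0) 0) r eta.
by rewrite msize_pure_index /mderiv mword_pure_index subr0 => /(_ isT e0).
Qed.

(** Integrating the upper bound on Re psi requires Re psi to be integrable in time. That follows
    from the order-zero bound on psi, which holds off the origin only. *)
Lemma Re_phase_le xi : 0 < enorm xi -> Re (phase xi) <= - (nu * enorm xi `^ gamma).
Proof.
move=> xi0; have [_ reP _ _] := Hpsi.
set eta := tscale lam xi.
have etaE : enorm eta `^ gamma = (t - s)^-1 * enorm xi `^ gamma.
  by rewrite enorm_tscale gtr0_norm// powRM ?lamE ?enorm_ge0// ltW.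
have e0 : eta != tzero R d.
  by rewrite -enorm_gt0 enorm_tscale mulr_gt0// normr_gt0 gt_eqF.
have [m1 m2] := measurable_psi_time eta.
have I1 : mu.-integrable `[s, t] (EFin \o (fun r => Re (psi r eta) : R)).
  apply: (@dominated_integrable R _ (measurableTypeR R) mu `[s, t] _
    (fun=> nu^-1 * enorm eta `^ gamma)) => //; last exact: integrable_cst_itv.
  - exact: measurable_funTS.
  - by move=> r _; apply: le_trans (normr_Re_normc _) _; exact: normc_psi_le.
rewrite /cintegral /=.
apply: (@le_trans _ _ (\int[mu]_(r in `[s, t]) (- nu * enorm eta `^ gamma))%R).
  apply: le_Rintegral => //; exact: integrable_cst_itv.
rewrite Rintegral_cst//= lebesgue_measure_itv/= lte_fin st /= etaE.
by rewrite le_eqVlt; apply/orP; left; apply/eqP; field; rewrite gt_eqF.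
Qed.

Definition weight (n : nat) (z : R) : R :=
  expweight n (expR (- (nu * z `^ gamma))) (2 * nu^-1 * z `^ gamma).

(** The powers of 2^k are Leibniz factors: two for multiplying the three factors, one per
    multiplication in the a-th power, and one inside each copy of (t - s) psi. [Cb] enters as a
    hypothesis so that it can be fixed before psi, s and t. *)
Lemma sym_q_symbol Cb x i : 0 <= Cb ->
  (forall c2, 0 <= c2 -> sym c2 k (fun u => Cb * rho c2 u `^ b)
    (fun u => (rho c2 u `^ b)%:C)) ->
  sym (transverse x i) k
    (fun u => 2 ^+ k * (2 ^+ k * ((2 ^+ k) ^+ a * (2 ^+ k * nu^-1) ^+ a * Cb)) *
      (rho (transverse x i) u `^ (gamma * a%:R + b) * weight k (rho (transverse x i) u)))
    (fun u => q_symbol gamma psi a b s t (set_coord x i u)).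
Proof.
move=> Cb0 HCb; set c2 := transverse x i.
have c20 : 0 <= c2 by exact: transverse_ge0.
have sP : sym c2 k (fun u => 2 ^+ k * nu^-1 * rho c2 u `^ gamma)
    (fun u => (t - s)%:C * psi t (tscale lam (set_coord x i u))).
  apply: sym_le (symM (sym_cst c2 k (t - s)%:C) (sym_psi t x i)) _ => u _.
  rewrite normc_real (gtr0_norm T0) lamE le_eqVlt; apply/orP; left; apply/eqP.
  by field; rewrite !gt_eqF.
have eP u : 0 < rho c2 u ->
    expR (Re (phase (set_coord x i u))) <= expR (- (nu * rho c2 u `^ gamma)).
  move=> u0; rewrite ler_expR; apply: le_trans (Re_phase_le _) _.
    by rewrite enorm_set_coord.
  by rewrite enorm_set_coord.
have h := symM (symM (symX a sP) (HCb c2 c20)) (sym_exp (sym_phase x i) eP).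
rewrite (_ : (fun u => q_symbol _ _ _ _ _ _ _) = (fun u =>
   ((t - s)%:C * psi t (tscale lam (set_coord x i u))) ^+ a *
   (rho c2 u `^ b)%:C * cexp (phase (set_coord x i u)))); last first.
  by apply/funext => u; rewrite /q_symbol enorm_set_coord.
apply: sym_le h _ => u u0; rewrite -/(weight k (rho c2 u)) powRDpos// powRrM powR_mulrn ?powR_ge0//.
rewrite [(_ * rho c2 u `^ gamma) ^+ a]exprMn.
by rewrite le_eqVlt; apply/orP; left; apply/eqP; ring.
Qed.

Lemma cmeasurable_q_symbol : cmeasurable (q_symbol gamma psi a b s t).
Proof.
have [[m1 m2] _ _ _] := Hpsi.
have mlam : measurable_fun setT (fun xi : d.-tuple R => (t, tscale lam xi)).
  by apply: measurable_fun_pair => //; exact: measurable_tscale.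
have mp : measurable_fun setT (fun p : d.-tuple R * measurableTypeR R =>
    (p.2 : R, tscale lam p.1)).
  apply: measurable_fun_pair => //.
  exact: (measurableT_comp (measurable_tscale _)).
apply: cmeasurableM; first apply: cmeasurableM.
- apply: cmeasurableX; apply: cmeasurableM; first by split.
  by split; [exact: (measurableT_comp m1 mlam)|exact: (measurableT_comp m2 mlam)].
- split => //=; apply: (measurableT_comp (measurable_powR _)).
  exact: measurable_enorm.
apply: cmeasurable_cexp; split => /=.
- apply: (@measurable_Rintegral_param R _ _ (d.-tuple R) (measurableTypeR R) mu `[s, t]
    (fun p => Re (psi p.2 (tscale lam p.1)))) => //.
  exact: (measurableT_comp m1 mp).
- apply: (@measurable_Rintegral_param R _ _ (d.-tuple R) (measurableTypeR R) mu `[s, t]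
    (fun p => Im (psi p.2 (tscale lam p.1)))) => //.
  exact: (measurableT_comp m2 mp).
Qed.

End symbol.

(** Allows the symbol to be redefined at the origin, where its size is not controlled by the
    assumptions on psi. *)
Lemma cintegral_eq_off_zero (R : realType) (d : nat) (f g : d.-tuple R -> R[i]) :
  (0 < d)%N -> cmeasurable f -> cmeasurable g ->
  (forall xi, xi != tzero R d -> f xi = g xi) ->
  cintegral (lebesgue_tuple R d) setT f = cintegral (lebesgue_tuple R d) setT g.
Proof.
move=> d0 [f1 f2] [g1 g2] fg.
have N : (lebesgue_tuple R d).-negligible [set tzero R d].
  apply/negligibleP; last exact: lebesgue_tuple_tzero.
  rewrite (_ : [set _] = [set x : d.-tuple R | enorm x <= 0]).
    rewrite -[X in measurable X]setTI.
    by apply: measurable_fun_le => //; exact: measurable_enorm.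
  apply/seteqP; split => x /=; first by move=> ->; rewrite enorm_tzero.
  by move=> x0; apply/eqP; rewrite -enorm_eq0 eq_le x0 enorm_ge0.
have H (u v : d.-tuple R -> R) : measurable_fun setT u -> measurable_fun setT v ->
    (forall xi, xi != tzero R d -> u xi = v xi) ->
    (\int[lebesgue_tuple R d]_xi u xi)%R = (\int[lebesgue_tuple R d]_xi v xi)%R.
  move=> mu mv uv; congr fine; apply: ae_eq_integral => //.
  - exact/measurable_EFinP.
  - exact/measurable_EFinP.
  apply: negligibleS N => xi /=.
  by apply: contra_notP => /eqP xi0 _; rewrite uv.
by apply: complexP; apply: H => // xi xi0; rewrite fg.
Qed.

(** The constant subtracted is the limit of the symbol at the origin: 1 if a = b = 0, and 0
    otherwise. The approach to it is of order gamma in the first case, from the phase, and of order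
    gamma a + b in the second, from the prefactor. *)
Lemma q_symbol_estimates (R : realType) (d : nat) (gamma nu beta b : R) (a : nat) :
  (0 < d)%N -> 0 < gamma -> 0 < nu -> 0 <= b -> 0 < beta ->
  (if (a == 0%N) && (b == 0) then beta <= gamma else beta <= gamma * a%:R + b) ->
  exists2 C : R, 0 <= C & forall (psi : R -> d.-tuple R -> R[i]) s t, symbol_assumptions gamma nu psi -> s < t ->
    [/\ forall xi : d.-tuple R, 0 < enorm xi -> normc (q_symbol gamma psi a b s t xi) <= C,
        forall xi, 0 < enorm xi -> normc (q_symbol gamma psi a b s t xi) <=
          C * enorm xi `^ (- (d%:R + 1)) &
        forall x i, sym (transverse x i) d./2.+1
          (fun u => C * rho (transverse x i) u `^ beta)
          (fun u => q_symbol gamma psi a b s t (set_coord x i u) -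
             ((a == 0%N) && (b == 0))%:R)].
Proof.
move=> d0 g0 nu0 b0 be0 Hbe.
set k := d./2.+1.
have [Cb Cb0 HCb] := sym_rho_powR k b.
have M0 : 0 <= 2 * nu^-1 by rewrite mulr_ge0// invr_ge0 ltW.
have m0 : 0 <= gamma * a%:R + b by rewrite addr_ge0// mulr_ge0// ltW.
pose Cg : R := 2 ^+ k * (2 ^+ k * ((2 ^+ k) ^+ a * (2 ^+ k * nu^-1) ^+ a * Cb)).
have Cg0 : 0 <= Cg.
  by rewrite !mulr_ge0 ?exprn_ge0 ?mulr_ge0 ?exprn_ge0// invr_ge0 ltW.
have [C1 C10 H1] := expweight_bound k g0 nu0 M0 m0.
(* The d + 1 additional powers of |xi| are divided out again to give the decay bound. *)
have m20 : 0 <= gamma * a%:R + b + (d%:R + 1) by rewrite addr_ge0// addr_ge0.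
have [C2 C20 H2] := expweight_bound k g0 nu0 M0 m20.
have [C3 C30 H3] : exists2 C3 : R, 0 <= C3 & forall (psi : R -> d.-tuple R -> R[i]) s t,
    symbol_assumptions gamma nu psi -> s < t -> forall x i, sym (transverse x i) k
      (fun u => C3 * rho (transverse x i) u `^ beta)
      (fun u => q_symbol gamma psi a b s t (set_coord x i u) -
             ((a == 0%N) && (b == 0))%:R).
  move: Hbe; case: ifPn => [/andP[/eqP a0 /eqP bz] beg|_ bem].
    have g_be : 0 <= gamma - beta by rewrite subr_ge0.
    (* The order is k - 1 because one derivative is spent on the phase; that derivative supplies
       rho^gamma, of which rho^beta is kept and rho^(gamma - beta) absorbed. *)
    have [C3 C30 H3] := expweight_bound d./2 g0 nu0 M0 g_be.
    have K0 : 0 <= 2 ^+ d./2 * (2 * nu^-1) * C3 by rewrite mulr_ge0// mulr_ge0// exprn_ge0.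
    (* The three terms serve order zero for rho > 1, order zero for rho <= 1, and the
       derivatives. *)
    exists (2 + 3 * (2 * nu^-1) + 2 ^+ d./2 * (2 * nu^-1) * C3).
      by rewrite addr_ge0 ?K0// addr_ge0// mulr_ge0.
    move=> psi s t Hpsi st x i; set c2 := transverse x i.
    have sP := sym_phase g0 nu0 Hpsi st x i.
    have eP u : 0 < rho c2 u -> expR (Re (cintegral (@lebesgue_measure R) `[s, t]
        (psi ^~ (tscale ((t - s) `^ (- (1 / gamma))) (set_coord x i u))))) <=
        expR (- (nu * rho c2 u `^ gamma)).
      move=> u0; rewrite ler_expR; have := @Re_phase_le R d gamma nu psi d0 g0 Hpsi s t st.
      by move=> /(_ (set_coord x i u)); rewrite enorm_set_coord; exact.
    rewrite (_ : (fun u => q_symbol _ _ _ _ _ _ _ - 1) = (fun u =>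
       cexp (cintegral (@lebesgue_measure R) `[s, t]
        (psi ^~ (tscale ((t - s) `^ (- (1 / gamma))) (set_coord x i u)))) - 1)); last first.
      by apply/funext => u; rewrite /q_symbol a0 bz expr0 powRr0 !mul1r.
    apply: (sym_exp_sub1 sP eP) => u u0; last first.
      apply: (@le_trans _ _ (2 ^+ d./2 * (2 * nu^-1) * C3 * rho c2 u `^ beta)); last first.
        by rewrite ler_wpM2r ?powR_ge0// lerDr addr_ge0// mulr_ge0.
      set E := expweight _ _ _.
      have -> : 2 * nu^-1 * rho c2 u `^ gamma =
          2 * nu^-1 * (rho c2 u `^ (gamma - beta) * rho c2 u `^ beta).
        by rewrite -powRDpos// subrK.
      have -> : 2 ^+ d./2 * (2 * nu^-1 * (rho c2 u `^ (gamma - beta) * rho c2 u `^ beta) * E)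
         = 2 ^+ d./2 * (2 * nu^-1) * (rho c2 u `^ (gamma - beta) * E) * rho c2 u `^ beta.
        by ring.
      rewrite ler_wpM2r ?powR_ge0// ler_wpM2l//; last exact: H3.
      by rewrite mulr_ge0// exprn_ge0.
    set z := cintegral _ _ _.
    have zb : normc z <= 2 * nu^-1 * rho c2 u `^ gamma := sym_bound sP u0.
    have rez : Re z <= 0.
      have := @Re_phase_le R d gamma nu psi d0 g0 Hpsi s t st.
      move=> /(_ (set_coord x i u)); rewrite enorm_set_coord => /(_ u0) h.
      by apply: le_trans h _; rewrite oppr_le0 mulr_ge0 ?powR_ge0// ltW.
    (* For small rho, |exp z - 1| <= 3 |z| and rho^gamma <= rho^beta; for large rho, |exp z - 1| <=
       2 and rho^beta >= 1. *)
    have [r1|r1] := leP (rho c2 u) 1.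
      apply: le_trans (normc_cexp_sub1 rez) _.
      apply: (@le_trans _ _ (3 * (2 * nu^-1 * rho c2 u `^ beta))).
        rewrite ler_wpM2l//; apply: le_trans zb _; rewrite ler_wpM2l//.
        by apply: ger_powR => //; rewrite u0.
      rewrite mulrA ler_wpM2r ?powR_ge0//; lra.
    apply: (@le_trans _ _ 2).
      apply: le_trans (normc_leB _ _) _; rewrite Normc.normc1 normc_cexp.
      have : expR (Re z) <= 1 by rewrite -expR0 ler_expR.
      lra.
    rewrite -[leLHS]mulr1; apply: ler_pM => //.
      by rewrite -addrA lerDl addr_ge0// mulr_ge0.
    have : (1 : R) `^ beta <= rho c2 u `^ beta.
      by apply: ge0_ler_powR; rewrite ?nnegrE ?rho_ge0 ?(ltW be0)// ltW.
    by rewrite powR1.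
  (* Here rho^beta is split off from the prefactor rho^(gamma a + b), and the nonnegative power left
     over is absorbed by the exponential. *)
  have bem0 : 0 <= gamma * a%:R + b - beta by rewrite subr_ge0.
  have [C3 C30 H3] := expweight_bound k g0 nu0 M0 bem0.
  exists (Cg * C3); first by rewrite mulr_ge0.
  move=> psi s t Hpsi st x i; set c2 := transverse x i.
  have sq := sym_q_symbol d0 g0 nu0 Hpsi a st x i Cb0 HCb.
  rewrite (_ : (fun u => _ - _) = (fun u => q_symbol gamma psi a b s t (set_coord x i u))); last first.
    by apply/funext => u; rewrite subr0.
  apply: sym_le sq _ => u u0; rewrite -/Cg -mulrA ler_wpM2l//.
  rewrite -[X in rho _ u `^ X](subrK beta) powRDpos// mulrAC.
  by rewrite ler_wpM2r ?powR_ge0// H3.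
exists (Cg * C1 + Cg * C2 + C3).
  by rewrite !addr_ge0// mulr_ge0.
move=> psi s t Hpsi st.
(* Pointwise bounds are the order-zero part of the class on the line through [xi] along the first
   axis. *)
have bnd xi : 0 < enorm xi -> normc (q_symbol gamma psi a b s t xi) <=
    Cg * (enorm xi `^ (gamma * a%:R + b) * weight gamma nu k (enorm xi)).
  move=> xi0; pose i := Ordinal d0.
  have sq := sym_q_symbol d0 g0 nu0 Hpsi a st xi i Cb0 HCb.
  have := sym_bound sq (u := tnth xi i).
  by rewrite -!enorm_set_coord set_coord_id; apply.
split.
- move=> xi xi0; apply: le_trans (bnd _ xi0) _.
  apply: (@le_trans _ _ (Cg * C1)); first by rewrite ler_wpM2l// H1.
  by rewrite -addrA lerDl addr_ge0// mulr_ge0.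
- move=> xi xi0; apply: le_trans (bnd _ xi0) _.
  apply: (@le_trans _ _ (Cg * C2 * enorm xi `^ (- (d%:R + 1)))); last first.
    by rewrite ler_wpM2r ?powR_ge0// addrAC lerDr addr_ge0// mulr_ge0.
  rewrite -mulrA ler_wpM2l//.
  have := H2 _ xi0; rewrite powRDpos// => h.
  have p0 : 0 < enorm xi `^ (d%:R + 1) by exact: powR_gt0.
  by rewrite powRN ler_pdivlMr// mulrAC.
- move=> x i; apply: sym_le (H3 psi s t Hpsi st x i) _ => u u0.
  by rewrite ler_wpM2r ?powR_ge0// lerDr addr_ge0// mulr_ge0.
Qed.

(** The condition on [y] keeps the segment from xi to xi + k y e_i at distance at least |xi|/2 from
    the origin. The negative power beta - k is thus at worst taken at |xi|/2, whence 2^(k - beta),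
    and [h] and [f] agree at every point used. The leading 2 adds real and imaginary parts. *)
Lemma sym_iter_diffq_le (R : realType) (d k : nat) (beta C : R)
    (h f : d.-tuple R -> R[i]) (i : 'I_d) (y : R) (xi : d.-tuple R) :
  0 <= C -> 0 < y -> (0 < k)%N -> beta <= k%:R -> 2 * k%:R * y <= enorm xi ->
  sym (transverse xi i) k (fun u => C * rho (transverse xi i) u `^ beta)
    (fun u => f (set_coord xi i u)) ->
  (forall eta, 0 < enorm eta -> h eta = f eta) ->
  normc (iter k (diffq i y) h xi) <=
    2 * (C * 2 `^ (k%:R - beta)) * y ^+ k * enorm xi `^ (beta - k%:R).
Proof.
move=> C0 y0 k0 bk kxi sf hf; set c2 := transverse xi i in sf *.
have c20 : 0 <= c2 by exact: transverse_ge0.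
have ky0 : 0 < k%:R * y by rewrite mulr_gt0// ltr0n.
have xi0 : 0 < enorm xi by apply: lt_le_trans kxi; rewrite -mulrA mulr_gt0.
have half v : tnth xi i <= v <= tnth xi i + k%:R * y -> enorm xi / 2 <= rho c2 v.
  move=> /andP[v1 v2].
  have := le_rho_dist (tnth xi i) v c20.
  rewrite -enorm_set_coord set_coord_id distrC ger0_norm ?subr_ge0//; lra.
have vpos v : tnth xi i <= v <= tnth xi i + k%:R * y -> 0 < rho c2 v.
  by move=> /half; apply: lt_le_trans; rewrite divr_gt0.
pose B := C * (enorm xi / 2) `^ (beta - k%:R).
have BE : B = C * 2 `^ (k%:R - beta) * enorm xi `^ (beta - k%:R).
  have h2 : (2^-1 : R) `^ (beta - k%:R) = 2 `^ (k%:R - beta).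
    by rewrite -powR_inv1// -powRrM; congr (_ `^ _); ring.
  by rewrite /B powRM ?enorm_ge0// h2; ring.
have wB v : tnth xi i <= v <= tnth xi i + k%:R * y ->
    0 < rho c2 v /\ C * rho c2 v `^ beta / rho c2 v ^+ k <= B.
  move=> hv; have v0 := vpos v hv; split => //.
  have -> : C * rho c2 v `^ beta / rho c2 v ^+ k = C * rho c2 v `^ (beta - k%:R).
    by rewrite powRDpos// powRN powR_mulrn ?mulrA// ltW.
  rewrite ler_wpM2l// -opprB !powRN lef_pV2 ?posrE ?powR_gt0 ?divr_gt0//.
  apply: ge0_ler_powR; rewrite ?nnegrE ?rho_ge0 ?half ?subr_ge0//.
  by rewrite divr_ge0 ?enorm_ge0.
have [hR hI] := sym_iter_ldiff y0 sf wB.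
have E : iter k (diffq i y) h xi =
    iter k (ldiff y) (fun u => f (set_coord xi i u)) (tnth xi i).
  rewrite -[xi in LHS](set_coord_id xi i) iter_diffq_line.
  apply: eq_iter_ldiff; first exact: ltW.
  by move=> v hv; apply: hf; rewrite enorm_set_coord vpos.
rewrite E; set z := iter _ _ _ _.
have zRI : normc z <= `|Re z| + `|Im z|.
  rewrite -(@ler_pXn2r _ 2) ?nnegrE ?normc_ge0 ?addr_ge0// sqr_normcE sqrrD.
  by rewrite !real_normK ?num_real// lerD2r lerDl mulrn_wge0// mulr_ge0.
apply: le_trans zRI _; apply: le_trans (lerD hR hI) _.
by rewrite BE le_eqVlt; apply/orP; left; apply/eqP; ring.
Qed.

Theorem lemma3p5 (R : realType) (d : nat) (gamma nu : R) (a : nat)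
    (b delta : R) :
  (0 < d)%N -> 0 < gamma -> 0 < nu -> 0 <= b ->
  (a = 0%N /\ b = 0) \/ 0 < gamma * a%:R + b ->
  0 < delta ->
  (0 < gamma * a%:R + b -> delta < Num.min (1 / 2) (gamma * a%:R + b)) ->
  (a = 0%N /\ b = 0 -> delta < Num.min (1 / 2) gamma) ->
  exists N : R, forall psi : R -> d.-tuple R -> R[i],
    symbol_assumptions gamma nu psi ->
    (ereal_sup [set \int[lebesgue_tuple R d]_x
        (Normc.normc ((enorm x `^ (d%:R / 2 + delta))%:C *
                q_kernel gamma psi a b st.1 st.2 x) ^+ 2)%R%:E
      | st in [set st : R * R | (st.1 < st.2)%R]] <= N%:E)%E.
Proof.
move=> d0 g0 nu0 b0 Hab dl0 Hd1 Hd2.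
pose z : bool := (a == 0%N) && (b == 0).
(* The order at which the symbol approaches its limit at the origin, which [beta] may not exceed. *)
pose e0 : R := if z then gamma else gamma * a%:R + b.
have dle : delta < Num.min (1 / 2) e0.
  rewrite /e0 /z; case: ifPn => [/andP[/eqP a0 /eqP bz]|nz]; first exact: Hd2.
  apply: Hd1; case: Hab => // -[a0 bz]; move: nz.
  by rewrite a0 bz !eqxx.
move: dle; rewrite lt_min => /andP[dl2 dle].
(* The midpoint leaves room on both sides: beta > delta for the geometric series, beta < 1/2 for the
   tail. *)
pose beta : R := (delta + Num.min (1 / 2) e0) / 2.
have [be1 be2 be3] : [/\ delta < beta, beta < 1 / 2 & beta <= e0].
  by rewrite /beta; case: (leP (1 / 2) e0) => h; split; lra.
pose k := d./2.+1.
(* For odd d one has 2k = d + 1, and the inequality is exactly beta < 1/2. *)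
have dk : d%:R < 2 * (k%:R - beta).
  have : (d.+1 <= 2 * k)%N.
    rewrite mul2n doubleS ltnS -[leqLHS]odd_double_half -[leqRHS]add1n leq_add2r.
    exact: leq_b1.
  rewrite -(ler_nat R) natrM -natr1; lra.
have bek : beta <= k%:R.
  have : (1 : R) <= k%:R by rewrite ler1n.
  lra.
have Hbe : if (a == 0%N) && (b == 0) then beta <= gamma else beta <= gamma * a%:R + b.
  by move: be3; rewrite /e0 /z; case: ifP.
have be0 : 0 < beta by lra.
have [C C0 HC] := q_symbol_estimates d0 g0 nu0 b0 be0 Hbe.
(* The added 1 accounts for the value given to the symbol at the origin, of modulus at most 1. *)
have C10 : 0 <= C + 1 by lra.
have C20 : 0 <= 2 * (C * 2 `^ (k%:R - beta)) by rewrite mulr_ge0// mulr_ge0// powR_ge0.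
have [N HN] := @weighted_fourier_bound R d k beta delta (C + 1) C _
  d0 isT dl0 be1 dk C10 C0 C20.
exists N => psi Hpsi; apply: ge_ereal_sup => _ [[s t] st' <-].
have st : s < t := st'.
have [E1 E2 E3] := HC psi s t Hpsi st.
have mG := cmeasurable_q_symbol Hpsi a b s t.
set G := q_symbol gamma psi a b s t in E1 E2 E3 mG.
pose c : R[i] := z%:R.
(* With the limit [c] as value at the origin, the bounds on g and on g - c hold at every point. *)
pose g xi := if enorm xi <= 0 then c else G xi.
have gG xi : 0 < enorm xi -> g xi = G xi.
  by move=> xi0; rewrite /g leNgt xi0.
have g0E xi : enorm xi <= 0 -> g xi = c by move=> xi0; rewrite /g xi0.
have mg : cmeasurable g.
  have mle : measurable_fun setT (fun xi : d.-tuple R => enorm xi <= 0).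
    by apply: measurable_fun_ler => //; exact: measurable_enorm.
  split.
    rewrite (_ : (fun x => _) = (fun x => if enorm x <= 0 then Re c else Re (G x))).
      by apply: measurable_fun_ifT => //; exact: mG.1.
    by apply/funext => x; rewrite /g; case: ifP.
  rewrite (_ : (fun x => _) = (fun x => if enorm x <= 0 then Im c else Im (G x))).
    by apply: measurable_fun_ifT => //; exact: mG.2.
  by apply/funext => x; rewrite /g; case: ifP.
have c1 : normc c <= 1 by rewrite /c; case: (z); rewrite ?Normc.normc1 ?Normc.normc0.
have qE x : q_kernel gamma psi a b (s, t).1 (s, t).2 x = inverse_fourier g x.
  rewrite /q_kernel /inverse_fourier; congr (_ * _).
  apply: cintegral_eq_off_zero => //.
  - apply: cmeasurableM; [exact: cmeasurable_character|exact: mG].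
  - apply: cmeasurableM; [exact: cmeasurable_character|exact: mg].
  by move=> xi xi0; rewrite gG// enorm_gt0.
rewrite (eq_integral (fun x => (normc ((enorm x `^ (d%:R / 2 + delta))%:C *
  inverse_fourier g x) ^+ 2)%:E)); last by move=> x _; rewrite qE.
apply: (HN g c) => //.
- move=> xi; have [xi0|xi0] := leP (enorm xi) 0.
    by rewrite g0E//; apply: le_trans c1 _; rewrite lerDr.
  by rewrite gG//; apply: le_trans (E1 _ xi0) _; rewrite lerDl.
- move=> xi xi0; rewrite gG//; apply: le_trans (E2 _ xi0) _.
  by rewrite ler_wpM2r ?powR_ge0// lerDl.
- move=> xi; have [xi0|xi0] := leP (enorm xi) 0.
    by rewrite g0E// subrr Normc.normc0 mulr_ge0 ?powR_ge0.
  rewrite gG//; pose i := Ordinal d0.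
  have := sym_bound (E3 xi i) (u := tnth xi i).
  by rewrite -!enorm_set_coord set_coord_id; apply.
- move=> i y xi y0 kxi.
  rewrite -(iter_diffq_sub_cst i y g c).
  apply: (@sym_iter_diffq_le R d k beta C _ (fun eta => G eta - c)) => //.
  by move=> eta eta0; rewrite gG.
Qed.
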